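(* Let $S\subseteq\mathbb{R}^D$ be compact and let $\{X_n\}_{n\in\mathbb{N}}$ be i.i.d. processes in $C(S)$ distributed as $X$, defined on a probability space $(\Omega,\mathfrak P,\mathbb{P})$. Let $K\in\mathbb{N}$ and $r_1,\dots,r_K\in\mathbb{N}$ with $1\le r_1<\dots<r_K$, and write $\boldsymbol r=(r_1,\dots,r_K)$. Assume that $X$ has $\mathcal{L}^{2r_K}$-Hölder continuous paths and that there exists $s\in S$ with $\mathbb{E}[X^{2r_K}(s)]<\infty$. Let $H\in C^1(\mathbb{R}^K,\mathbb{R})$, and let $\tilde G$ be the zero-mean Gaussian process with paths in $C(S)$ and covariance $$\tilde{\mathfrak c}(s,s')=\mathrm{d}H_{\boldsymbol\mu^{(\boldsymbol r)}(s)}\,\mathfrak c(s,s')\,\mathrm{d}H_{\boldsymbol\mu^{(\boldsymbol r)}(s')}^T,\qquad \mathfrak c_{kl}(s,s')=\mathbb{E}[X^{r_k}(s)X^{r_l}(s')]-\mu^{(r_k)}(s)\mu^{(r_l)}(s').$$ Let $\{g_{N,n}:N\in\mathbb{N},1\le n\le N\}$ be a triangular array of i.i.d. random variables on a probability space $(\Omega_g,\mathfrak P_g,\mathbb{P}_g)$ with $\mathbb{E}[g_{N,1}]=0$ and $\mathbb{E}[g_{N,1}^2]=1$, and on the product space $(\Omega\times\Omega_g,\mathfrak P\otimes\mathfrak P_g,\mathbb{P}\otimes\mathbb{P}_g)$ define the multiplier bootstrap process $$\tilde G_N^{(g,\boldsymbol r)}(\omega_g,\omega)=\frac1{\sqrt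 N}\sum_{n=1}^N g_{N,n}(\omega_g)\,\tilde R^{(\boldsymbol r)}_{N,n}(\omega),$$ where $\tilde R^{(\boldsymbol r)}_{N,n}=\mathrm{d}H_{\hat{\boldsymbol\mu}^{(\boldsymbol r)}_N}\big(X_n^{r_1}-\hat\mu_N^{(r_1)},\dots,X_n^{r_K}-\hat\mu_N^{(r_K)}\big)^T$. Then, as $N\to\infty$: (i) $\tilde G_N^{(g,\boldsymbol r)}\rightsquigarrow\tilde G$ in $C(S)$; (ii) $\displaystyle\sup_{h\in\mathcal B}\Big|\mathbb{E}_g\big[h\big(\tilde G_N^{(g,\boldsymbol r)}\big)\big]-\mathbb{E}\big[h(\tilde G)\big]\Big|\to0$ in probability with respect to $(\Omega,\mathfrak P,\mathbb{P})$, where $\mathbb{E}_g$ denotes expectation with respect to $(\Omega_g,\mathfrak P_g,\mathbb{P}_g)$ only (with $\omega$ fixed), and $\mathcal B$ is the set of all $h:C(S)\to\mathbb{R}$ with $\sup_{f\in C(S)}|h(f)|\le1$ and $|h(f)-h(f')|\le\|f-f'\|_\infty$ for all $f,f'\in C(S)$.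
   Context: $C(S)$ is the Banach space of continuous real functions on $S$ with the maximum norm $\|\cdot\|_\infty$, and $\rightsquigarrow$ denotes weak convergence. For $r\in\mathbb{N}$, $\mu^{(r)}(s)=\mathbb{E}[X^r(s)]$, $\hat\mu^{(r)}_N(s)=\frac1N\sum_{n=1}^N X_n^r(s)$, where $X^r(s)=(X(s))^r$; $\boldsymbol\mu^{(\boldsymbol r)}=(\mu^{(r_1)},\dots,\mu^{(r_K)})$ and $\hat{\boldsymbol\mu}^{(\boldsymbol r)}_N=(\hat\mu^{(r_1)}_N,\dots,\hat\mu^{(r_K)}_N)$. $\mathrm{d}H_x$ is the derivative of $H$ at $x$, a $1\times K$ row vector, and functions of $s$ are composed and multiplied pointwise. Random variables on $\Omega$ and on $\Omega_g$ are extended to the product space in the obvious way, so the multipliers $g_{N,n}$ are independent of the $X_n$. Definition: for $p\in\mathbb{N}$, a process $Y$ in $C(S)$ has $\mathcal{L}^p$-Hölder continuous paths of order $\alpha\in(0,1]$ if, almost surely, $|Y(s)-Y(s')|\le L\,|s-s'|^\alpha$ for all $s,s'\in S$, with $L$ a positive random variable satisfying $\mathbb{E}[L^p]<\infty$ (some order $\alpha$ is assumed). *)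

(* Defs.v *)
From HB Require Import structures.
From mathcomp Require Import all_boot all_order all_algebra.
From mathcomp Require Import finmap.
From mathcomp Require Import all_classical all_reals all_analysis.

Set Implicit Arguments.
Unset Strict Implicit.
Unset Printing Implicit Defensive.

Import Order.TTheory GRing.Theory Num.Theory.
Import numFieldNormedType.Exports.

Local Open Scope classical_set_scope.
Local Open Scope ring_scope.

Set Warnings "-redundant-canonical-projection".

Definition CS (R : realType) (D : nat) (S : set 'rV[R]_D) : Type :=
  continuousType S R.

(* C(S) carries the topology of uniform convergence on S and its Borel
   sigma-algebra; the null function serves as the default point. *)
Section CS_structures.
Import ArrowAsUniformType.
Context (R : realType) (D : nat) (S : set 'rV[R]_D).

HB.instance Definition _ := Choice.on (CS S).
HB.instance Definition _ := isPointed.Build (CS S) (cst (0 : R) : continuousType S R).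
HB.instance Definition _ := PseudoMetric.copy (CS S)
  (initial_topology (id : continuousType S R -> (S -> R))).
HB.instance Definition _ := Measurable.copy (CS S)
  (g_sigma_algebraType (@open (CS S))).

Lemma ball_CSE (f f' : CS S) (e : R) :
  ball f e f' = forall s : S, ball (f s) e (f' s).
Proof. by []. Qed.

Lemma nbhs_CSP (f : CS S) (A : set (CS S)) :
  nbhs f A <-> exists2 e : R, 0 < e &
    forall f' : CS S, (forall s : S, `|f s - f' s| < e) -> A f'.
Proof.
split.
- move/nbhs_ballP => [e e0 fA]; exists e; first exact: e0.
  by move=> f' ff'; apply: fA; rewrite /= ball_CSE => s; exact: ff'.
- move=> [e e0 fA]; apply/nbhs_ballP; exists e; first exact: e0.
  by move=> f'; rewrite /= ball_CSE => ff'; apply: fA => s; exact: ff'.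
Qed.

Lemma measurable_CSE : (measurable : set (set (CS S))) = <<s @open (CS S) >>.
Proof. by []. Qed.

End CS_structures.

Definition maxnorm (T : Type) (R : realType) (u : T -> R) : R :=
  sup (range (fun s => `|u s|)).

(* `|x| on row vectors is the maximum norm, hence a separate definition. *)
Definition euclid (R : realType) (D : nat) (x : 'rV[R]_D) : R :=
  Num.sqrt (\sum_(i < D) x 0 i ^+ 2).

Section probability.
Context (R : realType).

Definition mutually_independent d (T : measurableType d) (P : probability T R)
    d' (E : measurableType d') (I : choiceType) (Y : I -> T -> E) : Prop :=
  forall (J : {fset I}) (A : I -> set E), (forall i, measurable (A i)) ->
    P (\bigcap_(i in [set` J]) (Y i @^-1` A i)) =
    (\prod_(i <- J) P (Y i @^-1` A i))%E.

Definition same_law d (T : measurableType d) (P : probability T R)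
    d1 (T1 : measurableType d1) (P1 : probability T1 R)
    d' (E : measurableType d') (Y : T -> E) (Y1 : T1 -> E) : Prop :=
  forall A : set E, measurable A -> P (Y @^-1` A) = P1 (Y1 @^-1` A).

Definition iid d (T : measurableType d) (P : probability T R)
    d' (E : measurableType d') (I : choiceType) (Y : I -> {RV P >-> E}) : Prop :=
  mutually_independent P Y /\ forall i j, same_law P P (Y i) (Y j).

(* Normal law, including the degenerate one (a point mass), which
   normal_prob does not give for a null standard deviation. *)
Definition normal_rv d (T : measurableType d) (P : probability T R)
    (Y : T -> R) : Prop :=
  exists m sigma : R, forall A : set R, measurable A ->
    P (Y @^-1` A) =
      if sigma == 0 then (\d_m A)%E else normal_prob m sigma A.

(* All finite-dimensional marginals are multivariate normal, i.e. all their
   linear combinations are normal. *)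
Definition gaussian_process d (T : measurableType d) (P : probability T R)
    (D : nat) (S : set 'rV[R]_D) (Z : T -> CS S) : Prop :=
  forall (m : nat) (s : 'I_m -> S) (a : 'I_m -> R),
    normal_rv P (fun w => \sum_(i < m) a i * Z w (s i)).

Definition zero_mean_gaussian_with_cov d (T : measurableType d)
    (P : probability T R) (D : nat) (S : set 'rV[R]_D) (Z : T -> CS S)
    (c : S -> S -> R) : Prop :=
  [/\ gaussian_process P Z,
      forall s : S, ('E_P[fun w => Z w s] = 0)%E &
      forall s s' : S,
        covariance P (fun w => Z w s) (fun w => Z w s') = (c s s')%:E].

Definition Lp_hoelder d (T : measurableType d) (P : probability T R)
    (D : nat) (S : set 'rV[R]_D) (p : nat) (alpha : R) (Y : T -> CS S) : Prop :=
  exists L : {RV P >-> R},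
    [/\ forall w, 0 < L w,
        ('E_P[fun w => (L w ^+ p)%R] < +oo)%E &
        {ae P, forall w, forall s s' : S,
          `|Y w s - Y w s'| <= L w * euclid (val s - val s') `^ alpha}].

Definition weak_cvg d (T : measurableType d) (P : probability T R)
    d' (T' : measurableType d') (P' : probability T' R)
    (D : nat) (S : set 'rV[R]_D) (Y : nat -> T -> CS S) (Z : T' -> CS S) : Prop :=
  [/\ forall N, measurable_fun setT (Y N), measurable_fun setT Z &
      forall h : CS S -> R, continuous h -> (exists M, forall f, `|h f| <= M) ->
        ('E_P[h \o Y N])%E @[N --> \oo] --> ('E_P'[h \o Z])%E].

(* mu_ext P is the outer measure of P; it agrees with P on measurable events,
   so no measurability of U N needs to be presupposed. *)
Definition cvg_to0_in_prob d (T : measurableType d) (P : probability T R)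
    (U : nat -> T -> \bar R) : Prop :=
  forall e : R, 0 < e ->
    mu_ext P [set w | (e%:E < `|U N w|)%E] @[N --> \oo] --> 0%E.

Definition BL1 (D : nat) (S : set 'rV[R]_D) : set (CS S -> R) :=
  [set h | (forall f, `|h f| <= 1) /\
           (forall f f' : CS S, `|h f - h f'| <= maxnorm (fun s => f s - f' s))].

End probability.

Arguments BL1 {R D} S _.

Section derivative.
Context (R : realType) (K : nat).

Definition dH (H : 'rV[R]_K -> R) (x : 'rV[R]_K) : 'rV[R]_K :=
  \row_k 'd H x (delta_mx 0 k).

Definition C1 (H : 'rV[R]_K -> R) : Prop :=
  (forall x, differentiable H x) /\ continuous (dH H).

End derivative.

Section moments.
Context (R : realType) (D : nat) (S : set 'rV[R]_D) (K : nat).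
Context d (T : measurableType d) (P : probability T R).
Implicit Types (X : T -> CS S) (s : S).

Definition moment X (q : nat) s : R := fine 'E_P[fun w => (X w s ^+ q)%R]%E.

Definition moments X (r : 'I_K -> nat) s : 'rV[R]_K :=
  \row_k moment X (r k) s.

Definition cov_powers X (r : 'I_K -> nat) s s' : 'M[R]_K :=
  \matrix_(k, l) (fine 'E_P[fun w => (X w s ^+ r k * X w s' ^+ r l)%R]%E
                  - moment X (r k) s * moment X (r l) s').

Definition cov_delta (H : 'rV[R]_K -> R) X (r : 'I_K -> nat) s s' : R :=
  (dH H (moments X r s) *m cov_powers X r s s' *m (dH H (moments X r s'))^T) 0 0.

End moments.

Lemma continuous_sumR (R : realType) (T : topologicalType) (I : Type)
    (s : seq I) (F : I -> T -> R) :
  (forall i, continuous (F i)) -> continuous (fun t => \sum_(i <- s) F i t).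
Proof.
move=> cF; apply: continuous_big => //; exact: add_continuous.
Qed.

Lemma continuous_mulR (R : realType) (T : topologicalType) (f g : T -> R) :
  continuous f -> continuous g -> continuous (fun t => f t * g t).
Proof. by move=> cf cg t; apply: cvgM; [exact: cf|exact: cg]. Qed.

(* For one realization x of the sample and a of the multipliers. *)
Section bootstrap.
Context (R : realType) (D : nat) (S : set 'rV[R]_D) (K : nat).
Context (H : 'rV[R]_K -> R) (r : 'I_K -> nat) (N : nat) (x : 'I_N -> CS S).
Implicit Type s : S.

Definition emp_moment (q : nat) s : R := N%:R^-1 * \sum_(n < N) x n s ^+ q.

Definition emp_moments s : 'rV[R]_K := \row_k emp_moment (r k) s.

Definition delta_residual (n : 'I_N) s : R :=
  (dH H (emp_moments s) *m
     (\row_k (x n s ^+ r k - emp_moment (r k) s))^T) 0 0.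

Definition bootstrap_fun (a : 'I_N -> R) s : R :=
  (Num.sqrt N%:R)^-1 * \sum_(n < N) a n * delta_residual n s.

Lemma continuous_pow_path n q : continuous (fun s => x n s ^+ q).
Proof.
move=> s; apply: (@continuous_comp _ _ _ (x n) (fun y : R => y ^+ q)).
  exact: cts_fun.
exact: exprn_continuous.
Qed.

Lemma continuous_emp_moment q : continuous (emp_moment q).
Proof.
apply: (@continuous_mulR _ _ (cst N%:R^-1)); first exact: cst_continuous.
apply: (@continuous_sumR _ _ _ _ (fun n t => x n t ^+ q)) => n.
exact: continuous_pow_path.
Qed.

Lemma continuous_emp_moments : continuous emp_moments.
Proof.
move=> s A [B nB BA].
have nk k : \forall t \near s, B 0 k (emp_moment (r k) t).
  by apply: continuous_emp_moment; have := nB 0 k; rewrite mxE.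
have nB' : \forall t \near s, forall k, B 0 k (emp_moment (r k) t).
  exact: (@filter_forall _ _ (fun k t => B 0 k (emp_moment (r k) t)) (nbhs s) _ nk).
apply: (@filterS _ (nbhs s) _ _ _ _ nB') => t Bt.
by apply: BA => i k; rewrite ord1 mxE.
Qed.

Lemma continuous_bootstrap_fun (HC1 : C1 H) a : continuous (bootstrap_fun a).
Proof.
have [_ cH] := HC1.
apply: (@continuous_mulR _ _ (cst (Num.sqrt N%:R)^-1)).
  exact: cst_continuous.
apply: (@continuous_sumR _ _ _ _ (fun n t => a n * delta_residual n t)) => n.
apply: (@continuous_mulR _ _ (cst (a n))); first exact: cst_continuous.
have -> : delta_residual n = fun t => \sum_(k < K)
    dH H (emp_moments t) 0 k * (x n t ^+ r k - emp_moment (r k) t).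
  by apply/funext => u; rewrite /delta_residual mxE;
     apply: eq_bigr => k _; congr (_ * _); rewrite 2!mxE.
apply: (@continuous_sumR _ _ _ _ (fun k t =>
    dH H (emp_moments t) 0 k * (x n t ^+ r k - emp_moment (r k) t))) => k.
apply: continuous_mulR => t.
  apply: (@continuous_comp _ _ _ (fun t => dH H (emp_moments t))
            (fun M : 'rV[R]_K => M 0 k)); last exact: coord_continuous.
  apply: (@continuous_comp _ _ _ emp_moments (dH H)); last exact: cH.
  exact: continuous_emp_moments.
apply: (@cvgB _ _ _ (nbhs t) _ (fun u => x n u ^+ r k) (emp_moment (r k))).
  exact: continuous_pow_path.
exact: continuous_emp_moment.
Qed.

Definition bootstrap (HC1 : C1 H) (a : 'I_N -> R) : CS S :=
  @mkcts _ _ (bootstrap_fun a) (continuous_bootstrap_fun HC1 (a:=a)).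

End bootstrap.

(* Main.v *)
Require Import Defs.
From HB Require Import structures.
From mathcomp Require Import all_boot all_order all_algebra.
From mathcomp Require Import finmap ring lra.
From mathcomp Require Import all_classical all_reals all_analysis measurable_realfun.
Set Implicit Arguments.
Unset Strict Implicit.
Unset Printing Implicit Defensive.
Import Order.TTheory GRing.Theory Num.Theory.
Import numFieldNormedType.Exports.
Local Open Scope classical_set_scope.
Local Open Scope ring_scope.

(** The two sources of randomness are treated separately. With the sample
    fixed, the bootstrap process is a weighted sum of the multipliers, and only
    a few deterministic properties of the sample matter ([typical]): the
    centred powers of the paths are dominated, together with their Hölder
    constants, by numbers b_n whose squares have a bounded average and whose
    maximum is small compared with sqrt N; the empirical moments are uniformly
    close to the true ones; and the empirical covariances are close to the true
    ones on a finite net. [bootstrap_close] says that for such a sample the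
    multiplier expectation of h is close to its Gaussian expectation, uniformly
    over the bounded Lipschitz tests h. By [typical_vanishing] the sample is
    typical outside an event of vanishing probability; this uses a law of large
    numbers ([lln_mean]) for finitely many functionals of a path, and the
    moment hypotheses enter through the envelope [bound], which is
    square-integrable by [hnorm_moment]. Statement (ii) follows at once.
    Statement (i) follows by integrating over the sample (Fubini), then passing
    from bounded Lipschitz to bounded continuous tests by inf-convolution
    ([portmanteau]).

    To prove [bootstrap_close], the derivative of H is moved from the empirical
    to the true moments, and the process is replaced by the interpolation of
    its values on a net. Both errors are bounded by suprema and oscillations of
    sums of g_n a_n(s), which [chaining] controls. There remains a random vector
    of fixed dimension, compared with its Gaussian counterpart by [fd_clt].

    The multipliers have only a second moment, so their sums need not have
    sub-Gaussian tails. The maximal inequality under the chaining avoids tails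
    altogether: the soft maximum log(sum_i e^(x_i) + e^(-x_i)) is expanded to
    second order each time a summand is added; the linear term is centred, by
    independence, and the quadratic one is at most 4 b_n^2 g_n^2
    ([lse_step], [mean_lse_psum]). Hence the expected maximum of |A| sums is at
    most log(2|A|) + 4 sum_n b_n^2; along the chain log|A| grows linearly with the
    level, while the increments shrink geometrically.

    In [fd_clt] the characteristic functions converge by Lindeberg's argument
    ([mean_char_psum]). A Lipschitz test function is then approximated by a
    trigonometric polynomial: a Bernstein operator whose coins have the biases
    sin(z_i/l). The error ([bernstein_approx]) depends on the test function only
    through its Lipschitz constant, which gives the uniformity over h. The
    characteristic function of the normal law comes from Stein's identity
    ([stein]). *)

(** * Means of real random variables *)

Section mean.
Context (R : realType) d (T : measurableType d) (P : probability T R).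
Implicit Types f g : T -> R.

Definition L1 f : Prop := P.-integrable setT (EFin \o f).

Definition mean f : R := (\int[P]_x f x)%R.

Lemma meanE f : L1 f -> (\int[P]_x (f x)%:E)%E = (mean f)%:E.
Proof. by move=> f1; rewrite /mean /Rintegral fineK//; exact: integrable_fin_num. Qed.

Lemma expectationE f : L1 f -> 'E_P[f]%E = (mean f)%:E.
Proof. by move=> f1; rewrite unlock meanE. Qed.

Lemma L1P f : L1 f <-> measurable_fun setT f /\ (\int[P]_x (`|f x|)%:E < +oo)%E.
Proof.
split=> [/integrableP[mf fi]|[mf fi]]; first by split=> //; exact/measurable_EFinP.
by apply/integrableP; split => //; exact/measurable_EFinP.
Qed.

Lemma L1_measurable f : L1 f -> measurable_fun setT f.
Proof. by move/L1P => -[]. Qed.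

Lemma eq_L1 f g : f =1 g -> L1 f -> L1 g.
Proof. by move=> /funext ->. Qed.

Lemma L1_bounded f M : measurable_fun setT f -> (forall x, `|f x| <= M) -> L1 f.
Proof.
move=> mf fM; apply: measurable_bounded_integrable => //.
  by rewrite (le_lt_trans (probability_le1 _ _))// ltry.
by exists M; split; [exact: num_real|move=> z Mz x _; exact: (le_trans (fM x) (ltW Mz))].
Qed.

Lemma L1_cst c : L1 (fun=> c).
Proof. by apply: (@L1_bounded _ `|c|). Qed.

Lemma L1D f g : L1 f -> L1 g -> L1 (fun x => f x + g x).
Proof.
move=> f1 g1; rewrite /L1 (_ : EFin \o _ = (EFin \o f) \+ (EFin \o g))%E//.
exact: integrableD.
Qed.

Lemma L1Z c f : L1 f -> L1 (fun x => c * f x).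
Proof.
by move=> f1; rewrite /L1 (_ : EFin \o _ = (fun x => c%:E * (EFin \o f) x))%E//; exact: integrableZl.
Qed.

Lemma L1N f : L1 f -> L1 (fun x => - f x).
Proof.
move=> f1; rewrite (_ : (fun x => - f x) = fun x => -1 * f x); first exact: L1Z.
by apply/funext => x; rewrite mulN1r.
Qed.

Lemma L1B f g : L1 f -> L1 g -> L1 (fun x => f x - g x).
Proof. by move=> f1 g1; exact: L1D f1 (L1N g1). Qed.

Lemma L1_abs f : L1 f -> L1 (fun x => `|f x|).
Proof. by move=> /integrable_norm. Qed.

Lemma L1_le f g : measurable_fun setT f -> L1 g -> (forall x, `|f x| <= g x) -> L1 f.
Proof.
move=> mf g1 fg; apply: (le_integrable _ _ _ g1) => //.
  exact/measurable_EFinP.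
by move=> x _ /=; rewrite lee_fin (le_trans (fg x))// ler_norm.
Qed.

Lemma L1_sqrt f : measurable_fun setT f -> L1 (fun x => f x ^+ 2) -> L1 f.
Proof.
move=> mf f2; apply: (L1_le mf (L1D (L1_cst 1) f2)) => x.
rewrite -(real_normK (num_real (f x))); move: `|f x| => y.
by have := sqr_ge0 (y - 1); have := sqr_ge0 y; rewrite sqrrB expr1n; lra.
Qed.

Lemma L1_sum (I : Type) (s : seq I) (Q : pred I) (F : I -> T -> R) :
  (forall i, Q i -> L1 (F i)) -> L1 (fun x => \sum_(i <- s | Q i) F i x).
Proof.
move=> F1; elim: s => [|i s IH].
  by apply: eq_L1 (L1_cst 0) => x; rewrite big_nil.
have [Qi|Qi] := boolP (Q i).
  by apply: eq_L1 (L1D (F1 _ Qi) IH) => x; rewrite big_cons Qi.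
by apply: eq_L1 IH => x; rewrite big_cons (negbTE Qi).
Qed.

Lemma eq_mean f g : f =1 g -> mean f = mean g.
Proof. by move=> /funext ->. Qed.

Lemma mean_cst c : mean (fun=> c) = c.
Proof.
rewrite /mean Rintegral_cst// -[RHS]mulr1; congr (c * _).
exact: (congr1 fine (probability_setT P)).
Qed.

Lemma meanD f g : L1 f -> L1 g -> mean (fun x => f x + g x) = mean f + mean g.
Proof. by move=> f1 g1; rewrite /mean RintegralD. Qed.

Lemma meanZ c f : L1 f -> mean (fun x => c * f x) = c * mean f.
Proof. by move=> f1; rewrite /mean RintegralZl. Qed.

Lemma meanN f : L1 f -> mean (fun x => - f x) = - mean f.
Proof. by move=> f1; rewrite -mulN1r -meanZ//; apply: eq_mean => x; rewrite mulN1r. Qed.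

Lemma meanB f g : L1 f -> L1 g -> mean (fun x => f x - g x) = mean f - mean g.
Proof. by move=> f1 g1; rewrite meanD ?meanN//; exact: L1N. Qed.

Lemma mean_sum (I : Type) (s : seq I) (Q : pred I) (F : I -> T -> R) :
  (forall i, Q i -> L1 (F i)) ->
  mean (fun x => \sum_(i <- s | Q i) F i x) = \sum_(i <- s | Q i) mean (F i).
Proof.
move=> F1; elim: s => [|i s IH].
  by rewrite big_nil -[RHS]mean_cst; apply: eq_mean => x; rewrite big_nil.
rewrite big_cons -IH; case: ifPn => Qi; last first.
  by apply: eq_mean => x; rewrite big_cons (negbTE Qi).
rewrite -meanD; [|exact: F1|exact: L1_sum].
by apply: eq_mean => x; rewrite big_cons Qi.
Qed.

Lemma le_mean f g : L1 f -> L1 g -> (forall x, f x <= g x) -> mean f <= mean g.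
Proof. by move=> f1 g1 fg; apply: le_Rintegral. Qed.

Lemma mean_ge0 f : (forall x, 0 <= f x) -> 0 <= mean f.
Proof. by move=> f0; apply: Rintegral_ge0. Qed.

Lemma mean_abs f : L1 f -> `|mean f| <= mean (fun x => `|f x|).
Proof. by move=> f1; exact: le_normr_Rintegral. Qed.

Lemma mean_abs_le f g : L1 f -> L1 g -> (forall x, `|f x| <= g x) -> `|mean f| <= mean g.
Proof.
move=> f1 g1 fg; apply: le_trans (mean_abs f1) _.
by apply: le_mean => //; exact: L1_abs.
Qed.

Lemma mean_abs_bound f M : measurable_fun setT f -> (forall x, `|f x| <= M) ->
  `|mean f| <= M.
Proof.
move=> mf fM; rewrite -[leRHS]mean_cst; apply: mean_abs_le => //; last exact: L1_cst.
exact: L1_bounded fM.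
Qed.

Lemma mean_abs_le_sqr f : L1 f -> L1 (fun x => f x ^+ 2) ->
  mean (fun x => `|f x|) <= 2^-1 * (1 + mean (fun x => f x ^+ 2)).
Proof.
move=> f1 f2; have f3 : L1 (fun x => 1 + f x ^+ 2) by apply: L1D => //; exact: L1_cst.
have <- : mean (fun x => 2^-1 * (1 + f x ^+ 2)) = 2^-1 * (1 + mean (fun x => f x ^+ 2)).
  by rewrite meanZ// meanD ?mean_cst//; exact: L1_cst.
apply: le_mean; [exact: L1_abs|exact: L1Z|move=> x].
by rewrite -(real_normK (num_real (f x))); have := sqr_ge0 (`|f x| - 1); lra.
Qed.

Lemma measurable_gt f c : measurable_fun setT f -> measurable [set x | c < f x].
Proof.
move=> mf; rewrite [X in measurable X](_ : _ = f @^-1` `]c, +oo[%classic).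
  by rewrite -[X in measurable X]setTI; apply: mf.
by apply/seteqP; split => x /=; rewrite in_itv/= andbT.
Qed.

Lemma L1_indic A : measurable A -> L1 (\1_A : T -> R).
Proof.
move=> mA; apply: (@L1_bounded _ 1) => // x.
by rewrite indicE; case: (_ \in _); rewrite ?normr1 ?normr0.
Qed.

Lemma mean_indic A : measurable A -> mean (\1_A : T -> R) = fine (P A).
Proof. by move=> mA; rewrite /mean /Rintegral integral_indic// setIT. Qed.

Lemma prob_fine A : measurable A -> (fine (P A))%:E = P A.
Proof. by move=> mA; rewrite fineK// fin_num_measure. Qed.

Lemma markov_mean f (e : R) : L1 f -> (forall x, 0 <= f x) -> 0 < e ->
  (P [set x | (e < f x)%R] <= (mean f / e)%:E)%E.
Proof.
move=> f1 f0 e0; have mA := measurable_gt e (L1_measurable f1).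
rewrite -(prob_fine mA) lee_fin -mean_indic// ler_pdivlMr// mulrC -meanZ; last exact: L1_indic.
apply: le_mean => //; first by apply: L1Z; exact: L1_indic.
move=> x; rewrite indicE; case: (boolP (_ \in _)) => [|_]; last by rewrite mulr0.
by rewrite inE mulr1 => /ltW.
Qed.

Lemma dominated_mean (F : nat -> T -> R) f g : (forall n, measurable_fun setT (F n)) ->
  L1 g -> (forall n x, `|F n x| <= g x) -> (forall x, F n x @[n --> \oo] --> f x) ->
  L1 f /\ mean (F n) @[n --> \oo] --> mean f.
Proof.
move=> mF g1 Fg Ff.
have mf : measurable_fun setT f by apply: (measurable_fun_cvg mF) => x _; exact: Ff.
have [] := @dominated_convergence _ _ _ P _ measurableT (fun n => EFin \o F n)
  (EFin \o f) (EFin \o g).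
- by move=> n; apply/measurable_EFinP.
- exact/measurable_EFinP.
- by apply: aeW => x _; apply: cvg_EFin; [exact: nearW|exact: Ff].
- exact: g1.
- by apply: aeW => x n _ /=; rewrite lee_fin Fg.
move=> f1 _ cF; split => //; apply: fine_cvg; rewrite fineK; last exact: integrable_fin_num.
exact: cF.
Qed.

End mean.

(** * Independence and products *)

Section product_law.
Context (R : realType) d (T : measurableType d) (P : probability T R).

Definition indep2 (U V : T -> R) : Prop := forall A B : set R,
  measurable A -> measurable B ->
  P (U @^-1` A `&` V @^-1` B) = (P (U @^-1` A) * P (V @^-1` B))%E.

(** The joint law of (U, V) is the product of the marginal laws, because they
    agree on rectangles; the formula is then Fubini's theorem on the plane. *)
Lemma indep2_mean (U V : T -> R) : L1 P U -> L1 P V -> indep2 U V ->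
  L1 P (fun w => U w * V w) /\ mean P (fun w => U w * V w) = mean P U * mean P V.
Proof.
move=> U1 V1 UV.
have mU := L1_measurable U1; have mV := L1_measurable V1.
pose mfU : {mfun T >-> R} := HB.pack U (isMeasurableFun.Build _ _ _ _ _ mU).
pose mfV : {mfun T >-> R} := HB.pack V (isMeasurableFun.Build _ _ _ _ _ mV).
pose lU : probability _ _ := distribution P mfU.
pose lV : probability _ _ := distribution P mfV.
pose W w := (U w, V w).
have mW : measurable_fun setT W by exact: measurable_fun_pair.
pose mfW : {mfun T >-> (R * R)%type} :=
  HB.pack W (isMeasurableFun.Build _ _ _ _ _ mW).
pose lW : probability _ _ := distribution P mfW.
have lWE A : measurable A -> (lU \x lV)%E A = lW A.
  have rect B C : measurable B -> measurable C -> lW (B `*` C) = (lU B * lV C)%E.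
    by move=> mB mC; exact: UV B C mB mC.
  by move=> mA; exact: (product_measure_unique rect).
pose f (z : R * R) : \bar R := (z.1 * z.2)%:E.
have mf : measurable_fun setT f.
  apply/measurable_EFinP; apply: measurable_funM; first exact: measurable_fst.
  exact: measurable_snd.
have mabs : measurable_fun setT (fun y : R => `|y%:E|%E).
  by apply: measurableT_comp => //; exact: EFin_measurable.
have normI (X : T -> R) (mX : measurable_fun setT X) (l : probability (R) R) :
    L1 P X -> (forall A, l A = pushforward P X A) ->
    (\int[l]_y `|y%:E| = (mean P (fun w => `|X w|))%:E)%E /\
    l.-integrable setT EFin /\
    (\int[l]_y y%:E = (mean P X)%:E)%E.
  move=> X1 lE; have mE : measurable_fun setT (EFin : R -> \bar R).
    exact: EFin_measurable.
  have e1 : (\int[l]_y `|y%:E| = (mean P (fun w => `|X w|))%:E)%E.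
    rewrite (eq_measure_integral (pushforward P X)); last by move=> A _ _; first [exact: lE|exact: esym (lE A)].
    rewrite ge0_integral_pushforward//=.
    by rewrite preimage_setT -meanE//; exact: L1_abs.
  split=> //; split; first by apply/integrableP; split => //; rewrite e1 ltry.
  rewrite (eq_measure_integral (pushforward P X)); last by move=> A _ _; first [exact: lE|exact: esym (lE A)].
  by rewrite integral_pushforward//= preimage_setT -meanE.
have [eU [iU mU']] := normI U mU lU U1 (fun=> erefl).
have [eV [iV mV']] := normI V mV lV V1 (fun=> erefl).
have fi : (lU \x lV)%E.-integrable setT f.
  apply/integrable12ltyP => //.
  rewrite (eq_integral (fun x : R => `|x%:E| * (mean P (fun w => `|V w|))%:E)%E); last first.
    move=> x _; rewrite -eV -ge0_integralZl//.
    by apply: eq_integral => y _; rewrite /f /= normrM EFinM.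
  by rewrite ge0_integralZr//= ?eU -?EFinM ?ltry// lee_fin mean_ge0.
have fW : lW.-integrable setT f.
  apply/integrableP; split => //; move/integrableP : fi => [_].
  by rewrite (eq_measure_integral lW)//= => A mA _; exact: lWE.
have int1 : (\int[lW]_z f z = (mean P U * mean P V)%:E)%E.
  rewrite (eq_measure_integral (lU \x lV)%E); last by move=> A mA _; exact: esym (lWE A mA).
  rewrite -(integral12_prod_meas1 fi).
  rewrite (eq_integral (fun x : R => x%:E * (mean P V)%:E)%E); last first.
    by move=> x _; rewrite -mV' -integralZl.
  by rewrite integralZr// mU' EFinM.
have fT : P.-integrable setT (f \o W).
  apply/integrableP; split; first exact: measurableT_comp.
  move/integrableP : fW => [_]; rewrite ge0_integral_pushforward//.
  exact: measurableT_comp.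
split; first exact: fT.
apply: EFin_inj; rewrite -int1 -meanE; last exact: fT.
by rewrite /lW /distribution integral_pushforward.
Qed.

End product_law.

Section past.
Context (R : realType) d (T : measurableType d) (P : probability T R).
Context d' (E : measurableType d') (I : choiceType) (Y : I -> T -> E).
Hypothesis mY : forall i, measurable_fun setT (Y i).
Hypothesis indepY : mutually_independent P Y.

Definition cylinders (J : {fset I}) : set (set T) :=
  [set C | exists2 A : I -> set E, (forall i, measurable (A i)) &
           C = \bigcap_(j in [set` J]) (Y j @^-1` A j)].

(** The sample space with the sigma-algebra generated by the Y_j, j in J: being
    measurable from this type means being a function of these variables only. *)
Definition past J := g_sigma_algebraType (cylinders J).

Lemma measurable_preY i (A : set E) : measurable A -> measurable (Y i @^-1` A).
Proof. by move=> mA; rewrite -[X in measurable X]setTI; exact: mY. Qed.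

Lemma measurable_cylinders J : cylinders J `<=` measurable.
Proof.
move=> _ [A mA ->]; apply: fin_bigcap_measurable; first exact: finite_fset.
by move=> i _; exact: measurable_preY.
Qed.

Lemma past_measurable J i : i \in J -> measurable_fun setT (Y i : past J -> E).
Proof.
move=> iJ _ A mA; rewrite setTI; apply: sub_sigma_algebra.
exists (fun j => if j == i then A else setT); first by move=> j; case: ifP.
apply/seteqP; split=> w /=; first by move=> wA j /= _; case: eqP => [->|].
by move=> /(_ i iJ) /=; rewrite eqxx.
Qed.

Lemma past_measurableT J (U : past J -> R) :
  measurable_fun setT U -> measurable_fun setT (U : T -> R).
Proof.
move=> mU _ A mA; have := mU measurableT _ mA.
by apply: (smallest_sub (sigma_algebra_measurable T)); exact: measurable_cylinders.
Qed.

(** Cylinder sets are stable under intersection, so it suffices to compare the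
    two finite measures B |-> P(B inter D) and B |-> P(B) P(D) on them, where they
    agree by mutual independence. *)
Lemma past_indep2 J i (U : past J -> R) (v : E -> R) : i \notin J ->
  measurable_fun setT U -> measurable_fun setT v -> indep2 P U (v \o Y i).
Proof.
move=> iJ mU mv A B mA mB.
have mB' : measurable (v @^-1` B) by rewrite -[X in measurable X]setTI; exact: mv.
rewrite (_ : (v \o Y i) @^-1` B = Y i @^-1` (v @^-1` B))//.
move: (v @^-1` B) mB' => {mv v mB}B mB.
have mD := measurable_preY i mB.
set D := Y i @^-1` B in mD *.
pose p : {nonneg R} := NngNum (fine_ge0 (measure_ge0 P D)).
rewrite muleC -(prob_fine P mD) -[RHS]/(mscale p P (U @^-1` A)).
rewrite -[LHS]/(mrestr P mD (U @^-1` A)).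
have mUA : <<s cylinders J >> (U @^-1` A).
  by rewrite -[U @^-1` A]setTI; exact: mU.
apply: (g_sigma_algebra_measure_unique (cylinders J) _ (fun=> setT)) => //.
- exact: measurable_cylinders.
- move=> _; exists (fun=> setT) => //.
  by apply/seteqP; split => // w _ j _.
- by apply/seteqP; split => // w _; exists 0%N.
- move=> _ _ [A1 mA1 ->] [A2 mA2 ->]; exists (fun j => A1 j `&` A2 j).
    by move=> j; exact: measurableI.
  apply/seteqP; split => w /=.
    by move=> [w1 w2] j jJ; split; [exact: w1|exact: w2].
  by move=> w12; split=> j jJ; have [] := w12 j jJ.
- move=> _ [C mC ->].
  rewrite -[RHS]/((fine (P D))%:E * P (\bigcap_(j in [set` J]) (Y j @^-1` C j)))%E.
  rewrite (prob_fine P mD) /mrestr.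
  pose C' j := if j == i then B else C j.
  have mC' j : measurable (C' j) by rewrite /C'; case: ifP.
  have CD : \bigcap_(j in [set` J]) (Y j @^-1` C j) `&` D =
      \bigcap_(j in [set` (i |` J)%fset]) (Y j @^-1` C' j).
    apply/seteqP; split => w /=.
      move=> [wJ wD] j /=; rewrite /C' !inE; case: eqP => [->//|_ /= jJ].
      exact: wJ.
    move=> wJ; split; last by have := wJ i; rewrite /C' eqxx; apply; rewrite /= !inE eqxx.
    move=> j jJ; have := wJ j; rewrite /C' /= !inE jJ orbT => /(_ isT).
    by case: eqP => // ji; move: iJ; rewrite -ji jJ.
  transitivity (P (\bigcap_(j in [set` (i |` J)%fset]) (Y j @^-1` C' j))).
    exact: congr1 CD.
  rewrite indepY// big_fsetU1//= {1}/C' eqxx; congr (_ * _)%E.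
  rewrite indepY//; apply: eq_big_seq => j jJ; rewrite /C'.
  by case: eqP => // ji; move: iJ; rewrite -ji jJ.
- move=> _; apply: le_lt_trans (ltry 1); apply: probability_le1.
  exact: measurableI.
Qed.

Lemma past_mean J i (U : past J -> R) (v : E -> R) : i \notin J ->
  measurable_fun setT U -> L1 P U -> measurable_fun setT v -> L1 P (v \o Y i) ->
  L1 P (fun w => U w * v (Y i w)) /\
  mean P (fun w => U w * v (Y i w)) = mean P U * mean P (v \o Y i).
Proof.
move=> iJ mU U1 mv v1; apply: indep2_mean => //.
exact: past_indep2.
Qed.

End past.

(** * The soft maximum *)

Section soft_max.
Context (R : realType) (I : finType) (i0 : I).
Implicit Types x y : I -> R.

Definition lse_sum x : R := \sum_i (expR (x i) + expR (- x i)).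

(** Logarithm of a sum of exponentials over both signs: a smooth majorant of
    max_i |x_i|, larger by at most log(2|I|). *)
Definition lse x : R := ln (lse_sum x).

(** The gradient of [lse]; writing the denominator as an exponential makes its
    measurability a composition. *)
Definition lse_grad x i : R := (expR (x i) - expR (- x i)) * expR (- lse x).

Lemma expR_le_quad (t : R) : t <= 2^-1 -> expR t <= 1 + t + 2 * t ^+ 2.
Proof.
move=> t2; have t1 : 0 < 1 - t by lra.
have := expR_ge1Dx (- t); rewrite -[X in _ <= X]invrK expRN invrK => h.
have : (1 - t) * expR t <= 1.
  have := ler_wpM2r (expR_ge0 t) h; rewrite mulVf ?gt_eqF ?expR_gt0//.
have : (1 - t) * (1 + t + 2 * t ^+ 2) = 1 + t ^+ 2 * (1 - 2 * t) by ring.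
move=> e1 e2; rewrite -(ler_pM2l t1) e1; apply: le_trans e2 _.
by rewrite lerDl mulr_ge0 ?sqr_ge0//; lra.
Qed.

Lemma lse_sum_gt0 x : 0 < lse_sum x.
Proof.
rewrite /lse_sum (bigD1 i0)//= ltr_pwDl ?addr_gt0 ?expR_gt0//.
by apply: sumr_ge0 => i _; rewrite addr_ge0 ?expR_ge0.
Qed.

Lemma lse_gradE x i : lse_grad x i = (expR (x i) - expR (- x i)) / lse_sum x.
Proof. by rewrite /lse_grad [expR (- lse x)]expRN /lse lnK// posrE lse_sum_gt0. Qed.

Lemma abs_le_lse x i : `|x i| <= lse x.
Proof.
rewrite -[leLHS]expRK ler_ln ?posrE ?expR_gt0 ?lse_sum_gt0//.
rewrite /lse_sum (bigD1 i)//= ler_wpDr//.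
  by apply: sumr_ge0 => j _; rewrite addr_ge0 ?expR_ge0.
by case: (ger0P (x i)) => x0; rewrite ?lerDl ?lerDr expR_ge0.
Qed.

Lemma lse_ge0 x : 0 <= lse x.
Proof. exact: le_trans (normr_ge0 _) (abs_le_lse x i0). Qed.

Lemma lse0 : lse (fun=> 0) = ln (2 * #|I|%:R).
Proof.
rewrite /lse /lse_sum /= oppr0 expR0 sumr_const mulr_natr; congr (ln (_ *+ _)).
Qed.

Lemma lse_sum_le x y b : (forall i, `|y i| <= b) ->
  lse_sum (fun i => x i + y i) <= expR b * lse_sum x.
Proof.
move=> yb; rewrite /lse_sum mulr_sumr ler_sum// => i _.
have /ler_normlP[y1 y2] := yb i.
by rewrite mulrDr opprD -!expRD lerD ?ler_expR// addrC lerD2r; lra.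
Qed.

Lemma lse_le x b : (forall i, `|x i| <= b) -> lse x <= lse (fun=> 0) + b.
Proof.
move=> xb; rewrite /lse -[b in leRHS]expRK -lnM ?posrE ?lse_sum_gt0 ?expR_gt0//.
rewrite ler_ln ?posrE ?mulr_gt0 ?lse_sum_gt0 ?expR_gt0// mulrC.
rewrite (_ : lse_sum x = lse_sum (fun i => 0 + x i)); first exact: lse_sum_le.
by rewrite /lse_sum; apply: eq_bigr => i _; rewrite add0r.
Qed.

Lemma lse_grad_sum x : \sum_i `|lse_grad x i| <= 1.
Proof.
rewrite -[leRHS](divff (lt0r_neq0 (lse_sum_gt0 x))) {2}/lse_sum mulr_suml.
apply: ler_sum => i _; rewrite lse_gradE normrM [X in _ * X]ger0_norm ?invr_ge0 ?(ltW (lse_sum_gt0 x))//.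
rewrite ler_wpM2r ?invr_ge0 ?(ltW (lse_sum_gt0 x))//.
by rewrite (le_trans (ler_normB _ _))// !ger0_norm ?expR_ge0.
Qed.

Lemma lse_grad_abs x i : `|lse_grad x i| <= 1.
Proof.
apply: le_trans (lse_grad_sum x); rewrite (bigD1 i)//= lerDl.
by apply: sumr_ge0 => j _.
Qed.

(** Second-order expansion of the soft maximum. For b <= 1/2 it comes from
    e^t <= 1 + t + 2 t^2; for larger b the crude bound lse(x+y) <= lse x + b already
    lies below the right-hand side, since the linear term is at least -b and
    2b <= 4 b^2. *)
Lemma lse_step x y b : (forall i, `|y i| <= b) ->
  lse (fun i => x i + y i) <= lse x + \sum_i lse_grad x i * y i + 4 * b ^+ 2.
Proof.
move=> yb; have b0 : 0 <= b := le_trans (normr_ge0 _) (yb i0).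
have Z0 := lse_sum_gt0 x.
set u := \sum_i lse_grad x i * y i.
have ub : `|u| <= b.
  apply: le_trans (ler_norm_sum _ _ _) _.
  apply: le_trans (_ : \sum_i `|lse_grad x i| * b <= _).
    by apply: ler_sum => i _; rewrite normrM ler_wpM2l.
  by rewrite -mulr_suml -[leRHS]mul1r ler_wpM2r ?lse_grad_sum.
have [b2|b2] := lerP b 2^-1; last first.
  have : lse (fun i => x i + y i) <= lse x + b.
    rewrite /lse -[b in leRHS]expRK -lnM ?posrE ?expR_gt0//.
    rewrite ler_ln ?posrE ?mulr_gt0 ?lse_sum_gt0 ?expR_gt0// mulrC.
    exact: lse_sum_le.
  by move: ub => /ler_normlP[u1 u2]; nra.
have uE : lse_sum x * u = \sum_i (expR (x i) - expR (- x i)) * y i.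
  rewrite /u mulr_sumr; apply: eq_bigr => i _.
  by rewrite lse_gradE mulrA mulrCA mulfV ?gt_eqF// mulr1.
have le1 : lse_sum (fun i => x i + y i) <= lse_sum x * (1 + (u + 2 * b ^+ 2)).
  rewrite !mulrDr mulr1 uE addrA [X in _ <= X + _ + _]/lse_sum -big_split/=.
  rewrite {2}/lse_sum mulr_suml -big_split/=; apply: ler_sum => i _.
  have /ler_normlP[y1 y2] := yb i.
  have yb2 : y i ^+ 2 <= b ^+ 2 by rewrite -real_normK ?num_real// lerXn2r ?nnegrE.
  have h1 : expR (y i) <= 1 + y i + 2 * b ^+ 2.
    by apply: le_trans (@expR_le_quad (y i) _) _; lra.
  have h2 : expR (- y i) <= 1 - y i + 2 * b ^+ 2.
    by apply: le_trans (@expR_le_quad (- y i) _) _; rewrite ?sqrrN; lra.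
  rewrite opprD !expRD.
  have := ler_wpM2l (expR_ge0 (x i)) h1; have := ler_wpM2l (expR_ge0 (- x i)) h2.
  lra.
have u0 : 0 < 1 + (u + 2 * b ^+ 2).
  by rewrite -(pmulr_rgt0 _ Z0); apply: lt_le_trans le1; exact: lse_sum_gt0.
apply: le_trans (_ : lse x + (u + 2 * b ^+ 2) <= _); last by have := sqr_ge0 b; lra.
apply: le_trans (_ : lse x + ln (1 + (u + 2 * b ^+ 2)) <= _).
  rewrite /lse -lnM ?posrE//.
  by rewrite ler_ln ?posrE ?mulr_gt0 ?lse_sum_gt0.
by rewrite lerD2l le_ln1Dx//; lra.
Qed.

End soft_max.

(** * Taylor remainders of sine, cosine and exponential *)

Section trig_bounds.
Context (R : realType).
Implicit Types x : R.

Lemma mvt_from0 (f df : R -> R) x (M : R) : (forall y : R, is_derive y 1 f (df y)) ->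
  (forall y, `|y| <= `|x| -> `|df y| <= M) -> `|f x - f 0| <= M * `|x|.
Proof.
move=> fdf dfM.
have cf (A : set R) : {within A, continuous f}.
  apply: continuous_subspaceT => y.
  by apply/differentiable_continuous/derivable1_diffP; have [] := fdf y.
have [x0|x0] := lerP 0 x.
  have [c] := MVT_segment x0 (fun y _ => fdf y) (cf _).
  rewrite in_itv/= => /andP[c0 cx] ->.
  by rewrite subr0 normrM ler_wpM2r// dfM// !ger0_norm.
have [c] := MVT_segment (ltW x0) (fun y _ => fdf y) (cf _).
rewrite in_itv/= => /andP[cx c0]; rewrite distrC => ->.
by rewrite sub0r normrM normrN ler_wpM2r// dfM// !ler0_norm ?lerN2// ltW.
Qed.

Lemma sin_abs_le x : `|sin x| <= `|x|.
Proof.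
have := @mvt_from0 (@sin R) cos x 1 _ (fun y _ => cos_max y).
by rewrite sin0 subr0 mul1r; apply => y; exact: is_derive_sin.
Qed.

Lemma cos_sub1_le x : `|cos x - 1| <= `|x| ^+ 2 / 2.
Proof.
have -> : cos x - 1 = - (2 * sin (x / 2) ^+ 2).
  have e : x = x / 2 + x / 2 by lra.
  by rewrite {1}e cosD -!expr2 cos2sin2; ring.
rewrite normrN normrM ger0_norm// normrX.
have h := sin_abs_le (x / 2).
have : `|sin (x / 2)| ^+ 2 <= `|x / 2| ^+ 2 by rewrite lerXn2r// nnegrE.
rewrite (@normrM _ x) [ `|2^-1| ]ger0_norm// exprMn => h2.
by apply: le_trans (ler_wpM2l _ h2) _ => //; lra.
Qed.

Lemma sin_sub_le3 x : `|sin x - x| <= `|x| ^+ 3 / 2.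
Proof.
have -> : `|x| ^+ 3 / 2 = `|x| ^+ 2 / 2 * `|x| by ring.
have := @mvt_from0 (fun y => sin y - y) (fun y => cos y - 1) x (`|x| ^+ 2 / 2).
rewrite sin0 !subr0; apply => y yx.
apply: le_trans (cos_sub1_le y) _.
by rewrite ler_wpM2r// lerXn2r ?nnegrE.
Qed.

Lemma cos_sub_le4 x : `|cos x - 1 + x ^+ 2 / 2| <= `|x| ^+ 4 / 2.
Proof.
have -> : `|x| ^+ 4 / 2 = `|x| ^+ 3 / 2 * `|x| by ring.
have := @mvt_from0 (fun y => cos y - 1 + y ^+ 2 / 2) (fun y => y - sin y) x (`|x| ^+ 3 / 2).
rewrite cos0 subrr expr0n/= mul0r addr0 subr0; apply => y.
  apply: is_derive_eq; rewrite !scaler0 subr0 add0r /GRing.scale/= mulr1; lra.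
move=> yx; rewrite distrC; apply: le_trans (sin_sub_le3 y) _.
by rewrite ler_wpM2r// lerXn2r ?nnegrE.
Qed.

(** Remainder of the expansions of sine and cosine used for the central limit
    theorem: cubic near 0, but only quadratic at infinity so that it is
    integrable under a second moment. *)
Definition trem x : R := Num.min (`|x| ^+ 2) (`|x| ^+ 3).

Lemma sin_trem x : `|sin x - x| <= trem x.
Proof.
have h1 := sin_sub_le3 x; have h2 : `|sin x - x| <= 2 * `|x|.
  by apply: le_trans (ler_normB _ _) _; have := sin_abs_le x; lra.
have x0 := normr_ge0 x.
rewrite /trem le_min; move: (`|sin x - x|) (`|x|) h1 h2 x0 => s t h1 h2 t0.
have t2 := sqr_ge0 t; have t3 : 0 <= t ^+ 3 by rewrite exprn_ge0.
apply/andP; split; last by lra.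
have [t1|t1] := lerP t 2; last by nra.
by apply: le_trans h1 _; rewrite exprS; nra.
Qed.

Lemma cos_trem x : `|cos x - 1 + x ^+ 2 / 2| <= trem x.
Proof.
have h1 := cos_sub_le4 x.
have h2 : `|cos x - 1 + x ^+ 2 / 2| <= `|x| ^+ 2.
  apply: le_trans (ler_normD _ _) _; have := cos_sub1_le x.
  by rewrite normrM normrX [ `|2^-1| ]ger0_norm//; lra.
have x0 := normr_ge0 x.
rewrite /trem le_min h2/=; move: h1 h2; set s := `| _ - 1 + _|.
move: (`|x|) x0 => t t0 h1 h2.
have [t1|t1] := lerP t 1.
  apply: le_trans h1 _; have : 0 <= t ^+ 3 by rewrite exprn_ge0.
  by rewrite (exprS _ 3); nra.
by apply: le_trans h2 _; rewrite (exprS _ 2); have := sqr_ge0 t; nra.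
Qed.

Lemma trem_scale (a d z : R) : `|a| <= d ->
  trem (z * a) <= a ^+ 2 * (z ^+ 2 * Num.min 1 (d * `|z|)).
Proof.
move=> ad; rewrite /trem normrM !exprMn (exprS _ 2) (exprS _ 2) !real_normK ?num_real//.
have a2 := sqr_ge0 a; have z2 := sqr_ge0 z; have z0 := normr_ge0 z; have a0 := normr_ge0 a.
rewrite ge_min; case: (lerP 1 (d * `|z|)) => h; first by rewrite mulr1 mulrC lexx.
apply/orP; right.
have -> : `|z| * z ^+ 2 * (`|a| * a ^+ 2) = a ^+ 2 * (z ^+ 2 * (`|a| * `|z|)) by ring.
by rewrite !ler_wpM2l// ler_wpM2r.
Qed.

Lemma expRN_sub_le (b : R) : 0 <= b -> `|expR (- b) - (1 - b)| <= b ^+ 2.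
Proof.
move=> b0; have h1 := expR_ge1Dx (- b).
rewrite ger0_norm; last by lra.
have h2 := expR_ge1Dx b; have eb : expR (- b) * expR b = 1 by rewrite -expRD addNr expR0.
have h3 : expR (- b) * (1 + b) <= 1 by rewrite -[leRHS]eb ler_wpM2l// expR_ge0.
have h4 := expR_ge0 (- b); nra.
Qed.

Lemma expR_sub1_le (h : R) : `|h| <= 1 -> `|expR (h / 2) - 1| <= `|h|.
Proof.
move=> h1; have /ler_normlP[hb ha] := h1.
have e1 : expR (h / 2) <= 1 + h / 2 + 2 * (h / 2) ^+ 2 by apply: expR_le_quad; lra.
have e2 := expR_ge1Dx (h / 2).
have hh : h ^+ 2 <= `|h|.
  by rewrite -real_normK ?num_real// expr2 ler_piMl.
have := ler_norm h; have := ler_norm (- h); rewrite normrN => *.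
by rewrite ler_norml; apply/andP; split; lra.
Qed.

Lemma expR_sub_le (V v : R) : `|v - V| <= 1 ->
  `|expR (- (v / 2)) - expR (- (V / 2))| <= expR (- (V / 2)) * `|v - V|.
Proof.
move=> vV; have -> : - (v / 2) = - (V / 2) + (V - v) / 2 by field.
rewrite expRD -[X in _ * _ - X]mulr1 -mulrBr normrM ger0_norm ?expR_ge0//.
by rewrite ler_wpM2l ?expR_ge0// [leRHS]distrC; apply: expR_sub1_le; rewrite distrC.
Qed.

End trig_bounds.

(** * Weighted sums of independent multipliers *)

Section multiplier_sums.
Context (R : realType) d (T : measurableType d) (P : probability T R).
Context (I : choiceType) (Y : I -> T -> R).
Hypothesis Y1 : forall i, L1 P (Y i).
Hypothesis Y0 : forall i, mean P (Y i) = 0.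
Hypothesis Y2 : forall i, L1 P (fun w => Y i w ^+ 2).
Hypothesis Yvar : forall i, mean P (fun w => Y i w ^+ 2) = 1.
Hypothesis indepY : mutually_independent P Y.
Context (N : nat) (e : 'I_N -> I) (e_inj : injective e).

Let mY i : measurable_fun setT (Y i) := L1_measurable (Y1 i).

(** Partial sums along an injective enumeration e of N of the multipliers; the
    bound k makes induction on the number of summands possible with N fixed. *)
Definition psum (a : 'I_N -> R) (k : nat) (w : T) : R :=
  \sum_(n < N | (n < k)%N) Y (e n) w * a n.

Definition before (k : nat) : {fset I} :=
  [fset x in [seq e n | n : 'I_N <- enum 'I_N & (n < k)%N]]%fset.

Lemma in_before (n : 'I_N) k : (e n \in before k) = (n < k)%N.
Proof.
rewrite inE/= (mem_map e_inj).
by rewrite mem_filter mem_enum andbT.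
Qed.

Lemma psum0 a w : psum a 0 w = 0.
Proof. by rewrite /psum big_pred0. Qed.

Lemma psum_recr a (k : 'I_N) w : psum a k.+1 w = psum a k w + Y (e k) w * a k.
Proof.
rewrite /psum (bigD1 k)//= addrC; congr (_ + _); apply: eq_bigl => n.
by rewrite ltnS ltn_neqAle andbC.
Qed.

Lemma psum_full a w : psum a N w = \sum_(n < N) Y (e n) w * a n.
Proof. by apply: eq_bigl => n; rewrite ltn_ord. Qed.

Lemma sum_ltS (b : 'I_N -> R) (k : 'I_N) :
  \sum_(n < N | (n < k.+1)%N) b n = \sum_(n < N | (n < k)%N) b n + b k.
Proof.
rewrite (bigD1 k)//= addrC; congr (_ + _); apply: eq_bigl => n.
by rewrite ltnS ltn_neqAle andbC.
Qed.

Lemma psum_past a k : measurable_fun setT (psum a k : past Y (before k) -> R).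
Proof.
rewrite (_ : psum a k = fun w => \sum_(n < N) if (n < k)%N then Y (e n) w * a n else 0); last first.
  by apply/funext => w; rewrite /psum big_mkcond.
apply: measurable_sum => n; case: (boolP (n < k)%N) => nk; last exact: measurable_cst.
apply: measurable_funM; last exact: measurable_cst.
by apply: past_measurable; rewrite in_before.
Qed.

Lemma measurable_psum a k : measurable_fun setT (psum a k).
Proof. by refine (past_measurableT mY _); exact: psum_past. Qed.

Lemma psum_mean (k : 'I_N) (U : past Y (before k) -> R) (v : R -> R) :
  measurable_fun setT U -> L1 P U ->
  measurable_fun setT v -> L1 P (v \o Y (e k)) ->
  L1 P (fun w => U w * v (Y (e k) w)) /\
  mean P (fun w => U w * v (Y (e k) w)) = mean P U * mean P (v \o Y (e k)).
Proof.
move=> mU U1 mv v1; apply: (past_mean mY indepY (J := before k)) => //.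
by rewrite in_before ltnn.
Qed.

Lemma L1_past_bounded J (U : past Y J -> R) M :
  measurable_fun setT U -> (forall w, `|U w| <= M) -> L1 P U.
Proof.
move=> mU UM; apply: (@L1_bounded _ _ _ P U M) => //.
by refine (past_measurableT mY _); exact: mU.
Qed.

Lemma L1_psum c k : L1 P (psum c k).
Proof.
apply: L1_sum => n _; apply: eq_L1 (L1Z (c n) (Y1 (e n))) => w.
by rewrite mulrC.
Qed.

Lemma psum_sqr (a : 'I_N -> R) k : (k <= N)%N ->
  L1 P (fun w => psum a k w ^+ 2) /\
  mean P (fun w => psum a k w ^+ 2) = \sum_(n < N | (n < k)%N) a n ^+ 2.
Proof.
elim: k => [_|k IH kN].
  split; first by apply: eq_L1 (L1_cst P 0) => w; rewrite psum0 expr0n.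
  rewrite big_pred0// (@eq_mean _ _ _ P _ (fun=> 0)) ?mean_cst// => w.
  by rewrite psum0 expr0n.
pose k' := Ordinal kN; have [L IHE] := IH (ltnW kN).
have [Lc Ec] := @psum_mean k' (psum a k) id (@psum_past a k) (L1_psum a k)
  (@measurable_id _ _ setT) (Y1 (e k')).
have E w : psum a k.+1 w ^+ 2 = psum a k w ^+ 2 +
    (2 * a k' * (psum a k w * Y (e k') w) + a k' ^+ 2 * Y (e k') w ^+ 2).
  by rewrite (psum_recr a k'); ring.
split.
  by apply: eq_L1 (L1D L (L1D (L1Z (2 * a k') Lc) (L1Z (a k' ^+ 2) (Y2 (e k'))))) => w; rewrite E.
rewrite (eq_mean P E) meanD//; last by apply: L1D; exact: L1Z.
rewrite meanD; [|exact: L1Z|exact: L1Z].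
rewrite !meanZ// Yvar IHE Ec [X in _ * (_ * X)](Y0 (e k')) !mulr0 add0r mulr1.
by rewrite (@sum_ltS (fun n => a n ^+ 2) k').
Qed.

Section maximal.
Context (A : finType) (i0 : A) (a : A -> 'I_N -> R) (b : 'I_N -> R).
Hypothesis ab : forall i n, `|a i n| <= b n.

Let S k w := fun i => psum (a i) k w.

Let measurable_lse_sum_S k : measurable_fun setT (fun w : past Y (before k) => lse_sum (S k w)).
Proof.
apply: measurable_sum => i; apply: measurable_funD.
  by apply: measurableT_comp => //; exact: psum_past.
apply: measurableT_comp => //; apply: measurableT_comp => //; exact: psum_past.
Qed.

Lemma measurable_lse_psum k : measurable_fun setT (fun w => lse (S k w)).
Proof.
apply: (past_measurableT mY); apply: measurableT_comp; first exact: measurable_ln.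
exact: measurable_lse_sum_S.
Qed.

Lemma L1_lse_psum k : L1 P (fun w => lse (S k w)).
Proof.
apply: (@L1_le _ _ _ _ _ (fun w => lse (fun _ : A => 0 : R) + \sum_i `|S k w i|)).
- exact: measurable_lse_psum.
- apply: L1D; first exact: L1_cst.
  by apply: L1_sum => i _; apply: L1_abs; exact: L1_psum.
- move=> w; rewrite ger0_norm; last exact: lse_ge0.
  apply: lse_le => // i; rewrite (bigD1 i)//= lerDl.
  by apply: sumr_ge0.
Qed.

(** Maximal inequality under a second moment. Adding one summand changes the
    soft maximum by a term linear in the new multiplier, whose coefficient is a
    function of the previous ones and whose mean is therefore 0, and by at most
    4 b_k^2 g_k^2. *)
Lemma mean_lse_psum k : (k <= N)%N ->
  mean P (fun w => lse (S k w)) <=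
  lse (fun _ : A => 0 : R) + 4 * \sum_(n < N | (n < k)%N) b n ^+ 2.
Proof.
elim: k => [_|k IH kN].
  rewrite big_pred0// mulr0 addr0 (eq_mean P (g := fun=> lse (fun _ : A => 0 : R))) ?mean_cst// => w.
  by congr lse; apply/funext => i; rewrite /S psum0.
pose k' := Ordinal kN; have := IH (ltnW kN).
set m := mean _ _ => hm.
rewrite (@sum_ltS (fun n => b n ^+ 2) k') mulrDr addrA.
pose G i w := lse_grad (S k w) i.
have mG i : measurable_fun setT (G i : past Y (before k) -> R).
  apply: measurable_funM; last first.
    apply: measurableT_comp => //; apply: measurable_funN.
    apply: measurableT_comp; first exact: measurable_ln.
    exact: measurable_lse_sum_S.
  apply: measurable_funB; apply: measurableT_comp => //; first exact: psum_past.
  by apply: measurableT_comp => //; exact: psum_past.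
have G1 i : L1 P (G i) := L1_past_bounded (mG i) (fun w => lse_grad_abs i0 _ _).
have GY i := @psum_mean k' (G i) id (mG i) (G1 i) (@measurable_id _ _ setT) (Y1 (e k')).
pose step w := lse (S k w) + \sum_i (a i k' * (G i w * Y (e k') w)) + 4 * b k' ^+ 2 * Y (e k') w ^+ 2.
have L1_2 : L1 P (fun w => \sum_i (a i k' * (G i w * Y (e k') w))).
  by apply: L1_sum => i _; apply: L1Z; have [] := GY i.
have L1_3 : L1 P (fun w => 4 * b k' ^+ 2 * Y (e k') w ^+ 2) by exact: L1Z.
have L1_1 := L1_lse_psum k.
apply: le_trans (_ : mean P step <= _).
  apply: le_mean; first exact: L1_lse_psum.
    by apply: L1D L1_3; exact: L1D.
  move=> w; rewrite /step.
  have -> : S k.+1 w = fun i => S k w i + Y (e k') w * a i k'.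
    by apply/funext => i; rewrite /S (@psum_recr _ k').
  apply: le_trans (lse_step i0 (b := `|Y (e k') w| * b k') _ _) _.
    by move=> i; rewrite normrM ler_wpM2l.
  rewrite exprMn real_normK ?num_real// [X in _ + 4 * X]mulrC mulrA.
  rewrite lerD2r lerD2l le_eqVlt; apply/orP; left; apply/eqP; apply: eq_bigr => i _.
  by rewrite /G mulrCA mulrC mulrA -mulrA mulrC mulrCA; ring.
rewrite /step meanD//; last exact: L1D.
rewrite meanZ// Yvar mulr1 lerD2r meanD// mean_sum; last first.
  by move=> i _; apply: L1Z; have [] := GY i.
rewrite big1 ?addr0// => i _; have [GL GE] := GY i.
by rewrite meanZ// GE [X in _ * (_ * X)](Y0 (e k')) !mulr0.
Qed.

End maximal.

Section clt.
Context (a : 'I_N -> R) (dl kap : R).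
Hypothesis a_small : forall n, `|a n| <= dl.
Hypothesis Ykap : forall i, mean P (fun w => Y i w ^+ 2 * Num.min 1 (dl * `|Y i w|)) <= kap.

Let dl0 (n : 'I_N) : 0 <= dl := le_trans (normr_ge0 _) (a_small n).

Let S := psum a.

Let L1_trem (n : 'I_N) :
  L1 P (fun w => Y (e n) w ^+ 2 * Num.min 1 (dl * `|Y (e n) w|)).
Proof.
apply: L1_le (Y2 (e n)) _.
  apply: measurable_funM; first exact: measurable_funX.
  apply: measurable_minr; first exact: measurable_cst.
  by apply: measurable_funM; [exact: measurable_cst|exact: measurableT_comp].
move=> w; rewrite normrM normrX real_normK ?num_real//.
rewrite ger0_norm ?le_min ?ler01 ?mulr_ge0// ?(dl0 n)//.
by rewrite -[leRHS]mulr1 ler_wpM2l ?sqr_ge0// ge_min lexx.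
Qed.

Let L1_trig (f : R -> R) (U : T -> R) : measurable_fun setT f -> (forall x, `|f x| <= 1) ->
  measurable_fun setT U -> L1 P (f \o U).
Proof.
by move=> mf f1 mU; apply: (@L1_bounded _ _ _ _ _ 1) => [|x /=]; [exact: measurableT_comp|exact: f1].
Qed.

Let mcos : measurable_fun setT (@cos R).
Proof. by apply: continuous_measurable_fun; exact: continuous_cos. Qed.
Let msin : measurable_fun setT (@sin R).
Proof. by apply: continuous_measurable_fun; exact: continuous_sin. Qed.

Let mYa n : measurable_fun setT (fun w => Y (e n) w * a n).
Proof. by apply: measurable_funM => //; exact: measurable_cst. Qed.

(** Here and in the next lemma the Taylor remainder is at most
    a^2 g^2 min(1, dl |g|), whose mean is at most a^2 kap. *)
Lemma mean_cos_small n :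
  `|mean P (fun w => cos (Y (e n) w * a n)) - (1 - a n ^+ 2 / 2)| <= a n ^+ 2 * kap.
Proof.
have Lc : L1 P (fun w => cos (Y (e n) w * a n)) by exact: L1_trig mcos (@cos_max R) (mYa n).
have e1 : mean P (fun w => cos (Y (e n) w * a n) - (1 - a n ^+ 2 / 2 * Y (e n) w ^+ 2)) =
    mean P (fun w => cos (Y (e n) w * a n)) - (1 - a n ^+ 2 / 2).
  rewrite meanB//; last by apply: L1B; [exact: L1_cst|exact: L1Z].
  by rewrite meanB//; [rewrite mean_cst meanZ// Yvar mulr1|exact: L1_cst|exact: L1Z].
rewrite -e1; apply: le_trans (_ : mean P
    (fun w => a n ^+ 2 * (Y (e n) w ^+ 2 * Num.min 1 (dl * `|Y (e n) w|))) <= _).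
  apply: mean_abs_le.
  - by apply: L1B => //; apply: L1B; [exact: L1_cst|exact: L1Z].
  - exact: L1Z.
  move=> w; apply: le_trans (trem_scale (Y (e n) w) (a_small n)).
  apply: le_trans (cos_trem _); rewrite le_eqVlt; apply/orP; left; apply/eqP.
  by congr (`| _ |); rewrite exprMn; ring.
by rewrite meanZ// ler_wpM2l ?sqr_ge0.
Qed.

Lemma mean_sin_small n : `|mean P (fun w => sin (Y (e n) w * a n))| <= a n ^+ 2 * kap.
Proof.
have Lc : L1 P (fun w => sin (Y (e n) w * a n)) by exact: L1_trig msin (@sin_max R) (mYa n).
have Ly : L1 P (fun w => Y (e n) w * a n).
  by apply: eq_L1 (L1Z (a n) (Y1 (e n))) => w; rewrite mulrC.
have e1 : mean P (fun w => sin (Y (e n) w * a n) - Y (e n) w * a n) =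
    mean P (fun w => sin (Y (e n) w * a n)).
  rewrite meanB// (eq_mean P (f := fun w => _ * a n) (g := fun w => a n * Y (e n) w)).
    by rewrite meanZ// Y0 mulr0 subr0.
  by move=> w; rewrite mulrC.
rewrite -e1; apply: le_trans (_ : mean P
    (fun w => a n ^+ 2 * (Y (e n) w ^+ 2 * Num.min 1 (dl * `|Y (e n) w|))) <= _).
  apply: mean_abs_le; [exact: L1B|exact: L1Z|] => w.
  apply: le_trans (trem_scale (Y (e n) w) (a_small n)); exact: sin_trem.
by rewrite meanZ// ler_wpM2l ?sqr_ge0.
Qed.

Let L1_cosS k : L1 P (fun w => cos (S k w)).
Proof. by apply: L1_trig mcos (@cos_max R) _; exact: measurable_psum. Qed.
Let L1_sinS k : L1 P (fun w => sin (S k w)).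
Proof. by apply: L1_trig msin (@sin_max R) _; exact: measurable_psum. Qed.

Let mean_prod (k' : 'I_N) (f h : R -> R) :
  measurable_fun setT f -> measurable_fun setT h ->
  (forall x, `|f x| <= 1) -> (forall x, `|h x| <= 1) ->
  L1 P (fun w => f (S k' w) * h (Y (e k') w * a k')) /\
  mean P (fun w => f (S k' w) * h (Y (e k') w * a k')) =
  mean P (fun w => f (S k' w)) * mean P (fun w => h (Y (e k') w * a k')).
Proof.
move=> mf mh f1 h1.
have mha : measurable_fun setT (fun y : R => h (y * a k')).
  by apply: measurableT_comp => //; exact: mulrr_measurable.
apply: (@psum_mean k' (fun w => f (S k' w)) (fun y => h (y * a k'))) => //.
- by apply: measurableT_comp => //; exact: psum_past.
- by apply: L1_trig mf f1 _; exact: measurable_psum.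
exact: L1_trig mh h1 (mYa k').
Qed.

(** Lindeberg's argument for the real and imaginary parts of the characteristic
    function: adding a summand multiplies it by 1 - a_k^2/2, up to a_k^2 times a
    small number, and exp(-v/2) changes by the same factor up to such an error. *)
Lemma mean_char_psum k : (k <= N)%N ->
  let v := \sum_(n < N | (n < k)%N) a n ^+ 2 in
  `|mean P (fun w => cos (S k w)) - expR (- (v / 2))| <= (2 * kap + dl ^+ 2) * v /\ `|mean P (fun w => sin (S k w))| <= (2 * kap + dl ^+ 2) * v.
Proof.
elim: k => [_|k IH kN] /=.
  rewrite big_pred0// mul0r oppr0 expR0 mulr0.
  split.
    rewrite (@eq_mean _ _ _ P _ (fun=> 1)); last by move=> w; rewrite /S psum0 cos0.
    by rewrite mean_cst subrr normr0.
  rewrite (@eq_mean _ _ _ P _ (fun=> 0)); last by move=> w; rewrite /S psum0 sin0.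
  by rewrite mean_cst normr0.
pose k' := Ordinal kN; have [] := IH (ltnW kN).
rewrite (@sum_ltS (fun n => a n ^+ 2) k'); set v := \sum_(n < N | _) _ => hC hD.
have v0 : 0 <= v by apply: sumr_ge0 => n _; rewrite sqr_ge0.
have [Lcc Ecc] := mean_prod k' mcos mcos (@cos_max R) (@cos_max R).
have [Lss Ess] := mean_prod k' msin msin (@sin_max R) (@sin_max R).
have [Lsc Esc] := mean_prod k' msin mcos (@sin_max R) (@cos_max R).
have [Lcs Ecs] := mean_prod k' mcos msin (@cos_max R) (@sin_max R).
have SS w : S k.+1 w = S k w + Y (e k') w * a k' by rewrite /S (@psum_recr _ k').
have EC : mean P (fun w => cos (S k.+1 w)) =
    mean P (fun w => cos (S k w)) * mean P (fun w => cos (Y (e k') w * a k')) -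
    mean P (fun w => sin (S k w)) * mean P (fun w => sin (Y (e k') w * a k')).
  by rewrite -Ecc -Ess -meanB//; apply: eq_mean => w; rewrite SS cosD.
have ED : mean P (fun w => sin (S k.+1 w)) =
    mean P (fun w => sin (S k w)) * mean P (fun w => cos (Y (e k') w * a k')) +
    mean P (fun w => cos (S k w)) * mean P (fun w => sin (Y (e k') w * a k')).
  by rewrite -Esc -Ecs -meanD//; apply: eq_mean => w; rewrite SS sinD.
have c1 : `|mean P (fun w => cos (S k w))| <= 1.
  by apply: mean_abs_bound => [|w]; [exact: L1_measurable (L1_cosS k)|exact: cos_max].
have s1 : `|mean P (fun w => sin (S k w))| <= 1.
  by apply: mean_abs_bound => [|w]; [exact: L1_measurable (L1_sinS k)|exact: sin_max].
rewrite EC ED.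
have hc := mean_cos_small k'; have hs := mean_sin_small k'.
have q0 := sqr_ge0 (a k').
have qd : a k' ^+ 2 <= dl ^+ 2.
  by rewrite -real_normK ?num_real// lerXn2r ?nnegrE// (dl0 k').
have hq := @expRN_sub_le R (a k' ^+ 2 / 2) (divr_ge0 q0 (ler0n _ 2)).
have -> : expR (- ((v + a k' ^+ 2) / 2)) = expR (- (v / 2)) * expR (- (a k' ^+ 2 / 2)).
  by rewrite mulrDl opprD expRD.
move: c1 s1 hc hs hC hD hq q0 qd.
set C := mean P (fun w => cos (S k w)); set D := mean P (fun w => sin (S k w)).
set cc := mean _ _; set ss := mean P (fun w => sin (Y (e k') w * a k')).
move: (a k' ^+ 2) => q; set E1 := expR (- (v / 2)); set E2 := expR (- (q / 2)).
move=> c1 s1 hc hs hC hD hq q0 qd.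
have E1b : 0 <= E2 <= 1 by rewrite expR_ge0/= -(expR0 R) ler_expR; lra.
have qq : (q / 2) ^+ 2 <= q * dl ^+ 2.
  rewrite (_ : (q / 2) ^+ 2 = q * (q / 4)); last by field.
  by rewrite ler_wpM2l//; lra.
have cE2 : `|cc - E2| <= q * (kap + dl ^+ 2).
  rewrite (_ : cc - E2 = (cc - (1 - q / 2)) - (E2 - (1 - q / 2))); last by ring.
  by apply: le_trans (ler_normB _ _) _; rewrite mulrDr lerD// (le_trans hq).
have Css : `|C * (cc - E2)| <= q * (kap + dl ^+ 2).
  by rewrite normrM -[leRHS]mul1r ler_pM.
have Dcc : `|D * (cc - E2)| <= q * (kap + dl ^+ 2).
  by rewrite normrM -[leRHS]mul1r ler_pM.
have Dss : `|D * ss| <= q * kap by rewrite normrM -[leRHS]mul1r ler_pM.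
have Cs2 : `|C * ss| <= q * kap by rewrite normrM -[leRHS]mul1r ler_pM.
have mE2 x M : `|x| <= M -> `|x * E2| <= M.
  move=> xM; rewrite normrM (ger0_norm (x := E2)); last by case/andP: E1b.
  by rewrite -[leRHS]mulr1 ler_pM//; case/andP: E1b.
have hC2 := mE2 _ _ hC; have hD2 := mE2 _ _ hD.
have -> : (2 * kap + dl ^+ 2) * (v + q) = (2 * kap + dl ^+ 2) * v + (q * (kap + dl ^+ 2) + q * kap) by ring.
split.
  have -> : C * cc - D * ss - E1 * E2 = (C - E1) * E2 + (C * (cc - E2) - D * ss) by ring.
  apply: le_trans (ler_normD _ _) _; rewrite lerD//.
  by apply: le_trans (ler_normB _ _) _; rewrite lerD.
have -> : D * cc + C * ss = D * E2 + (D * (cc - E2) + C * ss) by ring.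
apply: le_trans (ler_normD _ _) _; rewrite lerD//.
by apply: le_trans (ler_normD _ _) _; rewrite lerD.
Qed.

End clt.
End multiplier_sums.

(** * Uniform approximation by trigonometric polynomials *)

Section coins.
Context (R : realType) (J : finType) (u : J -> R).
Implicit Types (b : {ffun J -> bool}) (p q : J).

Definition sgnb (x : bool) : R := if x then 1 else -1.

Definition coin p (x : bool) : R := (1 + sgnb x * u p) / 2.

(** Probability of the outcome b for independent signs with means u_p; a finite
    sum weighted by it is an expectation. *)
Definition coins b : R := \prod_p coin p (b p).

Lemma coins_ge0 b : (forall p, `|u p| <= 1) -> 0 <= coins b.
Proof.
move=> u1; apply: prodr_ge0 => p _; have /ler_normlP[? ?] := u1 p.
by rewrite /coin /sgnb; case: (b p); lra.
Qed.

Lemma coins_prod (F : J -> bool -> R) :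
  \sum_b coins b * \prod_p F p (b p) = \prod_p (coin p true * F p true + coin p false * F p false).
Proof.
transitivity (\prod_p \sum_(x : bool) coin p x * F p x).
  by rewrite bigA_distr_bigA; apply: eq_bigr => b _; rewrite /coins -big_split.
by apply: eq_bigr => p _; rewrite big_bool.
Qed.

Lemma coins_sum1 : \sum_b coins b = 1.
Proof.
transitivity (\sum_b coins b * \prod_(p : J) (1 : R)).
  by apply: eq_bigr => b _; rewrite big1 ?mulr1.
rewrite (coins_prod (fun _ _ => 1)) big1// => p _.
by rewrite /coin /sgnb; lra.
Qed.

Lemma coins_cov p q : \sum_b coins b * ((sgnb (b p) - u p) * (sgnb (b q) - u q)) =
  if p == q then 1 - u p ^+ 2 else 0.
Proof.
pose F r x := (if r == p then sgnb x - u p else 1) * (if r == q then sgnb x - u q else 1).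
transitivity (\sum_b coins b * \prod_r F r (b r)).
  apply: eq_bigr => b _; congr (_ * _).
  by rewrite /F big_split/= -!big_mkcond !big_pred1_eq.
rewrite coins_prod {}/F; case: eqVneq => [<-|pq].
  rewrite (bigD1 p)//= eqxx big1 ?mulr1; first by rewrite /coin /sgnb; field.
  by move=> r /negbTE ->; rewrite /coin /sgnb; lra.
rewrite (bigD1 p)//= eqxx (negbTE pq) !mulr1.
by rewrite [X in X * _](_ : _ = 0) ?mul0r// /coin /sgnb; field.
Qed.

End coins.

Section sine_bernstein.
Context (R : realType) (I : finType) (q : nat) (l : R).
Hypothesis (q0 : (0 < q)%N) (l0 : 0 < l).
Implicit Types (z : I -> R) (phi : (I -> R) -> R).

Let n := (q * q)%N.
Let J := (I * 'I_n)%type.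
Let u z (p : J) := sin (z p.1 / l).

Definition bernstein_node (b : {ffun I * 'I_n -> bool}) : I -> R :=
  fun i => l * (n%:R^-1 * \sum_(k < n) sgnb R (b (i, k))).

(** Each coordinate z_i is estimated by l times the average of q^2 signs of mean
    sin(z_i/l). The weights are trigonometric polynomials in z and depend
    neither on phi nor on its modulus of continuity. *)
Definition bernstein phi z : R :=
  \sum_b coins (u z) b * phi (bernstein_node b).

Definition lip1 phi := forall z z', `|phi z - phi z'| <= \sum_i `|z i - z' i|.

Let n0 : 0 < n%:R :> R.
Proof. by rewrite ltr0n /n muln_gt0 q0. Qed.

(** The sum of q^2 independent centred signs has variance at most q^2. *)
Let coin_dev z i :
  \sum_b coins (u z) b * `|\sum_(k < n) (sgnb R (b (i, k)) - sin (z i / l))| <= q%:R.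
Proof.
have w0 b : 0 <= coins (u z) b by apply: coins_ge0 => p; exact: sin_max.
have qR : 0 < q%:R :> R by rewrite ltr0n.
have amgm (x : R) : `|x| <= (q%:R + x ^+ 2 / q%:R) / 2.
  rewrite -(@ler_pM2r _ (2 * q%:R)) ?mulr_gt0//.
  have -> : (q%:R + x ^+ 2 / q%:R) / 2 * (2 * q%:R) = q%:R ^+ 2 + x ^+ 2.
    by field; rewrite gt_eqF.
  by rewrite -(real_normK (num_real x)); have := sqr_ge0 (`|x| - q%:R); lra.
apply: le_trans (_ : \sum_b coins (u z) b *
    ((q%:R + (\sum_(k < n) (sgnb R (b (i, k)) - sin (z i / l))) ^+ 2 / q%:R) / 2) <= _).
  by apply: ler_sum => b _; rewrite ler_wpM2l.
have -> : \sum_b coins (u z) b *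
    ((q%:R + (\sum_(k < n) (sgnb R (b (i, k)) - sin (z i / l))) ^+ 2 / q%:R) / 2) =
   q%:R / 2 + (2 * q%:R)^-1 * \sum_b coins (u z) b *
     (\sum_(k < n) (sgnb R (b (i, k)) - sin (z i / l))) ^+ 2.
  transitivity (\sum_b (q%:R / 2 * coins (u z) b + (2 * q%:R)^-1 * (coins (u z) b *
      (\sum_(k < n) (sgnb R (b (i, k)) - sin (z i / l))) ^+ 2))).
    by apply: eq_bigr => b _; field; rewrite gt_eqF.
  by rewrite big_split/= -!mulr_sumr coins_sum1 mulr1.
have -> : \sum_b coins (u z) b * (\sum_(k < n) (sgnb R (b (i, k)) - sin (z i / l))) ^+ 2 =
   \sum_(k < n) (1 - u z (i, k) ^+ 2).
  under eq_bigr do rewrite expr2 big_distrlr/= mulr_sumr.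
  rewrite exchange_big/=; apply: eq_bigr => k _.
  under eq_bigr do rewrite mulr_sumr.
  rewrite exchange_big/= (bigD1 k)//= [X in _ + X]big1 => [|j jk].
    by rewrite addr0; have := coins_cov (u z) (i, k) (i, k); rewrite eqxx.
  have := coins_cov (u z) (i, k) (i, j); rewrite xpair_eqE eqxx/= eq_sym (negbTE jk).
  exact.
apply: le_trans (_ : q%:R / 2 + (2 * q%:R)^-1 * (q * q)%:R <= _).
  rewrite lerD2l ler_wpM2l ?invr_ge0 ?mulr_ge0//.
  apply: le_trans (_ : \sum_(k < n) (1 : R) <= _).
    by apply: ler_sum => k _; rewrite gerBl sqr_ge0.
  by rewrite sumr_const card_ord.
by rewrite natrM le_eqVlt; apply/orP; left; apply/eqP; field; rewrite gt_eqF.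
Qed.

(** The first term is the fluctuation of the averaged signs, the second the
    error of l sin(z/l) as an approximation of z, bounded by z^2/l. *)
Lemma bernstein_approx phi z : lip1 phi ->
  `|phi z - bernstein phi z| <= #|I|%:R * (l / q%:R) + \sum_i z i ^+ 2 / l.
Proof.
move=> lphi; have qR : 0 < q%:R :> R by rewrite ltr0n.
have w0 b : 0 <= coins (u z) b by apply: coins_ge0 => p; exact: sin_max.
pose zl i := l * sin (z i / l).
have e1 : `|phi z - phi zl| <= \sum_i z i ^+ 2 / l.
  apply: le_trans (lphi _ _) _; apply: ler_sum => i _.
  have -> : z i - zl i = - (l * (sin (z i / l) - z i / l)).
    by rewrite /zl; field; rewrite gt_eqF.
  rewrite normrN normrM (gtr0_norm l0).
  apply: le_trans (ler_wpM2l (ltW l0) (sin_trem _)) _.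
  have : trem (z i / l) <= `|z i / l| ^+ 2 by rewrite /trem ge_min lexx.
  move=> /(ler_wpM2l (ltW l0)) /le_trans; apply.
  rewrite real_normK ?num_real// le_eqVlt; apply/orP; left; apply/eqP.
  by field; rewrite gt_eqF.
have e2 : `|phi zl - bernstein phi z| <= #|I|%:R * (l / q%:R).
  have -> : phi zl - bernstein phi z =
      \sum_b (coins (u z) b * phi zl - coins (u z) b * phi (bernstein_node b)).
    by rewrite sumrB -mulr_suml coins_sum1 mul1r.
  apply: le_trans (ler_norm_sum _ _ _) _.
  apply: le_trans (_ : \sum_b coins (u z) b * \sum_i `|zl i - bernstein_node b i| <= _).
    apply: ler_sum => b _; rewrite -mulrBr normrM (ger0_norm (w0 b)) ler_wpM2l//.
  under eq_bigr do rewrite mulr_sumr.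
  rewrite exchange_big/=.
  apply: le_trans (_ : \sum_(i : I) (l / q%:R) <= _); last first.
    by rewrite sumr_const mulr_natl.
  apply: ler_sum => i _.
  have -> : \sum_b coins (u z) b * `|zl i - bernstein_node b i| =
      l / n%:R * \sum_b coins (u z) b * `|\sum_(k < n) (sgnb R (b (i, k)) - sin (z i / l))|.
    rewrite mulr_sumr; apply: eq_bigr => b _; rewrite mulrCA; congr (_ * _).
    rewrite -[l / n%:R]ger0_norm ?divr_ge0 ?ltW// -normrM distrC; congr (`| _ |).
    rewrite sumrB sumr_const card_ord /zl /bernstein_node -[sin _ *+ n]mulr_natl.
    by field; rewrite gt_eqF.
  apply: le_trans (ler_wpM2l _ (coin_dev z i)) _; first by rewrite divr_ge0 ?ltW.
  by rewrite /n natrM le_eqVlt; apply/orP; left; apply/eqP; field; rewrite gt_eqF.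
have -> : phi z - bernstein phi z = (phi z - phi zl) + (phi zl - bernstein phi z) by ring.
by apply: le_trans (ler_normD _ _) _; rewrite addrC lerD.
Qed.

End sine_bernstein.

Section trigonometric_polynomials.
Context (R : realType) (I : finType).
Implicit Types (z t : I -> R).

(** Amplitude, phase and frequency vector. A phase is kept so that sine waves and
    products of waves are again of this form. *)
Definition wave (m : R * R * (I -> R)) z : R :=
  m.1.1 * cos (\sum_i m.2 i * z i + m.1.2).

Definition trig (s : seq (R * R * (I -> R))) z : R := \sum_(m <- s) wave m z.

Lemma trig_mul s1 s2 : exists s, forall z, trig s z = trig s1 z * trig s2 z.
Proof.
have wM m1 m2 : exists s, forall z, trig s z = wave m1 z * wave m2 z.
  exists [:: (m1.1.1 * m2.1.1 / 2, m1.1.2 + m2.1.2, fun i => m1.2 i + m2.2 i);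
             (m1.1.1 * m2.1.1 / 2, m1.1.2 - m2.1.2, fun i => m1.2 i - m2.2 i)].
  move=> z; rewrite /trig !big_cons big_nil addr0 /wave /=.
  set A := \sum_i m1.2 i * z i; set B := \sum_i m2.2 i * z i.
  have -> : \sum_i (m1.2 i + m2.2 i) * z i = A + B.
    by rewrite -big_split; apply: eq_bigr => i _; rewrite mulrDl.
  have -> : \sum_i (m1.2 i - m2.2 i) * z i = A - B.
    by rewrite -sumrB; apply: eq_bigr => i _; rewrite mulrBl.
  rewrite [A + B + _]addrACA [A - B + _]addrACA -opprD cosD cosB.
  by field.
have wT m : exists s, forall z, trig s z = wave m z * trig s2 z.
  elim: s2 => [|m2 s2 [s IH]]; first by exists [::] => z; rewrite /trig !big_nil mulr0.
  have [s' hs'] := wM m m2; exists (s' ++ s) => z.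
  by rewrite /trig big_cat big_cons/= mulrDr -!/(trig _ _) hs' IH.
elim: s1 => [|m1 s1 [s IH]]; first by exists [::] => z; rewrite /trig !big_nil mul0r.
have [s' hs'] := wT m1; exists (s' ++ s) => z.
by rewrite /trig big_cat big_cons/= mulrDl -!/(trig _ _) hs' IH.
Qed.

Lemma trig_coins q (l : R) (b : {ffun I * 'I_q -> bool}) :
  exists s, forall z, trig s z = coins (fun p : I * 'I_q => sin (z p.1 / l)) b.
Proof.
rewrite /coins; elim: (index_enum _) => [|p r [s IH]].
  exists [:: (1, 0, fun=> 0)] => z; rewrite /trig big_seq1 big_nil /wave /= mul1r addr0.
  by rewrite big1 ?cos0// => i _; rewrite mul0r.
have [s' hs'] := trig_mul
  [:: (2^-1, 0, fun=> 0); (sgnb R (b p) / 2, - (pi / 2), fun i => if i == p.1 then l^-1 else 0)] s.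
exists s' => z; rewrite hs' IH big_cons; congr (_ * _).
rewrite /trig !big_cons big_nil /wave /= !addr0 big1 ?cos0; last by move=> i _; rewrite mul0r.
rewrite (bigD1 p.1)//= eqxx big1 ?addr0; last by move=> i /negbTE ->; rewrite mul0r.
by rewrite cosBpihalf /coin mulrC [l^-1 * _]mulrC; field.
Qed.

End trigonometric_polynomials.

(** * Finite-dimensional central limit theorem *)

Section finite_continuous_measurable.
Context (R : realType) d (T : measurableType d) (I : finType).

Definition fin_continuous (phi : (I -> R) -> R) := forall z (e : R), 0 < e ->
  exists2 dl : R, 0 < dl &
    forall z', (forall i, `|z i - z' i| <= dl) -> `|phi z - phi z'| <= e.

Let measurable_grid (psi : {ffun I -> int} -> R) (z : I -> T -> R) (k : R) :
  (forall i, measurable_fun setT (z i)) ->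
  measurable_fun setT (fun w => psi [ffun i => Num.floor (z i w * k)]).
Proof.
move=> mz _ A mA; rewrite setTI.
pose F (m : {ffun I -> int}) : set T :=
  if psi m \in A then \bigcap_(i in [set: I]) [set w | Num.floor (z i w * k) = m i] else set0.
have -> : (fun w => psi [ffun i => Num.floor (z i w * k)]) @^-1` A = \bigcup_m F m.
  apply/seteqP; split => w /=.
    move=> wA; exists [ffun i => Num.floor (z i w * k)] => //.
    by rewrite /F mem_set// => i _ /=; rewrite ffunE.
  move=> [m _]; rewrite /F; case: ifP => // /set_mem mA' wm.
  rewrite (_ : [ffun _ => _] = m)//; apply/ffunP => i; rewrite ffunE; exact: wm.
apply: countable_bigcupT_measurable; first exact: countableP.
move=> m; rewrite /F; case: ifP => // _.
apply: fin_bigcap_measurable; first exact: finite_finset.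
move=> i _; rewrite [X in measurable X](_ : _ =
    (fun w => z i w * k) @^-1` `[(m i)%:~R, (m i + 1)%:~R[%classic).
  rewrite -[X in measurable X]setTI.
  by apply: (measurable_funM (mz i) (measurable_cst k)).
by apply/seteqP; split => w /=; rewrite in_itv/= -floor_eq => /eqP.
Qed.

(** A continuous function of finitely many measurable variables is the limit of
    its values at the points obtained by rounding the variables to multiples of
    1/(k+1); a rounded vector takes countably many values. *)
Lemma measurable_fin_continuous (phi : (I -> R) -> R) (z : I -> T -> R) :
  fin_continuous phi -> (forall i, measurable_fun setT (z i)) ->
  measurable_fun setT (fun w => phi (fun i => z i w)).
Proof.
move=> cphi mz.
pose r (k : nat) (x : R) : R := (Num.floor (x * k.+1%:R))%:~R / k.+1%:R.
have rE k x : `|x - r k x| <= k.+1%:R^-1.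
  have k0 : 0 < k.+1%:R :> R by [].
  have /andP[h1 h2] := floor_itv (x * k.+1%:R).
  have e : x - r k x = (x * k.+1%:R - (Num.floor (x * k.+1%:R))%:~R) / k.+1%:R.
    by rewrite /r; field; rewrite gt_eqF.
  rewrite e ger0_norm; last by rewrite divr_ge0 ?subr_ge0// ltW.
  rewrite -[leRHS]mul1r; apply: ler_wpM2r; first by rewrite invr_ge0 ltW.
  by move: h2; rewrite intrD => h2; rewrite lerBlDr addrC ltW.
apply: (@measurable_fun_cvg _ _ _ setT (fun k w => phi (fun i => r k (z i w)))).
  move=> k; have := measurable_grid (fun m : {ffun I -> int} => phi (fun i => (m i)%:~R / k.+1%:R)) k.+1%:R mz.
  congr measurable_fun; apply/funext => w; congr phi; apply/funext => i.
  by rewrite ffunE.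
move=> w _; apply/cvgrPdist_le => e e0.
have [dl dl0 h] := cphi (fun i => z i w) e e0.
near=> k; apply: h => i; apply: le_trans (rE k _) _.
near: k; have := near_infty_natSinv_lt (PosNum dl0).
by apply: filterS => k /= /ltW.
Unshelve. all: by end_near. Qed.

Lemma lip1_fin_continuous (phi : (I -> R) -> R) : lip1 phi -> fin_continuous phi.
Proof.
move=> lphi z e e0; exists (e / #|I|.+1%:R); first by rewrite divr_gt0.
move=> z' h; apply: le_trans (lphi _ _) _.
apply: le_trans (_ : \sum_(i : I) e / #|I|.+1%:R <= _); first exact: ler_sum.
rewrite sumr_const -[_ *+ #|_|]mulr_natr -mulrA ler_piMr ?ltW//.
by rewrite mulrC ltr_pdivrMr// mul1r ltr_nat.
Qed.

End finite_continuous_measurable.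

Section finite_dimensional_clt.
Context (R : realType) d (T : measurableType d) (P : probability T R).
Context (J : choiceType) (Y : J -> T -> R).
Hypothesis Y1 : forall i, L1 P (Y i).
Hypothesis Y0 : forall i, mean P (Y i) = 0.
Hypothesis Y2 : forall i, L1 P (fun w => Y i w ^+ 2).
Hypothesis Yvar : forall i, mean P (fun w => Y i w ^+ 2) = 1.
Hypothesis indepY : mutually_independent P Y.
Hypothesis Ylind : forall e : R, 0 < e -> exists2 dl0 : R, 0 < dl0 &
  forall dl : R, 0 < dl <= dl0 -> forall i, mean P (fun w => Y i w ^+ 2 * Num.min 1 (dl * `|Y i w|)) <= e.

Context d' (T' : measurableType d') (P' : probability T' R).
Context (I : finType) (Z : I -> T' -> R) (C : I -> I -> R).
Hypothesis Z2 : forall i, L1 P' (fun w => Z i w ^+ 2).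
Hypothesis Zvar : forall i, mean P' (fun w => Z i w ^+ 2) = C i i.
Hypothesis mZ : forall i, measurable_fun setT (Z i).
Hypothesis Zchar : forall (t : I -> R) (th : R),
  mean P' (fun w => cos (\sum_i t i * Z i w + th)) =
  cos th * expR (- ((\sum_i \sum_j t i * t j * C i j) / 2)).

Definition zeta N (e : 'I_N -> J) (a : I -> 'I_N -> R) (w : T) : I -> R :=
  fun i => \sum_(n < N) Y (e n) w * a i n.

Definition clt_array (dl : R) N (a : I -> 'I_N -> R) : Prop :=
  (forall i n, `|a i n| <= dl) /\
  (forall i j, `|\sum_(n < N) a i n * a j n - C i j| <= dl).

(** Convergence of the expectation of f, stated for arrays that are close to the
    limit, so that no sequence of arrays has to be fixed. *)
Definition clt_test (f : (I -> R) -> R) : Prop := forall eps : R, 0 < eps ->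
  exists2 dl, 0 < dl & forall N (e : 'I_N -> J) (a : I -> 'I_N -> R),
    injective e -> clt_array dl a ->
    `|mean P (fun w => f (zeta e a w)) - mean P' (fun w => f (Z ^~ w))| <= eps.

Lemma clt_array_le dl dl' N (a : I -> 'I_N -> R) : dl <= dl' -> clt_array dl a -> clt_array dl' a.
Proof. by move=> dd [h1 h2]; split=> *; apply: le_trans dd; [exact: h1|exact: h2]. Qed.

Let mcos : measurable_fun setT (@cos R).
Proof. by apply: continuous_measurable_fun; exact: continuous_cos. Qed.

Let mzeta N (e : 'I_N -> J) a i : measurable_fun setT (fun w => zeta e a w i).
Proof.
apply: measurable_sum => n; apply: measurable_funM; last exact: measurable_cst.
exact: L1_measurable.
Qed.

Let L1_wave dT (U : measurableType dT) (Q : probability U R) (X : I -> U -> R) m :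
  (forall i, measurable_fun setT (X i)) -> L1 Q (fun w => wave m (X ^~ w)).
Proof.
move=> mX; apply: L1Z; apply: (@L1_bounded _ _ _ _ _ 1); last by move=> w; exact: cos_max.
apply: measurableT_comp => //; apply: measurable_funD; last exact: measurable_cst.
by apply: measurable_sum => i; apply: measurable_funM => //; exact: measurable_cst.
Qed.

(** By linearity sum_i t_i zeta_i is a single sum of multipliers with the weights
    al_n = sum_i t_i a_(i,n), whose squares add up to nearly t^T C t; the result is
    then [mean_char_psum]. *)
Lemma clt_wave m : clt_test (wave m).
Proof.
case: m => [[c th] t] eps eps0.
pose tau := \sum_i `|t i|; pose V := \sum_i \sum_j t i * t j * C i j.
have tau0 : 0 <= tau by apply: sumr_ge0.
pose M := `|V| + 1; have M1 : 1 <= M by rewrite lerDr.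
pose e1 := eps / (`|c| + 1) / (16 * M).
have c1 : 0 < `|c| + 1 by rewrite ltr_wpDl.
have e10 : 0 < e1 by rewrite !divr_gt0 ?mulr_gt0// (lt_le_trans ltr01).
have [d0 d00 hd0] := Ylind e10.
pose dd := Num.min d0 (Num.min 1 e1).
have dd0 : 0 < dd by rewrite !lt_min d00 ltr01.
have ddle : [/\ dd <= d0, dd <= 1 & dd <= e1].
  by rewrite /dd !ge_min !lexx ?orbT.
pose E := expR (- (V / 2)).
pose e2 := eps / (`|c| + 1) / (2 * (E + 1)).
have E0 : 0 < E := expR_gt0 _.
have e20 : 0 < e2 by rewrite divr_gt0 ?divr_gt0// mulr_gt0// addr_gt0.
pose dl := Num.min (dd / (tau + 1)) (Num.min 1 e2 / (tau ^+ 2 + 1)).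
have t1 : 0 < tau + 1 by rewrite ltr_wpDl.
have t2 : 0 < tau ^+ 2 + 1 by rewrite ltr_wpDl ?sqr_ge0.
exists dl; first by rewrite lt_min !divr_gt0// lt_min ltr01.
move=> N e a ie [a1 a2].
have [dl1 dl2] : dl * tau <= dd /\ dl * tau ^+ 2 <= Num.min 1 e2.
  have h (x y : R) : 0 < x -> 0 <= y -> x / (y + 1) * y <= x.
    move=> x0 y0; rewrite mulrAC ler_pdivrMr ?ltr_wpDl//.
    by apply: ler_wpM2l; [exact: ltW|rewrite lerDl].
  split.
    by apply: le_trans (h dd tau dd0 tau0); rewrite ler_wpM2r// ge_min lexx.
  apply: le_trans (h (Num.min 1 e2) (tau ^+ 2) _ (sqr_ge0 _)).
    by rewrite ler_wpM2r ?sqr_ge0// /dl ge_min lexx orbT.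
  by rewrite lt_min ltr01.
pose al (n : 'I_N) := \sum_i t i * a i n.
have al1 n : `|al n| <= dd.
  apply: le_trans (ler_norm_sum _ _ _) _; apply: le_trans dl1.
  rewrite mulrC /tau mulr_suml; apply: ler_sum => i _; rewrite normrM ler_wpM2l//.
pose v := \sum_(n < N) al n ^+ 2.
have vV : `|v - V| <= Num.min 1 e2.
  apply: le_trans dl2.
  have -> : v - V = \sum_i \sum_j t i * t j * (\sum_(n < N) a i n * a j n - C i j).
    have -> : v = \sum_i \sum_j t i * t j * \sum_(n < N) a i n * a j n.
      rewrite /v; under eq_bigr do rewrite expr2 /al big_distrlr/=.
      rewrite exchange_big/=; apply: eq_bigr => i _; rewrite exchange_big/=.
      by apply: eq_bigr => j _; rewrite mulr_sumr; apply: eq_bigr => n _; ring.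
    by rewrite /V -sumrB; apply: eq_bigr => i _; rewrite -sumrB; apply: eq_bigr => j _; ring.
  have -> : dl * tau ^+ 2 = \sum_i \sum_j `|t i| * `|t j| * dl.
    transitivity (\sum_i `|t i| * (tau * dl)); first by rewrite -mulr_suml -/tau; ring.
    apply: eq_bigr => i _; rewrite /tau mulr_suml mulr_sumr.
    by apply: eq_bigr => j _; rewrite mulrA.
  apply: le_trans (ler_norm_sum _ _ _) _; apply: ler_sum => i _.
  apply: le_trans (ler_norm_sum _ _ _) _; apply: ler_sum => j _.
  by rewrite !normrM ler_wpM2l// mulr_ge0.
have vM : v <= M.
  have := ler_norm (v - V); have := ler_norm V.
  have : Num.min 1 e2 <= 1 by rewrite ge_min lexx.
  by rewrite /M; lra.
have vV1 : `|v - V| <= 1 by apply: le_trans vV _; rewrite ge_min lexx.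
have vV2 : `|v - V| <= e2 by apply: le_trans vV _; rewrite ge_min lexx orbT.
have v0 : 0 <= v by apply: sumr_ge0 => n _; rewrite sqr_ge0.
have kap i : mean P (fun w => Y i w ^+ 2 * Num.min 1 (dd * `|Y i w|)) <= e1.
  by apply: hd0; rewrite dd0; case: ddle.
have [hC hS] := mean_char_psum Y1 Y0 Y2 Yvar indepY ie al1 kap (leqnn N).
have sumE : \sum_(n < N | (n < N)%N) al n ^+ 2 = v by apply: eq_bigl => n; rewrite ltn_ord.
rewrite sumE in hC hS.
have small : (2 * e1 + dd ^+ 2) * v <= 3 * e1 * M.
  have dde : dd ^+ 2 <= e1.
    case: ddle => _ d1 d2; apply: le_trans d2; rewrite expr2 ler_piMl// ltW//.
  apply: ler_pM => //; last by lra.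
  by rewrite addr_ge0 ?sqr_ge0// mulr_ge0// ltW.
have {}hC := le_trans hC small; have {}hS := le_trans hS small.
pose mS := L1_measurable (L1_psum Y1 e al N).
have Lcos : L1 P (fun w => cos (psum Y e al N w)).
  apply: (@L1_bounded _ _ _ _ _ 1); last by move=> w; exact: cos_max.
  exact: measurableT_comp.
have Lsin : L1 P (fun w => sin (psum Y e al N w)).
  apply: (@L1_bounded _ _ _ _ _ 1); last by move=> w; exact: sin_max.
  apply: measurableT_comp => //.
  by apply: continuous_measurable_fun; exact: continuous_sin.
have E1 : mean P (fun w => wave (c, th, t) (zeta e a w)) =
    c * (cos th * mean P (fun w => cos (psum Y e al N w)) -
         sin th * mean P (fun w => sin (psum Y e al N w))).
  rewrite -meanZ// -[X in _ - X]meanZ// -meanB; [|exact: L1Z|exact: L1Z].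
  rewrite -meanZ; last by apply: L1B; exact: L1Z.
  apply: eq_mean => w; rewrite /wave/= psum_full.
  have -> : \sum_i t i * zeta e a w i = \sum_(n < N) Y (e n) w * al n.
    rewrite /zeta; under eq_bigr do rewrite mulr_sumr.
    rewrite exchange_big/=; apply: eq_bigr => n _; rewrite /al mulr_sumr.
    by apply: eq_bigr => i _; ring.
  by rewrite cosD; congr (_ * _); ring.
have E2 : mean P' (fun w => wave (c, th, t) (Z ^~ w)) = c * (cos th * E).
  rewrite /wave/= meanZ ?Zchar//.
  apply: eq_L1 (L1_wave P' (1, th, t) mZ) => w; by rewrite /wave/= mul1r.
rewrite E1 E2 -mulrBr normrM.
have hE := expR_sub_le vV1.
set Cm := mean _ _ in hC *; set Sm := mean _ _ in hS *.
have key : `|cos th * Cm - sin th * Sm - cos th * E| <= eps / (`|c| + 1).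
  have -> : cos th * Cm - sin th * Sm - cos th * E =
     cos th * (Cm - expR (- (v / 2))) - sin th * Sm + cos th * (expR (- (v / 2)) - E) by ring.
  have b1 : `|cos th * (Cm - expR (- (v / 2)))| <= 3 * e1 * M.
    by rewrite normrM -[leRHS]mul1r ler_pM// cos_max.
  have b2 : `|sin th * Sm| <= 3 * e1 * M.
    by rewrite normrM -[leRHS]mul1r ler_pM// sin_max.
  have b3 : `|cos th * (expR (- (v / 2)) - E)| <= E * e2.
    rewrite normrM -[leRHS]mul1r ler_pM// ?cos_max//.
    by apply: le_trans hE _; rewrite ler_wpM2l// ltW.
  apply: le_trans (ler_normD _ _) _.
  apply: le_trans (_ : 6 * e1 * M + E * e2 <= _).
    by rewrite lerD//; apply: le_trans (ler_normB _ _) _; lra.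
  have -> : 6 * e1 * M = 3 / 8 * (eps / (`|c| + 1)).
    by rewrite /e1; field; rewrite !gt_eqF// (lt_le_trans ltr01).
  have : E * e2 <= 1 / 2 * (eps / (`|c| + 1)).
    rewrite /e2 (_ : E * _ = E / (E + 1) * (1 / 2 * (eps / (`|c| + 1)))); last first.
      by field; rewrite !gt_eqF// addr_gt0.
    rewrite ler_piMl//; first by rewrite mulr_ge0// divr_ge0// ltW.
    by rewrite ler_pdivrMr ?addr_gt0// mul1r lerDl.
  have : 0 <= eps / (`|c| + 1) by rewrite divr_ge0// ltW.
  lra.
apply: le_trans (ler_wpM2l (normr_ge0 c) key) _.
rewrite mulrC mulrAC ler_pdivrMr//; apply: ler_wpM2l; first exact: ltW.
by rewrite lerDl.
Qed.

Lemma L1_trig dT (U : measurableType dT) (Q : probability U R) (X : I -> U -> R) s :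
  (forall i, measurable_fun setT (X i)) -> L1 Q (fun w => trig s (X ^~ w)).
Proof. by move=> mX; apply: L1_sum => m _; exact: L1_wave. Qed.

Lemma clt_trig s : clt_test (trig s).
Proof.
elim: s => [|m s IH] eps eps0.
  exists 1 => // N e a _ _; rewrite (@eq_mean _ _ _ P _ (fun=> 0)); last first.
    by move=> w; rewrite /trig big_nil.
  rewrite (@eq_mean _ _ _ P' _ (fun=> 0)); last by move=> w; rewrite /trig big_nil.
  by rewrite !mean_cst subrr normr0 ltW.
have e2 : 0 < eps / 2 by rewrite divr_gt0.
have [d1 d10 h1] := clt_wave m e2; have [d2 d20 h2] := IH _ e2.
exists (Num.min d1 d2) => [|N e a ie ca]; first by rewrite lt_min d10.
have := h1 N e a ie; have := h2 N e a ie.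
move=> /(_ (clt_array_le _ ca)); rewrite ge_min lexx orbT => /(_ isT) k2.
move=> /(_ (clt_array_le _ ca)); rewrite ge_min lexx => /(_ isT) k1.
have E dT (U : measurableType dT) (Q : probability U R) (X : I -> U -> R) :
    (forall i, measurable_fun setT (X i)) ->
    mean Q (fun w => trig (m :: s) (X ^~ w)) =
    mean Q (fun w => wave m (X ^~ w)) + mean Q (fun w => trig s (X ^~ w)).
  move=> mX; rewrite -meanD; [|exact: L1_wave|exact: L1_trig].
  by apply: eq_mean => w; rewrite /trig big_cons.
have -> := E _ _ P (fun i w => zeta e a w i) (mzeta e a).
have -> := E _ _ P' Z mZ.
rewrite opprD addrACA (splitr eps); apply: le_trans (ler_normD _ _) _.
by rewrite lerD.
Qed.

Lemma clt_test_fin (B : finType) (f : B -> (I -> R) -> R) : (forall b, clt_test (f b)) ->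
  forall eps : R, 0 < eps -> exists2 dl, 0 < dl & forall N (e : 'I_N -> J) a,
    injective e -> clt_array dl a -> forall b,
    `|mean P (fun w => f b (zeta e a w)) - mean P' (fun w => f b (Z ^~ w))| <= eps.
Proof.
move=> cf eps eps0.
suff [dl dl0 h] : exists2 dl, 0 < dl & forall N (e : 'I_N -> J) a,
    injective e -> clt_array dl a -> forall b, b \in enum B ->
    `|mean P (fun w => f b (zeta e a w)) - mean P' (fun w => f b (Z ^~ w))| <= eps.
  by exists dl => // N e a ie ca b; apply: h ie ca _ _; rewrite mem_enum.
elim: (enum B) => [|b s [d1 d10 h1]]; first by exists 1.
have [d2 d20 h2] := cf b eps eps0.
exists (Num.min d1 d2) => [|N e a ie ca b']; first by rewrite lt_min d10.
rewrite inE => /orP[/eqP ->|b's].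
  by apply: h2 ie (clt_array_le _ ca); rewrite ge_min lexx orbT.
by apply: (h1 _ _ _ ie (clt_array_le _ ca) _ b's); rewrite ge_min lexx.
Qed.

(** The mean of a test function is, up to an error depending on second moments
    only, a combination with bounded coefficients of means of the fixed
    trigonometric polynomials [coins]. *)
Lemma bernstein_mean dT (U : measurableType dT) (Q : probability U R) (X : I -> U -> R)
    (q : nat) (l : R) (v : I -> R) phi : (0 < q)%N -> 0 < l ->
  (forall i, measurable_fun setT (X i)) -> (forall i, L1 Q (fun w => X i w ^+ 2)) ->
  (forall i, mean Q (fun w => X i w ^+ 2) <= v i) ->
  (forall z, `|phi z| <= 1) -> lip1 phi ->
  `|mean Q (fun w => phi (X ^~ w)) -
    \sum_b phi (bernstein_node l b) *
      mean Q (fun w => coins (fun p : I * 'I_(q * q) => sin (X p.1 w / l)) b)| <=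
  #|I|%:R * (l / q%:R) + (\sum_i v i) / l.
Proof.
move=> q0 l0 mX X2 Xv phi1 lphi.
have mphi : measurable_fun setT (fun w => phi (X ^~ w)).
  exact: (measurable_fin_continuous (lip1_fin_continuous lphi) mX).
have Lw b : L1 Q (fun w => coins (fun p : I * 'I_(q * q) => sin (X p.1 w / l)) b).
  have [s hs] := @trig_coins R I (q * q) l b.
  by apply: eq_L1 (L1_trig Q s mX) => w; rewrite hs.
have -> : \sum_b phi (bernstein_node l b) *
      mean Q (fun w => coins (fun p : I * 'I_(q * q) => sin (X p.1 w / l)) b) =
    mean Q (fun w => bernstein q l phi (X ^~ w)).
  rewrite /bernstein mean_sum; last first.
    by move=> b _; apply: eq_L1 (L1Z (phi (bernstein_node l b)) (Lw b)) => w; rewrite mulrC.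
  by apply: eq_bigr => b _; rewrite -meanZ//; apply: eq_mean => w; rewrite mulrC.
have Lb : L1 Q (fun w => bernstein q l phi (X ^~ w)).
  apply: L1_sum => b _.
  by apply: eq_L1 (L1Z (phi (bernstein_node l b)) (Lw b)) => w; rewrite mulrC.
have Lp : L1 Q (fun w => phi (X ^~ w)) by exact: L1_bounded mphi _.
have LX : L1 Q (fun w => \sum_i (l^-1 * X i w ^+ 2)).
  by apply: L1_sum => i _; exact: L1Z.
rewrite -meanB//.
apply: le_trans (_ : mean Q (fun w => #|I|%:R * (l / q%:R) + \sum_i l^-1 * X i w ^+ 2) <= _).
  apply: mean_abs_le; [exact: L1B|by apply: L1D => //; exact: L1_cst|move=> w].
  apply: le_trans (bernstein_approx q0 l0 _ lphi) _; rewrite lerD2l.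
  by apply: ler_sum => i _; rewrite mulrC.
rewrite meanD ?mean_cst//; last exact: L1_cst.
rewrite lerD2l mean_sum; last by move=> i _; exact: L1Z.
by rewrite mulr_suml ler_sum// => i _; rewrite meanZ// mulrC ler_wpM2r// invr_ge0 ltW.
Qed.

(** The threshold dl is chosen before the test function: for fixed l and q only
    finitely many trigonometric polynomials are involved, and the test function
    enters through coefficients bounded by 1. *)
Lemma fd_clt (eps : R) : 0 < eps ->
  exists2 dl : R, 0 < dl & forall N (e : 'I_N -> J) (a : I -> 'I_N -> R),
    injective e -> clt_array dl a ->
    forall phi, (forall z, `|phi z| <= 1) -> lip1 phi ->
    `|mean P (fun w => phi (zeta e a w)) - mean P' (fun w => phi (Z ^~ w))| <= eps.
Proof.
move=> eps0.
pose M2 := \sum_i (C i i + 1).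
have M20 : 0 <= M2.
  by apply: sumr_ge0 => i _; rewrite addr_ge0// -Zvar; apply: mean_ge0 => w; rewrite sqr_ge0.
(* l makes the bias M2 / l at most eps / 8; q is chosen afterwards to do the
   same for the fluctuation. *)
pose l := M2 * 8 / eps + 1.
have l0 : 0 < l by rewrite ltr_wpDl// divr_ge0 ?mulr_ge0// ltW.
have [q q0 hq] : exists2 q : nat, (0 < q)%N & #|I|%:R * (l / q%:R) <= eps / 8.
  pose x := #|I|%:R * l * 8 / eps.
  have x0 : 0 <= x by rewrite divr_ge0 ?mulr_ge0// ltW.
  exists (Num.truncn x).+1 => //.
  rewrite mulrA ler_pdivrMr//.
  have : x <= (Num.truncn x).+1%:R by apply/ltW/truncnS_gt.
  move=> /(ler_wpM2l (ltW (_ : 0 < eps / 8))) => /(_ (divr_gt0 eps0 (ltr0n _ 8))).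
  apply: le_trans; rewrite /x le_eqVlt; apply/orP; left; apply/eqP.
  by field; rewrite gt_eqF.
have hl : M2 / l <= eps / 8.
  rewrite ler_pdivrMr// /l mulrDr mulr1 (_ : eps / 8 * _ = M2); last by field; rewrite gt_eqF.
  by rewrite lerDl divr_ge0// ltW.
pose B := {ffun I * 'I_(q * q) -> bool}.
pose f (b : B) (z : I -> R) := coins (fun p : I * 'I_(q * q) => sin (z p.1 / l)) b.
have cf b : clt_test (f b).
  have [s hs] := @trig_coins R I (q * q) l b.
  by move=> e' /(clt_trig s); rewrite (_ : trig s = f b)//; apply/funext => z; rewrite hs.
have e20 : 0 < eps / 2 / #|B|.+1%:R by rewrite !divr_gt0.
have [d1 d10 h1] := clt_test_fin cf e20.
exists (Num.min d1 1) => [|N e a ie ca phi phi1 lphi]; first by rewrite lt_min d10/=.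
have kb := h1 N e a ie (clt_array_le (_ : Num.min d1 1 <= d1) ca).
have {}kb := kb _; rewrite ge_min lexx in kb; have {}kb := kb isT.
have [ca1 ca2] := ca.
have psE i w : zeta e a w i = psum Y e (a i) N w by rewrite psum_full.
have b1 := @bernstein_mean _ _ P (fun i w => zeta e a w i) q l (fun i => C i i + 1) phi q0 l0
  (mzeta e a).
have {b1} b1 := b1 (fun i => eq_L1 (fun w => congr1 (fun x => x ^+ 2) (esym (psE i w)))
  (psum_sqr Y1 Y0 Y2 Yvar indepY ie (a i) (leqnn N)).1).
have {b1} b1 : `|mean P (fun w => phi (zeta e a w)) -
    \sum_b phi (bernstein_node l b) * mean P (fun w => f b (zeta e a w))| <=
  #|I|%:R * (l / q%:R) + M2 / l.
  apply: b1 => // i; under eq_mean do rewrite psE.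
  have [_ ->] := psum_sqr Y1 Y0 Y2 Yvar indepY ie (a i) (leqnn N).
  have h := le_trans (ler_norm _) (ca2 i i).
  rewrite (eq_bigl xpredT) => [|n]; last by rewrite ltn_ord.
  under eq_bigr do rewrite expr2.
  by rewrite -lerBlDl (le_trans h)// ge_min lexx orbT.
have b2 : `|mean P' (fun w => phi (Z ^~ w)) -
    \sum_b phi (bernstein_node l b) * mean P' (fun w => f b (Z ^~ w))| <=
  #|I|%:R * (l / q%:R) + M2 / l.
  by apply: bernstein_mean => // i; rewrite Zvar lerDl.
set A1 := mean P _ in b1 *; set A2 := mean P' _ in b2 *.
set S1 := \sum_b _ in b1; set S2 := \sum_b _ in b2.
have SS : `|S1 - S2| <= eps / 2.
  rewrite /S1 /S2 -sumrB; apply: le_trans (ler_norm_sum _ _ _) _.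
  apply: le_trans (_ : \sum_(b : B) eps / 2 / #|B|.+1%:R <= _).
    apply: ler_sum => b _; rewrite -mulrBr normrM -[leRHS]mul1r ler_pM//.
  rewrite sumr_const -[_ *+ #|_|]mulr_natr mulrAC ler_pdivrMr//.
  by apply: ler_wpM2l; [rewrite divr_ge0// ltW|rewrite ler_nat].
have -> : A1 - A2 = (A1 - S1) + (S1 - S2) - (A2 - S2) by ring.
apply: le_trans (ler_normB _ _) _; apply: le_trans (lerD (ler_normD _ _) (lexx _)) _.
by lra.
Qed.

End finite_dimensional_clt.

(** * The characteristic function of the normal law *)

Section normal_law.
Context (R : realType) (m s : R).
Hypothesis s0 : s != 0.
Local Notation mu := (@lebesgue_measure R).
Local Notation nu := (normal_prob m s : probability _ R).
Local Notation p := (normal_pdf m s).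

(** The Radon-Nikodym derivative of the normal law with respect to Lebesgue
    measure is almost everywhere equal to p. *)
Lemma mean_normal_density (F : R -> R) : L1 nu F ->
  mean nu F = fine (\int[mu]_x (F x * p x)%:E)%E.
Proof.
move=> F1; rewrite /mean /Rintegral; congr fine.
rewrite -(Radon_Nikodym_change_of_variables (normal_prob_dominates m s))//=.
have mp : measurable_fun setT (EFin \o p).
  by apply/measurable_EFinP; exact: measurable_normal_pdf.
under [RHS]eq_integral do rewrite EFinM.
apply: ae_eq_integral => //.
- apply: emeasurable_funM; first exact: (measurable_int nu).
  apply: (measurable_int mu).
  by apply: Radon_Nikodym_integrable; exact: normal_prob_dominates.
- apply: emeasurable_funM => //; exact: (measurable_int nu).
- apply: ae_eqe_mul2l => /=.
  rewrite Radon_NikodymE//=; first exact: normal_prob_dominates.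
  move=> num; case: cid => /= h [h1 h2 h3].
  apply: integral_ae_eq => //=.
  by move=> E E01 mE; rewrite -h3.
Qed.

Lemma normal_pdf_decay x : p x * (x - m) ^+ 2 <= normal_peak s * (s ^+ 2 *+ 2).
Proof.
rewrite normal_pdfE// /normal_fun -mulrA ler_wpM2l ?normal_peak_ge0//.
have s2 : 0 < s ^+ 2 *+ 2 by rewrite pmulrn_lgt0// exprn_even_gt0.
set y := (x - m) ^+ 2 / (s ^+ 2 *+ 2).
have -> : (x - m) ^+ 2 = y * (s ^+ 2 *+ 2) by rewrite /y divfK ?gt_eqF.
have -> : - (y * (s ^+ 2 *+ 2)) / (s ^+ 2 *+ 2) = - y by rewrite mulNr mulfK ?gt_eqF.
rewrite mulrA; apply: ler_piMl; first exact: ltW.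
have := expR_ge1Dx y; have : 0 <= y by rewrite divr_ge0 ?sqr_ge0// ltW.
by move=> y0 h; rewrite expRN mulrC ler_pdivrMr ?expR_gt0// mul1r; lra.
Qed.

Lemma is_derive_normal_pdf (x : R) : is_derive x 1 p (- (x - m) / s ^+ 2 * p x).
Proof.
rewrite normal_pdfE// /normal_fun.
have s2 : s ^+ 2 *+ 2 != 0 by rewrite -mulr_natr mulf_neq0 ?expf_neq0.
apply: is_derive_eq.
rewrite /GRing.scale/= !mulr0 add0r subr0 !mulr1; set E := expR _.
by field; rewrite s0.
Qed.

(** Stein's identity. The derivative of f p is (f' - (x - m) f / s^2) p, so the
    integral of the latter over [m - n, m + n] is the increment of f p, which tends
    to 0 because f grows at most linearly and p is O((x - m)^-2). *)
Lemma stein (f df : R -> R) (c : R) :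
  (forall x : R, is_derive x 1 f (df x)) -> continuous df ->
  (forall x, `|f x| <= c + `|x - m|) ->
  L1 nu (fun x => (x - m) * f x) -> L1 nu df ->
  mean nu (fun x => (x - m) * f x) = s ^+ 2 * mean nu df.
Proof.
move=> fdf cdf fc L_1 L_2.
have s2 : s ^+ 2 != 0 by rewrite expf_neq0.
pose q x := df x - (s ^+ 2)^-1 * ((x - m) * f x).
have Lq : L1 nu q by apply: L1B => //; exact: L1Z.
suff q0 : mean nu q = 0.
  move: q0; rewrite /q meanB//; last exact: L1Z.
  rewrite meanZ// => /eqP; rewrite subr_eq0 => /eqP ->.
  by rewrite mulrA mulfV// mul1r.
have mp : measurable_fun setT p by exact: measurable_normal_pdf.
have cp : continuous p by exact: continuous_normal_pdf.
have cf : continuous f.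
  by move=> y; apply/differentiable_continuous/derivable1_diffP; have [] := fdf y.
pose F x := f x * p x.
have FdF (x : R) : is_derive x 1 F (q x * p x).
  have := is_derive_normal_pdf x; have := fdf x => h1 h2.
  by apply: is_derive_eq; rewrite /GRing.scale/= /q; field.
have cqp : continuous (fun x => q x * p x).
  apply: continuous_mulR => // x; apply: cvgB; first exact: cdf.
  apply: cvgM; first exact: cvg_cst.
  apply: cvgM; last exact: cf.
  by apply: cvgB; [exact: cvg_id|exact: cvg_cst].
have cF : continuous F by exact: continuous_mulR.
pose I (n : nat) : set R := `[m - n.+1%:R, m + n.+1%:R]%classic.
pose qn n x := q x * \1_(I n) x.
have Lqn n : L1 nu (qn n).
  apply: L1_le (L1_abs Lq) _.
    by apply: measurable_funM; [exact: L1_measurable Lq|apply: measurable_indic; exact: measurable_itv].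
  move=> x; rewrite normrM; apply: ler_piMr => //.
  by rewrite indicE; case: (_ \in _); rewrite ?normr1 ?normr0.
have mqn n : mean nu (qn n) = F (m + n.+1%:R) - F (m - n.+1%:R).
  rewrite mean_normal_density//.
  transitivity (fine (\int[mu]_(x in I n) (q x * p x)%:E)%E).
    congr fine; rewrite [RHS]integral_mkcond; apply: eq_integral => x _.
    rewrite patchE /qn indicE; case: ifP => _; first by rewrite mulr1.
    by rewrite mulr0 mul0r.
  have lt : m - n.+1%:R < m + n.+1%:R.
    by have : 0 < n.+1%:R :> R by []; lra.
  rewrite (continuous_FTC2 lt (F := F))//.
  - exact: continuous_subspaceT.
  - split.
    + by move=> x _; have [] := FdF x.
    + by apply: cvg_at_right_filter; exact: cF.
    + by apply: cvg_at_left_filter; exact: cF.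
  - by move=> x _; rewrite derive1E; have [_ ->] := FdF x.
pose B := (c + 1) * (normal_peak s * (s ^+ 2 *+ 2)).
have Fb n (x : R) : `|x - m| = n.+1%:R -> `|F x| <= B / n.+1%:R.
  move=> xm; have n0 : 0 < n.+1%:R :> R by [].
  have n1 : 1 <= n.+1%:R :> R by rewrite ler1n.
  have := normal_pdf_decay x; rewrite -(real_normK (num_real (x - m))) xm => h.
  have c0 : 0 <= c.
    have := fc m; rewrite subrr normr0 addr0; exact: le_trans.
  rewrite /F normrM ler_pdivlMr// (ger0_norm (normal_pdf_ge0 _ _ _)) /B.
  apply: le_trans (_ : (c + 1) * n.+1%:R * p x * n.+1%:R <= _).
    rewrite ler_wpM2r// ler_wpM2r ?normal_pdf_ge0//.
    apply: le_trans (fc x) _; rewrite xm mulrDl mul1r lerD2r.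
    by rewrite ler_peMr.
  rewrite -!mulrA; apply: ler_wpM2l; first by rewrite addr_ge0.
  by apply: le_trans h; rewrite expr2 mulrCA.
have qnb n x : `|qn n x| <= `|q x|.
  rewrite normrM; apply: ler_piMr => //.
  by rewrite indicE; case: (_ \in _); rewrite ?normr1 ?normr0.
have qnq x : qn n x @[n --> \oo] --> q x.
  apply: cvg_near_cst; near=> n; rewrite /qn indicE mem_set ?mulr1//.
  rewrite /I /= in_itv/=; have : `|x - m| <= n.+1%:R.
    near: n; apply: filterS (nbhs_infty_ger `|x - m|) => n /le_trans; apply.
    by rewrite ler_nat.
  by move/ler_normlP => [? ?]; apply/andP; split; lra.
have [_ cvq] := @dominated_mean _ _ _ nu qn q (fun x => `|q x|) (fun n => L1_measurable (Lqn n))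
  (L1_abs Lq) qnb qnq.
have F0 : (F (m + n.+1%:R) - F (m - n.+1%:R)) @[n --> \oo] --> (0 : R).
  apply/cvgrPdist_le => e e0; near=> n.
  rewrite sub0r normrN; apply: le_trans (ler_normB _ _) _.
  have n0 : 0 < n.+1%:R :> R by [].
  have h1 := @Fb n (m + n.+1%:R); have h2 := @Fb n (m - n.+1%:R).
  apply: le_trans (lerD (h1 _) (h2 _)) _.
  - by rewrite addrAC subrr add0r ger0_norm.
  - by rewrite addrAC subrr add0r normrN ger0_norm.
  rewrite -mulrDl ler_pdivrMr// -ler_pdivrMl//.
  near: n; apply: filterS (nbhs_infty_ger (e^-1 * (B + B))) => n /le_trans; apply.
  by rewrite ler_nat.
rewrite (_ : (fun n => mean nu (qn n)) = fun n => F (m + n.+1%:R) - F (m - n.+1%:R)) in cvq; last first.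
  by apply/funext => n; exact: mqn.
exact: (cvg_unique _ cvq F0).
Unshelve. all: by end_near. Qed.

Section normal_char.
Hypothesis L1sqr : L1 nu (fun x => (x - m) ^+ 2).

Let m_id : measurable_fun setT (fun x : R => x - m).
Proof. by apply: measurable_funB; [exact: measurable_id|exact: measurable_cst]. Qed.

Let L1_center : L1 nu (fun x => x - m).
Proof. exact: L1_sqrt. Qed.

Lemma normal_mean : mean nu (fun x => x - m) = 0.
Proof.
have d0 (x : R) : is_derive x 1 (fun _ : R => 1 : R) 0 by exact: is_derive_cst.
have := @stein (fun=> 1) (fun=> 0) 1 d0 (fun x => cvg_cst _).
rewrite mean_cst mulr0 => <-.
- by apply: eq_mean => x; rewrite mulr1.
- by move=> x; rewrite normr1 lerDl.
- by apply: eq_L1 L1_center => x; rewrite mulr1.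
- exact: L1_cst.
Qed.

Lemma normal_variance : mean nu (fun x => (x - m) ^+ 2) = s ^+ 2.
Proof.
have d1 (x : R) : is_derive x 1 (fun x : R => x - m) 1.
  by apply: is_derive_eq; rewrite subr0.
have := @stein (fun x => x - m) (fun=> 1) 0 d1 (fun x => cvg_cst _).
rewrite mean_cst mulr1 => <-//.
- by move=> x; rewrite add0r.
- exact: L1_cst.
Qed.

Let phi (th t : R) := mean nu (fun x => cos (t * (x - m) + th)).

Let L1_bdd (f : R -> R) : continuous f -> (forall x, `|f x| <= 1) -> forall t th,
  L1 nu (fun x => f (t * (x - m) + th)).
Proof.
move=> cf f1 t th; apply: (@L1_bounded _ _ _ _ _ 1) => //.
apply: measurableT_comp; first exact: continuous_measurable_fun.
by apply: measurable_funD => //; apply: measurable_funM.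
Qed.

Let L1_csin t th : L1 nu (fun x => (x - m) * sin (t * (x - m) + th)).
Proof.
apply: (@L1_le _ _ _ nu _ (fun x => `|x - m|)); last 2 first.
- exact: L1_abs.
- by move=> x; rewrite normrM ler_piMr// sin_max.
apply: measurable_funM => //; apply: L1_measurable (L1_bdd _ _ t th) => //.
  exact: continuous_sin.
exact: sin_max.
Qed.

(** Stein's identity for sine turns the derivative of phi into a multiple of
    phi itself, which yields the differential equation phi' = - s^2 t phi. *)
Let stein_sin t th :
  mean nu (fun x => (x - m) * sin (t * (x - m) + th)) = s ^+ 2 * t * phi th t.
Proof.
have cosL := L1_bdd (@continuous_cos R) (@cos_max R) t th.
rewrite -mulrA /phi -meanZ//; apply: (@stein _ _ 1).
- move=> x; apply: is_derive_eq.
  rewrite /GRing.scale/= ?mulr1 ?mulr0 ?addr0 ?subr0 ?add0r; ring.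
- move=> x; apply: cvgM; first exact: cvg_cst.
  apply: (@continuous_comp _ _ _ (fun x : R => t * (x - m) + th)); last exact: continuous_cos.
  apply: cvgD; last exact: cvg_cst.
  by apply: cvgM; [exact: cvg_cst|apply: cvgB; [exact: cvg_id|exact: cvg_cst]].
- by move=> x; apply: le_trans (sin_max _) _; rewrite lerDl.
- exact: L1_csin.
- exact: L1Z.
Qed.

Let cos_taylor (a b : R) : `|cos (a + b) - cos a + b * sin a| <= 2 * b ^+ 2.
Proof.
have -> : cos (a + b) - cos a + b * sin a = cos a * (cos b - 1) - sin a * (sin b - b).
  by rewrite cosD; ring.
apply: le_trans (ler_normB _ _) _; rewrite !normrM.
have h1 : `|cos a| * `|cos b - 1| <= 1 * (b ^+ 2 / 2).
  by rewrite ler_pM ?cos_max// -(real_normK (num_real b)) cos_sub1_le.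
have h2 : `|sin a| * `|sin b - b| <= 1 * b ^+ 2.
  rewrite ler_pM ?sin_max//; apply: le_trans (sin_trem _) _.
  by rewrite /trem -(real_normK (num_real b)) ge_min lexx.
by have := sqr_ge0 b; lra.
Qed.

Let is_derive_phi th (t : R) : is_derive t 1 (phi th) (- (s ^+ 2 * t * phi th t)).
Proof.
have key (h : R) : `|phi th (h + t) - phi th t + h * (s ^+ 2 * t * phi th t)| <= 2 * s ^+ 2 * h ^+ 2.
  have c1 := L1_bdd (@continuous_cos R) (@cos_max R) (h + t) th.
  have c2 := L1_bdd (@continuous_cos R) (@cos_max R) t th.
  have c3 := L1_csin t th.
  rewrite -stein_sin /phi -meanB// -meanZ// -meanD; [|exact: L1B|exact: L1Z].
  apply: le_trans (_ : mean nu (fun x => 2 * h ^+ 2 * (x - m) ^+ 2) <= _).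
    apply: mean_abs_le; [exact: L1D (L1B c1 c2) (L1Z h c3)|exact: L1Z|].
    move=> x; have := cos_taylor (t * (x - m) + th) (h * (x - m)).
    have -> : (h + t) * (x - m) + th = t * (x - m) + th + h * (x - m) by ring.
    by rewrite exprMn !mulrA.
  by rewrite meanZ// normal_variance le_eqVlt; apply/orP; left; apply/eqP; ring.
have lim : h^-1 *: (phi th (h *: 1 + t) - phi th t) @[h --> 0^'] --> - (s ^+ 2 * t * phi th t).
  apply/cvgrPdist_le => e e0.
  have B0 : 0 < 2 * s ^+ 2 by rewrite mulr_gt0// exprn_even_gt0.
  near=> h; have h0 : h != 0 by near: h; exact: nbhs_dnbhs_neq.
  have -> : - (s ^+ 2 * t * phi th t) - h^-1 *: (phi th (h *: 1 + t) - phi th t) =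
     - (h^-1 * (phi th (h + t) - phi th t + h * (s ^+ 2 * t * phi th t))).
    by rewrite /GRing.scale/= mulr1; field.
  rewrite normrN normrM normfV ler_pdivrMl ?normr_gt0//.
  apply: le_trans (key h) _; rewrite -(real_normK (num_real h)) expr2 mulrCA ler_wpM2l//.
  rewrite mulrC -ler_pdivlMr//; near: h.
  apply: dnbhs0_le; by rewrite divr_gt0.
split; first by apply/cvg_ex; eexists; exact: lim.
exact/cvg_lim.
Unshelve. all: by end_near. Qed.

(** The product of phi with exp(s^2 t^2 / 2) has derivative 0. *)
Lemma normal_char th :
  mean nu (fun x => cos ((x - m) + th)) = cos th * expR (- (s ^+ 2 / 2)).
Proof.
pose psi (t : R) := phi th t * expR (s ^+ 2 / 2 * t ^+ 2).
have dpsi (t : R) : is_derive t 1 psi 0.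
  have h := is_derive_phi th t; apply: is_derive_eq.
  by rewrite /GRing.scale/= ?mulr1 ?mulr0 ?addr0; field.
have := @mvt_from0 R psi (fun=> 0) 1 0 dpsi (fun _ _ => ltac:(by rewrite normr0)).
rewrite mul0r normr_le0 subr_eq0 => /eqP.
rewrite /psi expr0n/= mulr0 expR0 mulr1 expr1n mulr1.
have -> : phi th 0 = cos th.
  by rewrite -[RHS](mean_cst nu); apply: eq_mean => x; rewrite mul0r add0r.
move=> <-; rewrite -mulrA -expRD subrr expR0 mulr1.
by apply: eq_mean => x; rewrite mul1r.
Qed.

End normal_char.
End normal_law.

Lemma mean_law (R : realType) d (T : measurableType d) (P : probability T R)
    dE (E : measurableType dE) (X : T -> E) (nu : probability E R) (F : E -> R) :
  measurable_fun setT X -> (forall A, measurable A -> P (X @^-1` A) = nu A) ->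
  measurable_fun setT F -> L1 P (F \o X) -> L1 nu F /\ mean nu F = mean P (F \o X).
Proof.
move=> mX lX mF F1.
have mEF : measurable_fun setT (EFin \o F) by apply/measurable_EFinP; exact: mF.
have iF : (pushforward P X).-integrable setT (EFin \o F).
  by apply: integrable_pushforward => //; rewrite preimage_setT.
have lE A : measurable A -> A `<=` setT -> pushforward P X A = nu A by move=> mA _; exact: lX.
split.
  apply/integrableP; split; first exact: mEF.
  by move/integrableP : iF => [_]; rewrite (eq_measure_integral nu).
rewrite /mean /Rintegral -(@eq_measure_integral _ _ _ _ _ _ (EFin \o F) lE).
by rewrite integral_pushforward//= preimage_setT.
Qed.

(** A degenerate normal variable is a point mass, here at 0 because the mean is
    0; otherwise mean and variance are identified by [normal_mean] and
    [normal_variance]. *)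
Section normal_rv_char.
Context (R : realType) d (T : measurableType d) (P : probability T R) (X : T -> R).
Hypothesis mX : measurable_fun setT X.

Lemma normal_rv_char th : normal_rv P X -> L1 P (fun w => X w ^+ 2) -> mean P X = 0 ->
  mean P (fun w => cos (X w + th)) = cos th * expR (- (mean P (fun w => X w ^+ 2) / 2)).
Proof.
move=> [m [s lX]] X2 X0.
have X1 : L1 P X by exact: L1_sqrt.
have mcos : measurable_fun setT (fun x : R => cos (x + th)).
  apply: measurableT_comp; last exact: measurable_funD.
  by apply: continuous_measurable_fun; exact: continuous_cos.
have cos1 : L1 P ((fun x : R => cos (x + th)) \o X).
  apply: (@L1_bounded _ _ _ _ _ 1); first exact: measurableT_comp.
  by move=> w; exact: cos_max.
have [s0|s0] := eqVneq s 0.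
  have dX (F : R -> R) : measurable_fun setT F -> L1 P (F \o X) -> mean P (F \o X) = F m.
    move=> mF F1; have lX' A : measurable A -> P (X @^-1` A) = \d_m A.
      by move=> mA; rewrite lX// s0 eqxx.
    have [_ <-] := @mean_law _ _ _ _ _ _ _ \d_m _ mX lX' mF F1.
    rewrite /mean /Rintegral integral_dirac//=; last exact/measurable_EFinP.
    by rewrite indicE mem_set// mul1r.
  have m0 : m = 0 by rewrite -X0; apply/esym; apply: (dX id) => //; exact: measurable_id.
  have := dX (fun x => x ^+ 2) (exprn_measurable _) X2; rewrite m0 expr0n/= => E2.
  rewrite -[mean P (fun w => X w ^+ 2)]/(mean P ((fun x => x ^+ 2) \o X)) E2 mul0r oppr0 expR0 mulr1.
  have := dX _ mcos cos1; rewrite m0 add0r; exact.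
have lX' A : measurable A -> P (X @^-1` A) = normal_prob m s A.
  by move=> mA; rewrite lX// (negbTE s0).
have mB : measurable_fun setT (fun x : R => x - m) by exact: measurable_funB.
have c1 : L1 P ((fun x => x - m) \o X) by apply: L1B => //; exact: L1_cst.
have c2 : L1 P ((fun x => (x - m) ^+ 2) \o X).
  apply: eq_L1 (L1D (L1B X2 (L1Z (2 * m) X1)) (L1_cst P (m ^+ 2))) => w /=; ring.
have mB2 : measurable_fun setT (fun x : R => (x - m) ^+ 2) by exact: measurable_funX.
have [_ e1] := @mean_law _ _ _ P _ (measurableTypeR R) X (normal_prob m s) _ mX lX' mB c1.
have [l2 e2] := @mean_law _ _ _ P _ (measurableTypeR R) X (normal_prob m s) _ mX lX' mB2 c2.
have m0 : m = 0.
  have := normal_mean s0 l2; rewrite e1 /comp meanB//; last exact: L1_cst.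
  by rewrite X0 mean_cst sub0r => /eqP; rewrite oppr_eq0 => /eqP.
have := normal_variance s0 l2; rewrite e2.
rewrite (_ : (fun x => _) \o X = fun w => X w ^+ 2); last by apply/funext => w; rewrite /= m0 subr0.
move=> ->; rewrite -(normal_char s0 l2).
have [_ <-] := @mean_law _ _ _ P _ (measurableTypeR R) X (normal_prob m s) _ mX lX' mcos cos1.
by apply: eq_mean => x; rewrite m0 subr0.
Qed.

End normal_rv_char.

(** * The geometry of S *)

Section geometry.
Context (R : realType) (D : nat) (S : set 'rV[R]_D).
Implicit Types (s : S).

(** The l1 distance. It is continuous and bounds the Euclidean norm from above, so
    a Hölder bound for the Euclidean norm implies one for rho, without square
    roots. *)
Definition rho s s' : R := \sum_(i < D) `|val s 0 i - val s' 0 i|.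

Lemma rho_ge0 s s' : 0 <= rho s s'.
Proof. exact: sumr_ge0. Qed.

Lemma rho_sym s s' : rho s s' = rho s' s.
Proof. by apply: eq_bigr => i _; rewrite distrC. Qed.

Lemma rho_triangle s s' s'' : rho s s'' <= rho s s' + rho s' s''.
Proof.
rewrite /rho -big_split; apply: ler_sum => i _ /=.
by rewrite -(subrKA (val s' 0 i)) ler_normD.
Qed.

Lemma euclid_le_rho s s' : euclid (val s - val s') <= rho s s'.
Proof.
rewrite /euclid -[leRHS]ger0_norm ?rho_ge0// -sqrtr_sqr ler_sqrt ?sqr_ge0//.
rewrite /rho expr2 big_distrlr/=; apply: ler_sum => i _.
rewrite (bigD1 i)//= !mxE -normrM -expr2 ger0_norm ?sqr_ge0// lerDl.
by apply: sumr_ge0 => j _; rewrite -normrM.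
Qed.

Lemma ball_setE s s' (e : R) : ball s e s' = ball (val s) e (val s').
Proof. by []. Qed.

Lemma nbhs_rhoP s (U : set S) :
  nbhs s U <-> exists2 e : R, 0 < e & forall s', rho s s' < e -> U s'.
Proof.
split.
  move=> /nbhs_ballP[e e0 sU]; exists e => // s' ss'; apply: sU.
  rewrite ball_setE; split => // i j.
  rewrite ord1 /ball/=; apply: le_lt_trans ss'; rewrite /rho (bigD1 j)//= lerDl.
  exact: sumr_ge0.
move=> [e e0 sU]; apply/nbhs_ballP; exists (e / D.+1%:R); first by rewrite /= divr_gt0.
move=> s'; rewrite ball_setE => -[_ ss']; apply: sU.
apply: le_lt_trans (_ : \sum_(i < D) e / D.+1%:R < _).
  by apply: ler_sum => i _; apply/ltW; exact: (ss' 0 i).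
rewrite sumr_const card_ord -[_ *+ D]mulr_natr mulrAC ltr_pdivrMr//.
by rewrite ltr_pM2l// ltr_nat.
Qed.

(** Finitely many of the balls given by the hypothesis cover S. *)
Lemma compact_near (I : Type) (F : set_system I) (P : I -> S -> Prop) : compact S -> Filter F ->
  (forall s, exists2 e : R, 0 < e & \forall i \near F, forall s', rho s s' < e -> P i s') ->
  \forall i \near F, forall s, P i s.
Proof.
move=> /compact_near_coveringP/near_covering_withinP cS FF hP.
pose Q i x := forall h : x \in S, P i (exist _ x h).
have cov x : S x -> \forall x' \near x & i \near F, S x' -> Q i x'.
  move=> Sx; pose s : S := exist _ x (mem_set Sx).
  have [e e0 FW] := hP s.
  exists ([set y | ball x (e / D.+1%:R) y], [set i | forall s', rho s s' < e -> P i s']).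
    split; last exact: FW.
    by apply: nbhsx_ballx; rewrite divr_gt0.
  move=> [y i] [/= [_ xy] Wi] Sy yS; apply: Wi => //.
  apply: le_lt_trans (_ : \sum_(i < D) e / D.+1%:R < _).
    by apply: ler_sum => k _; apply/ltW; exact: (xy 0 k).
  rewrite sumr_const card_ord -[_ *+ D]mulr_natr mulrAC ltr_pdivrMr//.
  by rewrite ltr_pM2l// ltr_nat.
have := cS I F Q FF cov; apply: filterS => i h [x xS].
exact: h (set_mem xS) xS.
Qed.

Lemma continuous_rhoP (f : S -> R) : continuous f <->
  forall s (e : R), 0 < e -> exists2 dl : R, 0 < dl & forall s', rho s s' < dl -> `|f s - f s'| < e.
Proof.
split.
  move=> cf s e e0; have /nbhs_rhoP[dl dl0 h] := cf s _ (nbhsx_ballx (f s) e e0).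
  by exists dl.
move=> h s U /nbhs_ballP[e /= e0 sU]; have [dl dl0 hd] := h s e e0.
by apply/nbhs_rhoP; exists dl => // s' /hd ?; exact: sU.
Qed.

Hypothesis cS : compact S.

Lemma heine_cantor (f : S -> R) (e : R) : continuous f -> 0 < e ->
  exists2 dl : R, 0 < dl & forall s s', rho s s' < dl -> `|f s - f s'| < e.
Proof.
move=> /continuous_rhoP cf e0.
have : \forall dl \near (0 : R)^'+, forall s s', rho s s' < dl -> `|f s - f s'| < e.
  apply: compact_near => // s; have [dl dl0 h] := cf s (e / 2) (divr_gt0 e0 (ltr0n _ 2)).
  exists (dl / 2); first by rewrite divr_gt0.
  near=> d' => s' ss' s'' ss''.
  have dd : d' < dl / 2 by near: d'; apply: nbhs_right_lt; rewrite divr_gt0.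
  have h1 : `|f s - f s'| < e / 2 by apply: h; apply: lt_trans ss' _; lra.
  have h2 : `|f s - f s''| < e / 2.
    by apply: h; apply: le_lt_trans (rho_triangle s s' s'') _; lra.
  rewrite -(subrKA (f s)) (splitr e); apply: le_lt_trans (ler_normD _ _) _.
  by rewrite distrC ltrD.
move=> [/= r r0 hr]; exists (r / 2); first by rewrite divr_gt0.
by apply: hr; rewrite /=; [rewrite sub0r normrN gtr0_norm; lra|lra].
Unshelve. all: by end_near. Qed.

Lemma compact_bounded_fun (f : S -> R) : continuous f -> exists M : R, forall s, `|f s| <= M.
Proof.
move=> /continuous_rhoP cf.
have : \forall M \near +oo, forall s, `|f s| <= M.
  apply: compact_near => // s; have [dl dl0 h] := cf s 1 ltr01.
  exists dl => //; near=> M => s' ss'.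
  have M1 : `|f s| + 1 <= M by near: M; apply: nbhs_pinfty_ge; exact: num_real.
  apply: le_trans M1; rewrite -[f s'](subrK (f s)) addrC.
  by apply: le_trans (ler_normD _ _) _; rewrite lerD2l distrC ltW// h.
by move=> [M [_ hM]]; exists (M + 1); apply: hM; rewrite ltrDl.
Unshelve. all: by end_near. Qed.

End geometry.

(** * Finite nets and measurability in C(S) *)

Section nets.
Context (R : realType) (D : nat) (S : set 'rV[R]_D).
Hypothesis cS : compact S.
Variable s0 : S.
Implicit Types (s : S).

Lemma coord_bound : exists M : nat, forall s i, `|val s 0 i| <= M%:R.
Proof.
have cc i : continuous (fun s : S => val s 0 i).
  apply/continuous_rhoP => s e e0; exists e => // s'; apply: le_lt_trans.
  by rewrite /rho (bigD1 i)//= lerDl sumr_ge0.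
have /choice[M hM] : forall i, exists M : R, forall s, `|val s 0 i| <= M.
  by move=> i; exact: compact_bounded_fun.
exists (Num.truncn (\sum_i `|M i|)).+1 => s i; apply: le_trans (hM i s) _.
apply: le_trans (ler_norm _) _; apply: le_trans (ltW (truncnS_gt _)).
by rewrite (bigD1 i)//= lerDl sumr_ge0.
Qed.

Definition box : nat := projT1 (cid coord_bound).

Lemma boxP s i : `|val s 0 i| <= box%:R.
Proof. exact: (projT2 (cid coord_bound)). Qed.

(** Number of grid intervals per unit length; the factor D + 1 makes the l1
    diameter of a cell smaller than 2^-j. *)
Definition resolution (j : nat) : nat := (D.+1 * 2 ^ j)%N.

(** The cells of the grid over a box containing S; cells that do not meet S are
    kept, with the representative s0. *)
Definition cells (j : nat) := {ffun 'I_D -> 'I_((2 * box * resolution j).+1)}.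

Definition cell j s : cells j :=
  [ffun i => inord (Num.truncn ((val s 0 i + box%:R) * (resolution j)%:R))].

Definition rep j (c : cells j) : S := xget s0 [set s | cell j s = c].

Definition mesh (j : nat) : R := 2^-1 ^+ j.

Lemma mesh_gt0 j : 0 < mesh j.
Proof. by rewrite exprn_gt0. Qed.

Lemma meshS j : mesh j.+1 = mesh j / 2.
Proof. by rewrite /mesh exprS mulrC. Qed.

Lemma resolution_gt0 j : 0 < (resolution j)%:R :> R.
Proof. by rewrite ltr0n muln_gt0/= expn_gt0. Qed.

Lemma cell_close j s s' : cell j s = cell j s' -> rho s s' < mesh j.
Proof.
move=> /ffunP cc.
have h i : `|val s 0 i - val s' 0 i| <= (resolution j)%:R^-1.
  have := congr1 val (cc i); rewrite !ffunE /=.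
  have b s1 : 0 <= (val s1 0 i + box%:R) * (resolution j)%:R <= (2 * box * resolution j)%:R.
    have /ler_normlP[b1 b2] := boxP s1 i.
    rewrite mulr_ge0 ?(ltW (resolution_gt0 j))//=; last by lra.
    rewrite natrM ler_wpM2r ?(ltW (resolution_gt0 j))// natrM; lra.
  have t s1 : (Num.truncn ((val s1 0 i + box%:R) * (resolution j)%:R)%R < (2 * box * resolution j).+1)%N.
    by case/andP: (b s1) => b1 b2; rewrite ltnS -(ler_nat R) (le_trans _ b2)// truncn_le.
  rewrite (inordK (t s)) (inordK (t s')).
  have /andP[s1 _] := b s; have /andP[s2 _] := b s'.
  move: (truncn_itv s1) (truncn_itv s2) => /andP[a1 a2] /andP[a3 a4] E.
  rewrite E in a1 a2; rewrite -[leRHS]mul1r ler_pdivlMr ?resolution_gt0//.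
  rewrite -[X in _ * X]gtr0_norm ?resolution_gt0// -normrM mulrBl.
  by move: a1 a2 a3 a4; rewrite -natr1 !mulrDl => *; rewrite ler_norml; apply/andP; split; lra.
apply: le_lt_trans (_ : \sum_(i < D) (resolution j)%:R^-1 < mesh j).
  by apply: ler_sum => i _; exact: h.
rewrite sumr_const card_ord -[_ *+ D]mulr_natr mulrC ltr_pdivrMr ?resolution_gt0//.
rewrite /resolution natrM natrX /mesh mulrCA exprVn mulVf ?mulr1 ?ltr_nat//.
Qed.

Lemma rep_close j s : rho s (rep (cell j s)) < mesh j.
Proof.
apply: cell_close; rewrite /rep.
by case: xgetP => [s1 -> //|/(_ s)]; rewrite /=.
Qed.

Definition tent j (c : cells j) s : R := Num.max 0 (2 * mesh j - rho s (rep c)).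

Definition tents j s : R := \sum_(c : cells j) tent c s.

Lemma tent_ge0 j (c : cells j) s : 0 <= tent c s.
Proof. by rewrite /tent le_max lexx. Qed.

Lemma tents_gt0 j s : 0 < tents j s.
Proof.
rewrite /tents (bigD1 (cell j s))//= ltr_pwDl//; last by apply: sumr_ge0 => *; exact: tent_ge0.
by rewrite lt_max; apply/orP; right; have := rep_close j s; have := mesh_gt0 j; lra.
Qed.

(** Partition of unity subordinate to the balls of radius 2 mesh j around the
    representatives. *)
Definition unity j (c : cells j) s : R := tent c s / tents j s.

Lemma unity_ge0 j (c : cells j) s : 0 <= unity c s.
Proof. by rewrite divr_ge0 ?tent_ge0// ltW ?tents_gt0. Qed.

Lemma unity_sum j s : \sum_(c : cells j) unity c s = 1.
Proof. by rewrite -mulr_suml divff// gt_eqF ?tents_gt0. Qed.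

Lemma unity_le1 j (c : cells j) s : unity c s <= 1.
Proof.
rewrite -(unity_sum j s) (bigD1 c)//= lerDl; apply: sumr_ge0 => *; exact: unity_ge0.
Qed.

Lemma unity_far j (c : cells j) s : 2 * mesh j <= rho s (rep c) -> unity c s = 0.
Proof.
by move=> h; rewrite /unity /tent max_l ?mul0r// subr_le0.
Qed.

Lemma continuous_tent j (c : cells j) : continuous (tent c).
Proof.
apply/continuous_rhoP => s e e0; exists e => // s' ss'.
apply: le_lt_trans ss'; rewrite /tent.
have := rho_triangle s s' (rep c); have := rho_triangle s' s (rep c).
rewrite (rho_sym s' s); move: (rho s (rep c)) (rho s' (rep c)) (rho s s') => a b r h1 h2.
have r0 : 0 <= r by lra.
by rewrite ler_norml; case: (leP 0 (2 * mesh j - a)); case: (leP 0 (2 * mesh j - b)) => *;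
  apply/andP; split; lra.
Qed.

Lemma continuous_unity j (c : cells j) : continuous (unity c).
Proof.
apply: continuous_mulR; first exact: continuous_tent.
move=> s; apply: (@cvgV R S (nbhs s) _ (tents j) (tents j s)).
  exact: lt0r_neq0 (tents_gt0 j s).
apply: (@continuous_sumR R _ _ _ (fun (c : cells j) s => tent c s)) => c'; exact: continuous_tent.
Qed.

Definition interp_fun j (z : cells j -> R) s : R := \sum_(c : cells j) z c * unity c s.

Lemma continuous_interp_fun j (z : cells j -> R) : continuous (interp_fun z).
Proof.
apply: (@continuous_sumR R _ _ _ (fun c s => z c * unity c s)) => c.
by apply: continuous_mulR; [exact: cst_continuous|exact: continuous_unity].
Qed.

Definition interp j (z : cells j -> R) : CS S := mkcts (@continuous_interp_fun j z).

Lemma interp_close j (f : S -> R) s (e : R) :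
  (forall c : cells j, rho s (rep c) < 2 * mesh j -> `|f s - f (rep c)| <= e) ->
  `|f s - interp (fun c : cells j => f (rep c)) s| <= e.
Proof.
move=> h; have -> : f s - interp (fun c : cells j => f (rep c)) s =
    \sum_(c : cells j) (f s - f (rep c)) * unity c s.
  rewrite /interp /mkcts /= /interp_fun.
  by under [RHS]eq_bigr do rewrite mulrBl; rewrite sumrB -mulr_sumr unity_sum mulr1.
apply: le_trans (ler_norm_sum _ _ _) _.
apply: le_trans (_ : \sum_(c : cells j) e * unity c s <= _); last first.
  by rewrite -mulr_sumr unity_sum mulr1.
apply: ler_sum => c _; rewrite normrM (ger0_norm (unity_ge0 _ _)).
have [far|near] := lerP (2 * mesh j) (rho s (rep c)); first by rewrite unity_far// !mulr0.
by rewrite ler_wpM2r ?unity_ge0 ?h.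
Qed.

Lemma interp_lip j (z z' : cells j -> R) s :
  `|interp z s - interp z' s| <= \sum_(c : cells j) `|z c - z' c|.
Proof.
rewrite /interp /mkcts /= /interp_fun -sumrB.
apply: le_trans (ler_norm_sum _ _ _) _; apply: ler_sum => c _.
by rewrite -mulrBl normrM (ger0_norm (unity_ge0 _ _)) ler_piMr// unity_le1.
Qed.

Lemma mesh_small (e : R) : 0 < e -> exists J, forall j, (J <= j)%N -> mesh j < e.
Proof.
move=> e0; have : mesh j @[j --> \oo] --> (0 : R).
  by apply: cvg_expr; rewrite ger0_norm// invf_lt1// ltr1n.
move=> /cvgrPdist_lt/(_ e e0)[J _ hJ]; exists J => j Jj.
by have := hJ j Jj; rewrite /= sub0r normrN gtr0_norm// mesh_gt0.
Qed.

Lemma interp_cvg (f : CS S) (e : R) : 0 < e -> exists J, forall j, (J <= j)%N ->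
  forall s, `|f s - interp (fun c : cells j => f (rep c)) s| <= e.
Proof.
move=> e0; have [dl dl0 h] := heine_cantor cS (@cts_fun _ _ f) e0.
have [J hJ] := mesh_small (divr_gt0 dl0 (ltr0n _ 2)).
exists J => j Jj s; apply: interp_close => c sc; apply/ltW/h.
by apply: lt_le_trans sc _; have := hJ j Jj; lra.
Qed.

(** Coordinatewise measurability implies Borel measurability. Interpolations with
    rational values on the nets are dense, so an open set is a countable union of
    closed balls around them; such a ball is cut out by countably many coordinates,
    those at the points of the nets. *)
Lemma CS_measurable d (T : measurableType d) (F : T -> CS S) :
  (forall s, measurable_fun setT (fun w => F w s)) -> measurable_fun setT F.
Proof.
move=> mF.
have mU (U : set (CS S)) : open U -> measurable (F @^-1` U).
  move=> oU.
  pose ball_ (m : {j : nat & {ffun cells j -> rat}}) (k : nat) : set (CS S) :=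
    [set f | forall s, `|f s - interp (fun c => ratr (tagged m c)) s| <= k.+1%:R^-1].
  pose good m k := ball_ m k `<=` U.
  pose K := ({j : nat & {ffun cells j -> rat}} * nat)%type.
  pose G (p : K) : set T := if `[< good p.1 p.2 >] then F @^-1` ball_ p.1 p.2 else set0.
  have -> : F @^-1` U = \bigcup_p G p.
    apply/seteqP; split => w /=; last first.
      by move=> [p _]; rewrite /G; case: asboolP => // gp; exact: gp.
    move=> Uw; have /nbhs_CSP[e e0 eU] : nbhs (F w) U by exact: open_nbhs_nbhs.
    have e30 : 0 < e / 3 by rewrite divr_gt0.
    have [k hk] : exists k : nat, k.+1%:R^-1 < e / 3.
      have := near_infty_natSinv_lt (PosNum e30) => -[k _ hk]; exists k; exact: (hk k (leqnn k)).
    have k20 : 0 < k.+1%:R^-1 / 2 :> R by rewrite divr_gt0.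
    have [j hj] := interp_cvg (F w) k20.
    have {}hj := hj j (leqnn j).
    have /choice[q hq] : forall c : cells j, exists q : rat,
        `|F w (rep c) - ratr q| <= k.+1%:R^-1 / 2.
      move=> c.
      have lt : F w (rep c) - k.+1%:R^-1 / 2 < F w (rep c) + k.+1%:R^-1 / 2.
        by rewrite ltrBlDr -addrA ltrDl addr_gt0.
      have [q] := rat_in_itvoo lt.
      rewrite in_itv/= => /andP[q1 q2]; exists q; rewrite ler_norml.
      apply/andP; split; first by rewrite lerBrDr addrC lerBlDr ltW.
      by rewrite lerBlDr addrC -lerBlDr ltW.
    have Fb : ball_ (existT _ j [ffun c => q c]) k (F w).
      move=> s; rewrite -(subrKA (interp (fun c : cells j => F w (rep c)) s)).
      rewrite (splitr k.+1%:R^-1); apply: le_trans (ler_normD _ _) _; rewrite lerD//.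
      rewrite /interp /mkcts /= /interp_fun -sumrB.
      apply: le_trans (ler_norm_sum _ _ _) _.
      apply: le_trans (_ : \sum_(c : cells j) (k.+1%:R^-1 / 2) * unity c s <= _); last first.
        by rewrite -mulr_sumr unity_sum mulr1.
      apply: ler_sum => c _; rewrite -mulrBl normrM (ger0_norm (unity_ge0 _ _)) ffunE.
      by rewrite ler_wpM2r ?unity_ge0.
    exists (existT _ j [ffun c => q c], k) => //.
    rewrite /G /=; case: asboolP => // -[]; move=> f fb; apply: eU => s.
    rewrite -(subrKA (interp (fun c => ratr ([ffun c => q c] c)) s)).
    apply: le_lt_trans (ler_normD _ _) _.
    have := Fb s; have := fb s; rewrite /= distrC => b1 b2.
    apply: le_lt_trans (lerD b2 b1) _.
    by move: hk; move: (k.+1%:R^-1) => v; lra.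
  apply: countable_bigcupT_measurable; first exact: countableP.
  move=> p; rewrite /G; case: asboolP => _ //.
  pose C := {j : nat & cells j}.
  have -> : F @^-1` ball_ p.1 p.2 = \bigcap_(c in [set: C])
      [set w | `|F w (rep (tagged c)) - interp (fun c => ratr (tagged p.1 c)) (rep (tagged c))| <= p.2.+1%:R^-1].
    apply/seteqP; split => w /= h; first by move=> c _; exact: h.
    move=> s; rewrite leNgt; apply/negP => hs.
    set g := interp _ in h hs.
    pose e := `|F w s - g s| - p.2.+1%:R^-1.
    have e0 : 0 < e by rewrite subr_gt0.
    have e20 : 0 < e / 2 by rewrite divr_gt0.
    have [d1 d10 h1] := heine_cantor cS (@cts_fun _ _ (F w)) e20.
    have [d2 d20 h2] := heine_cantor cS (@cts_fun _ _ g) e20.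
    have d120 : 0 < Num.min d1 d2 by rewrite lt_min d10.
    have [J hJ] := mesh_small d120.
    have sr := lt_trans (rep_close J s) (hJ J (leqnn J)).
    move: sr; rewrite lt_min => /andP[sr1 sr2].
    have a1 := h1 _ _ sr1; have a2 := h2 _ _ sr2.
    have /= a3 := h (existT _ J (cell J s)) I.
    have : `|F w s - g s| < e / 2 + (p.2.+1%:R^-1 + e / 2).
      have -> : F w s - g s = (F w s - F w (rep (cell J s))) +
         ((F w (rep (cell J s)) - g (rep (cell J s))) - (g s - g (rep (cell J s)))) by ring.
      apply: le_lt_trans (ler_normD _ _) _; rewrite ltr_leD//.
      by apply: le_trans (ler_normB _ _) _; rewrite lerD// ltW.
    by rewrite /e; move: (p.2.+1%:R^-1) (`|F w s - g s|) => v x; lra.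
  rewrite -[X in measurable X]setCK setC_bigcap; apply: measurableC.
  apply: countable_bigcupT_measurable; first exact: countableP.
  move=> c; apply: measurableC.
  set x := interp _ _.
  rewrite (_ : [set w | _] = (fun w => `|F w (rep (tagged c)) - x|) @^-1` `]-oo, p.2.+1%:R^-1]); last first.
    by apply/seteqP; split => w /=; rewrite in_itv.
  rewrite -[X in measurable X]setTI.
  have : measurable_fun setT (fun w => `|F w (rep (tagged c)) - x|).
    by apply: measurableT_comp => //; apply: measurable_funB => //; exact: mF.
  by apply => //; exact: measurable_itv.
move=> _ A mA; rewrite setTI; move: A mA; rewrite measurable_CSE.
apply: smallest_sub; last by move=> U oU; exact: mU.
split.
- by rewrite /= preimage_set0; exact: measurable0.
- by move=> A mA; rewrite /= setTD preimage_setC; exact: measurableC.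
- by move=> A mA; rewrite /= preimage_bigcup; apply: bigcupT_measurable.
Qed.

Lemma CS_continuous_measurable (h : CS S -> R) : continuous h -> measurable_fun setT h.
Proof.
move=> ch; apply: (measurability _ (RGenOpens.measurableE R)).
move=> _ [_ [a [b ->] <-]]; rewrite setTI; apply: sub_sigma_algebra.
by apply: open_comp (interval_open _ _) => // f _; exact: ch.
Qed.

Lemma measurable_eval s : measurable_fun setT (fun f : CS S => f s).
Proof.
apply: CS_continuous_measurable => f U /nbhs_ballP[e /= e0 eU].
apply/nbhs_CSP; exists e => // f' ff'; apply: eU; exact: ff'.
Qed.

End nets.

(** * Chaining *)

Section geometric_tail.
Context (R : realType) (k : R).
Hypothesis k01 : 0 < k < 1.

Lemma geometric_tail J J1 : \sum_(J <= j < J1) k ^+ j <= k ^+ J / (1 - k).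
Proof.
case/andP: k01 => k0 k1; have k1' : 0 < 1 - k by rewrite subr_gt0.
rewrite ler_pdivlMr//; have [J1J|/ltnW JJ1] := leqP J1 J.
  by rewrite big_geq// mul0r exprn_ge0// ltW.
suff -> : (\sum_(J <= j < J1) k ^+ j) * (1 - k) = k ^+ J - k ^+ J1.
  by rewrite gerBl exprn_ge0// ltW.
rewrite mulr_suml (eq_bigr (fun j => - (k ^+ j.+1 - k ^+ j))).
  by rewrite sumrN telescope_sumr// opprB.
by move=> j _; rewrite exprS; ring.
Qed.

Lemma linear_geometric : exists2 c : R, 0 <= c & forall j, j.+1%:R * k ^+ j <= c.
Proof.
case/andP: k01 => k0 k1; pose u := k^-1 - 1.
have u0 : 0 < u by rewrite subr_gt0 invf_gt1.
exists (1 + u^-1); first by rewrite addr_ge0// invr_ge0 ltW.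
move=> j; have h : 1 + j%:R * u <= (k^-1) ^+ j.
  elim: j => [|j IH]; first by rewrite mul0r addr0 expr0.
  have e : k^-1 = 1 + u by rewrite /u; ring.
  rewrite exprS; apply: le_trans (ler_wpM2l _ IH); last by rewrite invr_ge0 ltW.
  rewrite e -natr1; have : 0 <= j%:R * u ^+ 2 by rewrite mulr_ge0// sqr_ge0.
  by move=> h; lra.
have kj : 0 < k ^+ j by rewrite exprn_gt0.
have {}h : (1 + j%:R * u) * k ^+ j <= 1.
  by move: h; rewrite exprVn => h; rewrite -ler_pdivlMr// div1r.
have a1 : k ^+ j <= 1 by rewrite exprn_ile1// ltW.
have a2 : j%:R * k ^+ j <= u^-1.
  rewrite -[leRHS]mul1r ler_pdivlMr//.
  by apply: le_trans h; rewrite mulrDl mul1r mulrAC lerDr ltW.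
by rewrite -natr1 mulrDl mul1r addrC lerD.
Qed.

End geometric_tail.

Section chaining.
Context (R : realType) (D : nat) (S : set 'rV[R]_D).
Hypothesis cS : compact S.
Variables (s0 : S) (alpha : R).
Hypothesis alpha0 : 0 < alpha.
Local Notation rep := (@rep R D S cS s0 _).
Local Notation cells := (cells cS).
Local Notation mesh := (@mesh R).
Local Notation pi_ j s := (rep (cell cS j s)).

(** Pairs of cells of two consecutive nets. Only the pairs at distance at most
    3 mesh j count: [linkdiff] is 0 on the others. *)
Definition link j := (cells j.+1 * cells j)%type.

Definition step j : R := (3 * mesh j) `^ alpha.

Definition linkdiff j (f : S -> R) (p : link j) : R :=
  if rho (rep p.1) (rep p.2) <= 3 * mesh j then f (rep p.1) - f (rep p.2) else 0.

(** Soft maximum of the increments of f over the links of scale j. The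
    normalisation by [step] makes the increments of a Hölder function bounded by
    its Hölder constant at every scale. *)
Definition osc j (f : S -> R) : R := step j * lse (fun p : link j => linkdiff f p / step j).

Definition hoelder (b : R) (f : S -> R) :=
  forall s s', `|f s - f s'| <= b * rho s s' `^ alpha.

Let link0 j : link j := (cell cS j.+1 s0, cell cS j s0).

Lemma step_gt0 j : 0 < step j.
Proof. by rewrite powR_gt0// mulr_gt0// mesh_gt0. Qed.

Lemma osc_link j f (c : cells j.+1) (c' : cells j) : rho (rep c) (rep c') <= 3 * mesh j ->
  `|f (rep c) - f (rep c')| <= osc j f.
Proof.
move=> cc'; have := abs_le_lse (link0 j) (fun p : link j => linkdiff f p / step j) (c, c').
rewrite {1}/linkdiff /= cc' normrM [ `|_^-1| ]ger0_norm ?invr_ge0 ?(ltW (step_gt0 j))//.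
by rewrite ler_pdivrMr ?step_gt0// mulrC.
Qed.

Definition osc_sum J J1 f := \sum_(J <= j < J1) osc j f.

Lemma chain_pi J J1 f s : (J <= J1)%N ->
  `|f (pi_ J1 s) - f (pi_ J s)| <= osc_sum J J1 f.
Proof.
elim: J1 => [|J1 IH]; first by rewrite leqn0 => /eqP ->; rewrite subrr normr0 /osc_sum big_geq.
rewrite leq_eqVlt => /predU1P[->|]; first by rewrite subrr normr0 /osc_sum big_geq.
rewrite ltnS => JJ1; rewrite /osc_sum big_nat_recr//=.
rewrite -(subrKA (f (pi_ J1 s))) addrC; apply: le_trans (ler_normD _ _) _.
rewrite lerD ?IH//; apply: osc_link; rewrite rho_sym in (IH) *.
apply: le_trans (rho_triangle _ s _) _.
have := rep_close cS s0 J1.+1 s; have := rep_close cS s0 J1 s.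
rewrite meshS (rho_sym _ s); have := mesh_gt0 R J1; lra.
Qed.

(** The oscillation around a net point is paid from the link between the cells of
    levels J + 1 and J on; the representative of c may be any one within
    2 mesh J of s, as interpolation requires. *)
Lemma chain_cell J J1 f s (c : cells J) : (J < J1)%N -> rho s (rep c) < 2 * mesh J ->
  `|f s - f (rep c)| <= `|f s - f (pi_ J1 s)| + osc_sum J J1 f.
Proof.
move=> JJ1 sc; rewrite /osc_sum big_ltn//.
have -> : f s - f (rep c) = (f s - f (pi_ J1 s)) +
   ((f (pi_ J.+1 s) - f (rep c)) + (f (pi_ J1 s) - f (pi_ J.+1 s))) by ring.
apply: le_trans (ler_normD _ _) _; rewrite lerD2l.
apply: le_trans (ler_normD _ _) _; rewrite lerD//.
  apply: osc_link; apply: le_trans (rho_triangle _ s _) _.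
  have := rep_close cS s0 J.+1 s; rewrite meshS rho_sym.
  by have := mesh_gt0 R J; lra.
exact: chain_pi.
Qed.

Lemma hoelder_remainder (b : R) f s J : 0 <= b -> hoelder b f ->
  `|f s - f (pi_ J s)| <= b * mesh J `^ alpha.
Proof.
move=> b0 hf; apply: le_trans (hf _ _) _; rewrite ler_wpM2l//.
by rewrite ge0_ler_powR ?nnegrE ?rho_ge0 ?(ltW (mesh_gt0 _ _)) ?(ltW alpha0)// ltW// rep_close.
Qed.

Lemma linkdiff_le j (b : R) f (p : link j) : 0 <= b -> hoelder b f ->
  `|linkdiff f p / step j| <= b.
Proof.
move=> b0 hf; rewrite /linkdiff; case: ifPn => h; last by rewrite mul0r normr0.
rewrite normrM [ `|_^-1| ]ger0_norm ?invr_ge0 ?(ltW (step_gt0 j))//.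
rewrite ler_pdivrMr ?step_gt0//; apply: le_trans (hf _ _) _; rewrite ler_wpM2l//.
by rewrite /step ge0_ler_powR ?nnegrE ?rho_ge0 ?(ltW alpha0)// mulr_ge0// ltW// mesh_gt0.
Qed.

Definition theta : R := 2^-1 `^ alpha.

(** The square root of theta leaves room for the factor j + 1 coming from the
    logarithm of the number of links. *)
Definition kappa : R := Num.sqrt theta.

Lemma mesh_powR j : mesh j `^ alpha = theta ^+ j.
Proof.
rewrite /theta; elim: j => [|j IH]; first by rewrite /mesh !expr0 powR1.
by rewrite meshS powRM ?IH ?(ltW (mesh_gt0 _ _))// exprS mulrC.
Qed.

Lemma theta01 : 0 < theta < 1.
Proof.
rewrite powR_gt0//= (_ : 1 = 1 `^ alpha :> R); last by rewrite powR1.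
by apply: gt0_ltr_powR; rewrite ?nnegrE// invf_lt1// ltr1n.
Qed.

Lemma kappa01 : 0 < kappa < 1.
Proof.
have /andP[t0 t1] := theta01; rewrite sqrtr_gt0 t0/= -sqrtr1.
by rewrite ltr_sqrt.
Qed.

Lemma kappa_sqr : kappa ^+ 2 = theta.
Proof. by rewrite sqr_sqrtr//; have /andP[/ltW] := theta01. Qed.

Lemma step_le j : step j = 3 `^ alpha * theta ^+ j.
Proof. by rewrite /step powRM ?mesh_powR// ltW// mesh_gt0. Qed.

Definition linkbase : nat := (2 * (2 * (2 * box cS * D.+1 + 1)) ^ (D * 2))%N.

Lemma card_link j : (2 * #|{: link j}| <= linkbase ^ j.+1)%N.
Proof.
rewrite card_prod /cells !card_ffun !card_ord.
set A := (2 * box cS * D.+1 + 1)%N.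
have h i : ((2 * box cS * resolution D i).+1 <= A * 2 ^ i)%N.
  rewrite /resolution /A mulnDl mulnA -addn1 leq_add// mul1n expn_gt0//.
have h1 : ((2 * box cS * resolution D j.+1).+1 <= A * 2 ^ j.+1)%N := h j.+1.
have h2 : ((2 * box cS * resolution D j).+1 <= A * 2 ^ j.+1)%N.
  by apply: leq_trans (h j) _; rewrite leq_mul2l leq_exp2l// leqnSn orbT.
have h3 : (A * 2 ^ j.+1 <= (2 * A) ^ j.+1)%N.
  rewrite expnMn mulnC leq_mul2l; apply/orP; right.
  by rewrite -{1}(expn1 A) leq_pexp2l// /A addn1.
rewrite /linkbase -/A expnMn; apply: leq_mul.
  by rewrite -{1}(expn1 2) leq_exp2l.
have -> : (((2 * A) ^ (D * 2)) ^ j.+1 = ((2 * A) ^ j.+1) ^ D * ((2 * A) ^ j.+1) ^ D)%N.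
  by rewrite -expnD addnn -muln2 -!expnM; congr (_ ^ _)%N; exact: mulnC.
have e (m : nat) : (m <= (2 * A) ^ j.+1)%N -> (m ^ D <= ((2 * A) ^ j.+1) ^ D)%N.
  by case: (posnP D) => [->|D0]; rewrite ?expn0// leq_exp2r.
by apply: leq_mul; apply: e; [exact: leq_trans h1 h3|exact: leq_trans h2 h3].
Qed.

Lemma linkbase_gt0 : (0 < linkbase)%N.
Proof. by rewrite muln_gt0/= expn_gt0 muln_gt0/= addn1. Qed.

Lemma ln_card_link j : ln (2 * #|{: link j}|%:R) <= j.+1%:R * ln (linkbase%:R : R).
Proof.
have W0 : 0 < linkbase%:R :> R by rewrite ltr0n linkbase_gt0.
have l0 : (0 < #|{: link j}|)%N by apply/card_gt0P; exists (link0 j).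
rewrite [leRHS]mulr_natl -lnXn// ler_ln ?posrE ?exprn_gt0 ?mulr_gt0 ?ltr0n//.
  by rewrite -natrX -natrM ler_nat card_link.
exact: linkbase_gt0.
Qed.

Section expectation.
Context d (T : measurableType d) (P : probability T R).
Context (I : choiceType) (Y : I -> T -> R).
Hypothesis Y1 : forall i, L1 P (Y i).
Hypothesis Y0 : forall i, mean P (Y i) = 0.
Hypothesis Y2 : forall i, L1 P (fun w => Y i w ^+ 2).
Hypothesis Yvar : forall i, mean P (fun w => Y i w ^+ 2) = 1.
Hypothesis indepY : mutually_independent P Y.

Definition msum N (e : 'I_N -> I) (v : 'I_N -> S -> R) (w : T) (s : S) : R :=
  \sum_(n < N) Y (e n) w * v n s.

Lemma mean_lse_sum N (e : 'I_N -> I) (A : finType) (i0 : A) (a : A -> 'I_N -> R) (b : 'I_N -> R) :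
  injective e -> (forall i n, `|a i n| <= b n) ->
  L1 P (fun w => lse (fun i => \sum_(n < N) Y (e n) w * a i n)) /\
  mean P (fun w => lse (fun i => \sum_(n < N) Y (e n) w * a i n)) <=
    ln (2 * #|A|%:R) + 4 * \sum_(n < N) b n ^+ 2.
Proof.
move=> ie ab; have h := mean_lse_psum Y1 Y0 Y2 Yvar indepY ie i0 ab (leqnn N).
have h1 := L1_lse_psum Y1 ie i0 a N.
have E w : lse (fun i => psum Y e (a i) N w) = lse (fun i => \sum_(n < N) Y (e n) w * a i n).
  by congr lse; apply/funext => i; rewrite psum_full.
split; first exact: eq_L1 E h1.
move: h; rewrite (eq_mean P E) lse0.
by rewrite [X in 4 * X](eq_bigl xpredT) => [//|n]; rewrite ltn_ord.
Qed.

Lemma mean_osc N (e : 'I_N -> I) (v : 'I_N -> S -> R) (b : 'I_N -> R) j : injective e ->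
  (forall n, 0 <= b n) -> (forall n, hoelder (b n) (v n)) ->
  L1 P (fun w => osc j (msum e v w)) /\
  mean P (fun w => osc j (msum e v w)) <=
    step j * (ln (2 * #|{: link j}|%:R) + 4 * \sum_(n < N) b n ^+ 2).
Proof.
move=> ie b0 hv.
have [h1 h2] := @mean_lse_sum N e (link j) (link0 j) (fun p n => linkdiff (v n) p / step j) b ie
  (fun p n => linkdiff_le p (b0 n) (hv n)).
have E w : lse (fun p : link j => \sum_(n < N) Y (e n) w * (linkdiff (v n) p / step j)) =
    lse (fun p : link j => linkdiff (msum e v w) p / step j).
  congr lse; apply/funext => p; rewrite /linkdiff; case: ifP => _; last first.
    by rewrite mul0r big1// => n _; rewrite mulr0.
  rewrite /msum -sumrB mulr_suml; apply: eq_bigr => n _; ring.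
have h1' := eq_L1 E h1; split; first exact: L1Z.
by rewrite /osc meanZ// ler_pM2l ?step_gt0// -(eq_mean P E).
Qed.

Lemma mean_abs_le1 i : mean P (fun w => `|Y i w|) <= 1.
Proof. by apply: le_trans (mean_abs_le_sqr (Y1 i) (Y2 i)) _; rewrite Yvar; lra. Qed.

(** The scale-j oscillation has mean at most a constant times (j + 1) theta^j, which
    is summable. The chain is stopped at a level J1 depending on the sum, where the
    crude bound by the sum of b_n |g_n| is already small. *)
Theorem chaining : exists2 C0 : R, 0 <= C0 & forall N (e : 'I_N -> I) (v : 'I_N -> S -> R) (b : 'I_N -> R),
  injective e -> (forall n, 0 <= b n) -> (forall n, hoelder (b n) (v n)) ->
  (forall n s, `|v n s| <= b n) ->
  (forall J, exists2 O : T -> R, L1 P O /\ mean P O <= C0 * kappa ^+ J * (1 + \sum_(n < N) b n ^+ 2) &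
    forall w s (c : cells J), rho s (rep c) < 2 * mesh J ->
      `|msum e v w s - msum e v w (rep c)| <= O w) /\
  (exists2 O : T -> R, L1 P O /\ mean P O <= C0 * (1 + \sum_(n < N) b n ^+ 2) &
    forall w s, `|msum e v w s| <= O w).
Proof.
have [k0 k1] : 0 < kappa /\ kappa < 1 by apply/andP; exact: kappa01.
have [c c0 hc] := linear_geometric kappa01.
pose lW := ln (linkbase%:R : R).
have lW0 : 0 <= lW by apply: ln_ge0; rewrite ler1n linkbase_gt0.
pose C1 := 3 `^ alpha * (lW + 4) * c / (1 - kappa).
have C10 : 0 <= C1.
  by rewrite divr_ge0 ?subr_ge0 ?(ltW k1)// !mulr_ge0 ?powR_ge0 ?addr_ge0.
pose lc := ln (2 * #|{: cells 0}|%:R : R).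
have lc0 : 0 <= lc.
  apply: ln_ge0; rewrite -natrM ler1n muln_gt0/=; apply/card_gt0P; exists (cell cS 0 s0) => //.
exists (C1 + 1 + (lc + 4)); first by rewrite !addr_ge0.
move=> N e v b ie b0 hv vb.
set Q := \sum_(n < N) b n ^+ 2.
have Q0 : 0 <= Q by apply: sumr_ge0 => n _; rewrite sqr_ge0.
have oscL j := (mean_osc j ie b0 hv).1.
have oscE j : mean P (fun w => osc j (msum e v w)) <= 3 `^ alpha * (lW + 4) * c * (1 + Q) * kappa ^+ j.
  have [_] := mean_osc j ie b0 hv; move/le_trans; apply.
  rewrite step_le -kappa_sqr -exprM mulnC exprM expr2.
  have kj : 0 <= kappa ^+ j by rewrite exprn_ge0// ltW.
  have h1 : ln (2 * #|{: link j}|%:R) + 4 * Q <= j.+1%:R * (lW + 4) * (1 + Q).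
    have h := ln_card_link j; rewrite -/lW in h.
    have j1 : 1 <= j.+1%:R :> R by rewrite ler1n.
    have a1 : 0 <= j.+1%:R * lW * Q by rewrite !mulr_ge0.
    have a2 : 0 <= (j.+1%:R - 1) * Q by rewrite mulr_ge0// subr_ge0.
    by apply: le_trans (lerD h (lexx _)) _; lra.
  have h2 : kappa ^+ j * (ln (2 * #|{: link j}|%:R) + 4 * Q) <= c * ((lW + 4) * (1 + Q)).
    apply: le_trans (ler_wpM2l kj h1) _.
    have -> : kappa ^+ j * (j.+1%:R * (lW + 4) * (1 + Q)) =
      (j.+1%:R * kappa ^+ j) * ((lW + 4) * (1 + Q)) by ring.
    by rewrite ler_wpM2r ?mulr_ge0 ?addr_ge0.
  rewrite -!mulrA ler_wpM2l ?powR_ge0//.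
  have := ler_wpM2l kj h2; congr (_ <= _); ring.
have sumE J J1 : mean P (fun w => osc_sum J J1 (msum e v w)) <= C1 * kappa ^+ J * (1 + Q).
  rewrite /osc_sum mean_sum; last by move=> j _; exact: oscL.
  apply: le_trans (ler_sum _ (fun j _ => oscE j)) _.
  rewrite -mulr_sumr; apply: le_trans (ler_wpM2l _ (geometric_tail kappa01 J J1)) _.
    by rewrite !mulr_ge0 ?powR_ge0 ?addr_ge0.
  by rewrite /C1 le_eqVlt; apply/orP; left; apply/eqP; field; rewrite subr_eq0 gt_eqF.
have sumL J J1 : L1 P (fun w => osc_sum J J1 (msum e v w)).
  by apply: L1_sum => j _; exact: oscL.
pose B := \sum_(n < N) b n.
have B0 : 0 <= B by apply: sumr_ge0.
pose A w := \sum_(n < N) b n * `|Y (e n) w|.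
have A0 w : 0 <= A w by apply: sumr_ge0 => n _; rewrite mulr_ge0.
have AL : L1 P A by apply: L1_sum => n _; apply: L1Z; exact: L1_abs.
have AE : mean P A <= B.
  rewrite mean_sum; last by move=> n _; apply: L1Z; exact: L1_abs.
  apply: ler_sum => n _; rewrite meanZ; last exact: L1_abs.
  by apply: ler_piMr => //; exact: mean_abs_le1.
have hA w : hoelder (A w) (msum e v w).
  move=> s s'; rewrite /msum -sumrB /A mulr_suml.
  apply: le_trans (ler_norm_sum _ _ _) _; apply: ler_sum => n _.
  rewrite -mulrBr normrM (_ : b n * _ * _ = `|Y (e n) w| * (b n * rho s s' `^ alpha)); last by ring.
  by rewrite ler_wpM2l// hv.
have small (x : R) : 0 < x -> exists J0, forall J1, (J0 <= J1)%N -> theta ^+ J1 * B <= x.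
  move=> x0; have : theta ^+ j * B @[j --> \oo] --> (0 * B : R).
    apply: cvgM; last exact: cvg_cst.
    by apply: cvg_expr; case/andP: theta01 => t0 t1; rewrite ger0_norm// ltW.
  rewrite mul0r => /cvgrPdist_le/(_ x x0)[J0 _ hJ0]; exists J0 => J1 JJ.
  have := hJ0 J1 JJ; rewrite /= sub0r normrN; exact: le_trans (ler_norm _).
have remE J1 (x : R) : theta ^+ J1 * B <= x -> mean P (fun w => theta ^+ J1 * A w) <= x.
  move=> h; rewrite meanZ//; apply: le_trans h; rewrite ler_wpM2l// exprn_ge0//.
  by case/andP: theta01 => /ltW.
split=> [J|].
  have kJ : 0 < kappa ^+ J by rewrite exprn_gt0.
  have [J0 hJ0] := small _ kJ.
  pose J1 := maxn J0 J.+1.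
  exists (fun w => theta ^+ J1 * A w + osc_sum J J1 (msum e v w)).
    split; first by apply: L1D => //; exact: L1Z.
    rewrite meanD//; last exact: L1Z.
    apply: le_trans (lerD (remE J1 _ (hJ0 J1 (leq_maxl _ _))) (sumE J J1)) _.
    have h1 : 0 <= kappa ^+ J * Q by rewrite mulr_ge0// ltW.
    have h2 : 0 <= (lc + 4) * (kappa ^+ J * (1 + Q)).
      by rewrite !mulr_ge0 ?addr_ge0// ltW.
    by lra.
  move=> w s c' sc; apply: le_trans (chain_cell (msum e v w) (leq_maxr J0 J.+1) sc) _.
  by rewrite lerD2r mulrC -mesh_powR; exact: hoelder_remainder.
have [J1 hJ1] := small _ ltr01.
have {}hJ1 := hJ1 J1 (leqnn _).
have [l1 l2] := @mean_lse_sum N e (cells 0) (cell cS 0 s0) (fun c n => v n (rep c)) b ie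
  (fun c n => vb n _).
exists (fun w => theta ^+ J1 * A w + osc_sum 0 J1 (msum e v w) +
    lse (fun c : cells 0 => msum e v w (rep c))).
  split; first by apply: L1D => //; apply: L1D => //; exact: L1Z.
  rewrite meanD//; last by apply: L1D => //; exact: L1Z.
  rewrite meanD//; last exact: L1Z.
  apply: le_trans (lerD (lerD (remE J1 _ hJ1) (sumE 0 J1)) l2) _.
  rewrite expr0 mulr1 -/lc -/Q; have : 0 <= lc * Q by rewrite mulr_ge0.
  by lra.
move=> w s.
have -> : msum e v w s = (msum e v w s - msum e v w (pi_ J1 s)) +
   (msum e v w (pi_ J1 s) - msum e v w (pi_ 0 s)) + msum e v w (pi_ 0 s) by ring.
apply: le_trans (ler_normD _ _) _; rewrite lerD//; last first.
  exact: (abs_le_lse (cell cS 0 s0) (fun c : cells 0 => msum e v w (rep c)) (cell cS 0 s)).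
apply: le_trans (ler_normD _ _) _; rewrite lerD//; last exact: chain_pi.
by rewrite mulrC -mesh_powR; exact: hoelder_remainder.
Qed.

End expectation.
End chaining.

(** * The law of large numbers in mean *)

Section almost_everywhere.
Context (R : realType) d (T : measurableType d) (P : probability T R).

Lemma prob_le_mean (A : set T) (f : T -> R) : measurable A -> L1 P f ->
  (forall x, 0 <= f x) -> (forall x, A x -> 1 <= f x) -> (P A <= (mean P f)%:E)%E.
Proof.
move=> mA f1 f0 Af; rewrite -(prob_fine P mA) lee_fin -mean_indic//.
apply: le_mean => //; first exact: L1_indic.
move=> x; rewrite indicE; case: (boolP (x \in A)) => [/set_mem/Af//|_]; exact: f0.
Qed.

(** The hypotheses on paths hold almost surely; this and the next two lemmas allow
    a null set of exceptions in pointwise bounds. *)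
Lemma mean_null (A : set T) (f : T -> R) : measurable A -> P A = 0%E -> L1 P f ->
  mean P (fun x => \1_(~` A) x * f x) = mean P f.
Proof.
move=> mA A0 f1; have mf := L1_measurable f1.
rewrite /mean /Rintegral; congr fine; apply: ae_eq_integral => //.
- apply/measurable_EFinP; apply: measurable_funM => //.
  by apply: measurable_indic; exact: measurableC.
- exact/measurable_EFinP.
exists A; split => // x /= h; apply: contrapT => nA; apply: h => _.
by rewrite indicE mem_set// mul1r.
Qed.

Lemma mean_abs_le_null (A : set T) (f g : T -> R) : measurable A -> P A = 0%E ->
  L1 P f -> L1 P g -> (forall x, ~ A x -> `|f x| <= g x) -> `|mean P f| <= mean P g.
Proof.
move=> mA A0 f1 g1 fg; rewrite -(mean_null mA A0 f1) -(mean_null mA A0 g1).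
have LI (h : T -> R) : L1 P h -> L1 P (fun x => \1_(~` A) x * h x).
  move=> h1; have mh := L1_measurable h1; apply: (L1_le _ (L1_abs h1)).
    by apply: measurable_funM => //; apply: measurable_indic; exact: measurableC.
  move=> x; rewrite normrM; apply: ler_piMl => //.
  by rewrite indicE; case: (_ \in _); rewrite ?normr1 ?normr0.
apply: mean_abs_le; [exact: LI|exact: LI|move=> x].
rewrite indicE; case: (boolP (x \in ~` A)) => [/set_mem nA|_]; last by rewrite !mul0r normr0.
by rewrite !mul1r; exact: fg.
Qed.

Lemma L1_le_null (A : set T) (f g : T -> R) : measurable A -> P A = 0%E ->
  measurable_fun setT f -> L1 P g -> (forall x, ~ A x -> `|f x| <= g x) -> L1 P f.
Proof.
move=> mA A0 mf g1 fg; have mg := L1_measurable g1; apply/L1P; split => //.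
move/L1P : (g1) => [_]; apply: le_lt_trans.
apply: ae_ge0_le_integral => //.
- by apply/measurable_EFinP; exact: measurableT_comp.
- by apply/measurable_EFinP; exact: measurableT_comp.
exists A; split => // x /= h; apply: contrapT => nA; apply: h => _.
by rewrite lee_fin (le_trans (fg x nA))// ler_norm.
Qed.

Lemma same_law_mean dE (E : measurableType dE) (Y Y1 : {mfun T >-> E}) (F : E -> R) :
  same_law P P Y Y1 -> measurable_fun setT F -> L1 P (F \o Y1) ->
  L1 P (F \o Y) /\ mean P (F \o Y) = mean P (F \o Y1).
Proof.
move=> YY1 mF F1.
have mY : measurable_fun setT Y by exact: measurable_funP.
have mY1 : measurable_fun setT Y1 by exact: measurable_funP.
have LY : L1 P (F \o Y).
  apply/L1P; split; first exact: measurableT_comp.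
  have mFa : measurable_fun setT (fun y => (`|F y|)%:E).
    by apply/measurable_EFinP; exact: measurableT_comp.
  move/L1P : F1 => [_].
  have e (Z : T -> E) : measurable_fun setT Z -> (\int[P]_x (`|(F \o Z) x|)%:E =
      \int[pushforward P Z]_y (`|F y|)%:E)%E.
    by move=> mZ; rewrite ge0_integral_pushforward//= preimage_setT.
  rewrite (e Y)// (e Y1)// (eq_measure_integral (pushforward P Y))// => A mA _.
  by rewrite /pushforward; exact/esym/YY1.
split => //.
pose nu : probability E R := distribution P Y1.
have l1 A : measurable A -> P (Y1 @^-1` A) = nu A by [].
have l2 A : measurable A -> P (Y @^-1` A) = nu A by move=> mA; exact: YY1.
have [_ <-] := @mean_law _ _ _ _ _ _ _ nu _ mY l2 mF LY.
by have [_ <-] := @mean_law _ _ _ _ _ _ _ nu _ mY1 l1 mF F1.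
Qed.

Lemma measurable_gt_bool dE (E : measurableType dE) (f : E -> R) (c : R) :
  measurable_fun setT f -> measurable_fun setT (fun x => (c < f x)%R%:R : R).
Proof.
move=> mf; rewrite (_ : (fun x => _) = \1_[set x | c < f x]).
  by apply: measurable_indic; exact: measurable_gt.
by apply/funext => x; rewrite indicE; congr (nat_of_bool _)%:R; apply/idP/idP; rewrite inE.
Qed.

Lemma L1_tail (W : T -> R) (e : R) : L1 P W -> 0 < e -> exists c0 : R, forall c, c0 <= c ->
  mean P (fun x => `|W x| * (c < `|W x|)%R%:R) <= e.
Proof.
move=> W1 e0; have mW := L1_measurable W1.
have mI c : measurable_fun setT (fun x => `|W x| * (c < `|W x|)%R%:R).
  apply: measurable_funM; first exact: measurableT_comp.
  by apply: measurable_gt_bool; exact: measurableT_comp.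
have b c x : `| `|W x| * (c < `|W x|)%R%:R | <= `|W x|.
  by rewrite normrM normr_id; case: (_ < _); rewrite ?normr1 ?normr0 ?mulr1 ?mulr0.
have LI c : L1 P (fun x => `|W x| * (c < `|W x|)%R%:R).
  by apply: L1_le (L1_abs W1) (b c).
have cv : mean P (fun x => `|W x| * (n%:R < `|W x|)%R%:R) @[n --> \oo] --> (0 : R).
  rewrite -[X in _ --> X](mean_cst P 0).
  apply: (@dominated_mean _ _ _ P (fun n x => `|W x| * (n%:R < `|W x|)%R%:R) (fun=> 0)
    (fun x => `|W x|) (fun n => mI n%:R) (L1_abs W1) (fun n => b n%:R) _).2 => x.
  apply: cvg_near_cst; near=> n.
  rewrite ltNge (_ : `|W x| <= n%:R) ?mulr0//.
  by near: n; exact: nbhs_infty_ger.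
move/cvgrPdist_le : cv => /(_ e e0)[n0 _ hn0].
exists n0%:R => c c0; have := hn0 n0 (leqnn n0); rewrite /= sub0r normrN.
move=> /(le_trans (ler_norm _)); apply: le_trans; apply: le_mean => // x.
rewrite ler_wpM2l// ler_nat; case: (boolP (c < _)) => // h.
by rewrite (le_lt_trans c0 h).
Unshelve. all: by end_near. Qed.

End almost_everywhere.

Section law_of_large_numbers.
Context (R : realType) d (T : measurableType d) (P : probability T R).
Context dE (E : measurableType dE) (Y : nat -> {mfun T >-> E}).
Hypothesis indepY : mutually_independent P Y.
Hypothesis lawY : forall n, same_law P P (Y n) (Y 0%N).
Variable w : E -> R.
Hypothesis mw : measurable_fun setT w.
Hypothesis w1 : L1 P (w \o Y 0%N).

Let mY n : measurable_fun setT (Y n) := measurable_funP (Y n).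

Let L1w n : L1 P (w \o Y n) := (same_law_mean (lawY n) mw w1).1.

Definition avg N x : R := N%:R^-1 * \sum_(n < N) w (Y n x).

Lemma L1_avg N : L1 P (avg N).
Proof. by apply: L1Z; apply: L1_sum => n _; exact: L1w. Qed.

Let uncorrelated (v : E -> R) c n k : measurable_fun setT v -> (forall y, `|v y| <= c) ->
  n != k -> mean P (fun x => v (Y n x) * v (Y k x)) = mean P (v \o Y n) * mean P (v \o Y k).
Proof.
move=> mv vc nk.
have mU : measurable_fun setT (v \o Y n : past Y [fset n]%fset -> R).
  by apply: measurableT_comp => //; apply: past_measurable; rewrite inE.
have L i : L1 P (v \o Y i).
  by apply: (@L1_bounded _ _ _ _ _ c) => [|x]; [exact: measurableT_comp|exact: vc].
have kn : k \notin [fset n]%fset by rewrite inE eq_sym.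
by have [] := past_mean mY indepY kn mU (L n) mv (L k).
Qed.

(** Truncation at a level c that makes the discarded part small in mean, and the
    second moment of the centred truncated variables, which are uncorrelated. *)
Lemma lln_mean (e : R) : 0 < e -> exists N0, forall N, (N0 <= N)%N ->
  mean P (fun x => `|avg N x - mean P (w \o Y 0%N)|) <= e.
Proof.
move=> e0; pose m := mean P (w \o Y 0%N).
have e8 : 0 < e / 8 by rewrite divr_gt0.
have [c0 hc0] := L1_tail w1 e8.
pose c := Num.max c0 1; have c1 : 1 <= c by rewrite le_max lexx orbT.
have cpos : 0 < c := lt_le_trans ltr01 c1.
have {}hc0 := hc0 c; rewrite le_max lexx /= in hc0; have {}hc := hc0 isT.
pose big y := w y * (c < `|w y|)%R%:R.
pose wc y := w y - big y.
have maw : measurable_fun setT (fun y => `|w y|) by exact: measurableT_comp.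
have mbig : measurable_fun setT big.
  by apply: measurable_funM => //; exact: measurable_gt_bool.
have mwc : measurable_fun setT wc by exact: measurable_funB.
have wcb y : `|wc y| <= c.
  rewrite /wc /big; case: ltP => h; last by rewrite mulr0 subr0.
  by rewrite mulr1 subrr normr0 ltW.
have bigw y : `|big y| <= `|w y|.
  by rewrite normrM; case: (_ < _); rewrite ?normr1 ?normr0 ?mulr1 ?mulr0.
have L1comp v n : measurable_fun setT v -> L1 P (v \o Y 0%N) -> L1 P (v \o Y n) /\
    mean P (v \o Y n) = mean P (v \o Y 0%N).
  by move=> mv v1; exact: (same_law_mean (lawY n) mv v1).
have big1 : L1 P (big \o Y 0%N).
  by apply: (L1_le _ (L1_abs w1)) => [|x]; [exact: measurableT_comp|exact: bigw].
have wc1 : L1 P (wc \o Y 0%N) by exact: L1B.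
pose mc := mean P (wc \o Y 0%N).
have mabig : measurable_fun setT (fun y => `|big y|) by exact: measurableT_comp.
have absbig n : mean P (fun x => `|big (Y n x)|) <= e / 8.
  have [_ ->] := L1comp (fun y => `|big y|) n mabig (L1_abs big1).
  apply: le_trans hc; apply: le_mean.
  - exact: L1_abs.
  - apply: eq_L1 (L1_abs big1) => x /=; rewrite /big normrM; congr (_ * _).
    by case: (_ < _); rewrite ?normr1 ?normr0.
  by move=> x /=; rewrite /big normrM ler_wpM2l//; case: (_ < _); rewrite ?normr1 ?normr0.
have mmc : `|m - mc| <= e / 8.
  rewrite /m /mc -meanB//; apply: le_trans (mean_abs (L1B w1 wc1)) _.
  apply: le_trans (absbig 0%N); rewrite le_eqVlt; apply/orP; left; apply/eqP.
  by apply: eq_mean => x /=; rewrite /wc opprB addrC subrK.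
have mcb : `|mc| <= c by apply: mean_abs_bound => [|x]; [exact: measurableT_comp|exact: wcb].
pose V y := wc y - mc.
have mV : measurable_fun setT V by apply: measurable_funB.
have Vb y : `|V y| <= 2 * c.
  by rewrite mulrDl mul1r (le_trans (ler_normB _ _))// lerD.
have V1 n : L1 P (V \o Y n).
  by apply: (@L1_bounded _ _ _ _ _ (2 * c)) => [|x]; [exact: measurableT_comp|exact: Vb].
have V0 n : mean P (V \o Y n) = 0.
  have [_ ->] := L1comp V n mV (V1 0%N).
  by rewrite (@meanB _ _ _ P (wc \o Y 0%N) (fun=> mc) wc1 (L1_cst _ _)) mean_cst subrr.
pose A N x := \sum_(n < N) V (Y n x).
have VV n k : L1 P (fun x => V (Y n x) * V (Y k x)).
  apply: (@L1_bounded _ _ _ _ _ (2 * c * (2 * c))) => [|x].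
    by apply: measurable_funM; exact: measurableT_comp.
  by rewrite normrM; apply: ler_pM.
have A2E N : (fun x => A N x ^+ 2) =1
    fun x => \sum_(n < N) \sum_(k < N) V (Y n x) * V (Y k x).
  by move=> x; rewrite expr2 mulr_suml; apply: eq_bigr => n _; rewrite mulr_sumr.
have A2L N : L1 P (fun x => A N x ^+ 2).
  apply: (eq_L1 (fsym (A2E N))).
  by apply: L1_sum => n _; apply: L1_sum => k _; exact: VV.
have A2b N : mean P (fun x => A N x ^+ 2) <= N%:R * (2 * c) ^+ 2.
  rewrite (eq_mean P (A2E N)) mean_sum; last by move=> n _; apply: L1_sum => k _; exact: VV.
  rewrite -[N in leRHS]card_ord -sum1_card natr_sum mulr_suml; apply: ler_sum => n _.
  rewrite mean_sum; last by move=> k _; exact: VV.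
  rewrite (bigD1 n)//= bigop.big1 ?addr0 ?mul1r => [|k kn]; last first.
    by rewrite (uncorrelated mV Vb) 1?eq_sym// V0 mul0r.
  apply: le_trans (ler_norm _) _; apply: mean_abs_bound => [|x].
    by apply: measurable_funM; exact: measurableT_comp.
  by rewrite normrM expr2; apply: ler_pM.
have AL N : L1 P (A N) by apply: L1_sum => n _; exact: V1.
pose B N x := N%:R^-1 * \sum_(n < N) `|big (Y n x)|.
have BL1 N : L1 P (B N).
  by apply: L1Z; apply: L1_sum => n _; apply: L1_abs; exact: (L1comp _ _ mbig big1).1.
have Bb N : (0 < N)%N -> mean P (B N) <= e / 8.
  move=> N0; rewrite /B meanZ; last first.
    by apply: L1_sum => n _; apply: L1_abs; exact: (L1comp _ _ mbig big1).1.
  rewrite mean_sum => [|n _]; last by apply: L1_abs; exact: (L1comp _ _ mbig big1).1.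
  rewrite ler_pdivrMl ?ltr0n// -[N in leRHS]card_ord -sum1_card natr_sum mulr_suml.
  by apply: ler_sum => n _; rewrite mul1r; exact: absbig.
have [M hM] : exists M : nat, 16 * c ^+ 2 / e ^+ 2 <= M%:R.
  exists (Num.truncn (16 * c ^+ 2 / e ^+ 2)).+1; apply: ltW; apply: truncnS_gt.
exists M.+1 => N MN; have N0 : (0 < N)%N by exact: leq_trans MN.
have NR : 0 < N%:R :> R by rewrite ltr0n.
have dec x : `|avg N x - m| <= (e / 4 + e^-1 * (N%:R ^- 2 * A N x ^+ 2)) + B N x + e / 8.
  have -> : avg N x - m = N%:R^-1 * A N x + N%:R^-1 * \sum_(n < N) big (Y n x) + (mc - m).
    have -> : A N x = \sum_(n < N) w (Y n x) - \sum_(n < N) big (Y n x) - N%:R * mc.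
      by rewrite /A /V /wc !sumrB sumr_const card_ord mulr_natl.
    by rewrite /avg; field; rewrite gt_eqF.
  apply: le_trans (ler_normD _ _) _; rewrite lerD 1?distrC//.
  apply: le_trans (ler_normD _ _) _; rewrite lerD//; last first.
    rewrite normrM gtr0_norm ?invr_gt0// /B; apply: ler_wpM2l; first by rewrite invr_ge0 ltW.
    exact: ler_norm_sum.
  rewrite -exprVn -exprMn; set z := N%:R^-1 * A N x.
  rewrite -(real_normK (num_real z)); set t := `|z|.
  have : 0 <= e^-1 * (e / 2 - t) ^+ 2 by rewrite mulr_ge0 ?sqr_ge0// invr_ge0 ltW.
  have -> : e^-1 * (e / 2 - t) ^+ 2 = e / 4 - t + e^-1 * t ^+ 2.
    by field; rewrite gt_eqF.
  lra.
have L2 : L1 P (fun x => e^-1 * (N%:R ^- 2 * A N x ^+ 2)) by do 2 apply: L1Z.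
apply: (@le_trans _ _ (mean P (fun x => (e / 4 + e^-1 * (N%:R ^- 2 * A N x ^+ 2)) + B N x + e / 8))).
  apply: le_mean => //; first by apply: L1_abs; apply: L1B; [exact: L1_avg|exact: L1_cst].
  by apply: L1D; [apply: L1D => //; apply: L1D => //; exact: L1_cst|exact: L1_cst].
rewrite meanD; [|by apply: L1D => //; apply: L1D => //; exact: L1_cst|exact: L1_cst].
rewrite meanD => //; last by apply: L1D => //; exact: L1_cst.
rewrite meanD => //; last exact: L1_cst.
rewrite !mean_cst meanZ; last exact: L1Z.
rewrite meanZ//; have {}Bb := Bb _ N0.
have h : e^-1 * (N%:R ^- 2 * mean P (fun x => A N x ^+ 2)) <= e / 4.
  apply: (@le_trans _ _ (e^-1 * (N%:R ^- 2 * (N%:R * (2 * c) ^+ 2)))).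
    apply: ler_wpM2l; first by rewrite invr_ge0 ltW.
    by apply: ler_wpM2l => //; rewrite invr_ge0 sqr_ge0.
  have -> : e^-1 * (N%:R ^- 2 * (N%:R * (2 * c) ^+ 2)) =
      (16 * c ^+ 2 / e ^+ 2) / N%:R * (e / 4) by field; rewrite !gt_eqF.
  apply: ler_piMl; first by rewrite divr_ge0// ltW.
  rewrite ler_pdivrMr// mul1r (le_trans hM)// ler_nat.
  exact: ltnW.
lra.
Qed.

End law_of_large_numbers.

(** * Envelopes of sample paths *)

Section maximum.
Context (R : realType) d (T : measurableType d) (P : probability T R).
Context dE (E : measurableType dE) (Y : nat -> {mfun T >-> E}).
Hypothesis lawY : forall n, same_law P P (Y n) (Y 0%N).
Variable w : E -> R.
Hypothesis mw : measurable_fun setT w.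
Hypothesis w0 : forall y, 0 <= w y.
Hypothesis w1 : L1 P (w \o Y 0%N).

Definition exceed N (c : R) : set T := \bigcup_(n in [set n | (n < N)%N]) [set x | c < w (Y n x)].

Lemma measurable_exceed N c : measurable (exceed N c).
Proof.
apply: bigcup_measurable => n _.
by apply: (@measurable_gt _ _ _ (w \o Y n)); exact: measurableT_comp.
Qed.

Lemma exceedN N c x : ~ exceed N c x -> forall n : 'I_N, w (Y n x) <= c.
Proof.
move=> h n; rewrite leNgt; apply/negP => wc; apply: h.
by exists n => /=.
Qed.

(** The probability is at most N times that of one variable exceeding dl N, hence at
    most the mean of w over its tail divided by dl. *)
Lemma max_small (dl e : R) : 0 < dl -> 0 < e -> exists N0, forall N, (N0 <= N)%N ->
  (P (exceed N (dl * N%:R)) <= e%:E)%E.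
Proof.
move=> dl0 e0; have [c0 hc0] := L1_tail w1 (mulr_gt0 e0 dl0).
exists (Num.truncn (`|c0| / dl)).+1 => N hN.
have N0 : (0 < N)%N by exact: leq_trans hN.
have NR : 0 < N%:R :> R by rewrite ltr0n.
have dN : 0 < dl * N%:R by rewrite mulr_gt0.
have {hc0} := hc0 (dl * N%:R).
have -> : c0 <= dl * N%:R.
  apply: le_trans (ler_norm _) _; rewrite mulrC -ler_pdivrMr//.
  by apply: le_trans (ltW (truncnS_gt _)) _; rewrite ler_nat.
move=> /(_ isT) tail.
pose t y := `|w y| * (dl * N%:R < `|w y|)%R%:R.
have mt : measurable_fun setT t.
  have ma : measurable_fun setT (fun y => `|w y|) by exact: measurableT_comp.
  by apply: measurable_funM => //; exact: measurable_gt_bool.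
have t0 y : 0 <= t y by rewrite mulr_ge0.
have t1 : L1 P (t \o Y 0%N).
  apply: (L1_le _ (L1_abs w1)) => [|x]; first exact: measurableT_comp.
  by rewrite ger0_norm ?t0// /t /=; apply: ler_piMr => //; case: (_ < _).
have tn n := same_law_mean (lawY n) mt t1.
pose F x := (dl * N%:R)^-1 * \sum_(n < N) t (Y n x).
have F1 : L1 P F by apply: L1Z; apply: L1_sum => n _; exact: (tn n).1.
apply: le_trans (@prob_le_mean _ _ _ P _ F _ F1 _ _) _.
- exact: measurable_exceed.
- by move=> x; rewrite mulr_ge0 ?invr_ge0 ?(ltW dN)//; apply: sumr_ge0.
- move=> x; move=> [n /= nN wn].
  rewrite /F ler_pdivlMl// mulr1 (bigD1 (Ordinal nN))//= ler_wpDr//.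
    by apply: sumr_ge0.
  by rewrite /t ger0_norm// wn mulr1 ltW.
rewrite lee_fin /F meanZ; last by apply: L1_sum => n _; exact: (tn n).1.
rewrite mean_sum; last by move=> n _; exact: (tn n).1.
rewrite ler_pdivrMl//.
apply: (@le_trans _ _ (\sum_(n < N) e * dl)).
  by apply: ler_sum => n _; rewrite (tn n).2.
by rewrite sumr_const card_ord -mulr_natr le_eqVlt; apply/orP; left; apply/eqP; ring.
Qed.

End maximum.

Section hoelder_norm.
Context (R : realType) (D : nat) (S : set 'rV[R]_D).
Hypothesis cS : compact S.
Variables (s0 : S) (alpha : R).
Hypothesis alpha0 : 0 < alpha.

(** A common bound for the sup norm and the Hölder constant, taken among the
    integers: the sets [level] are closed, which makes [hnorm] measurable. *)
Definition level (n : nat) : set (CS S) :=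
  [set f | (forall s, `|f s| <= n.+1%:R) /\ hoelder alpha n.+1%:R f].

Lemma measurable_level n : measurable (level n).
Proof.
rewrite -[level n]setCK; apply: measurableC; apply: sub_sigma_algebra.
rewrite openE => f /=; rewrite /interior => nf.
have [[s hs]|] := pselect (exists s, n.+1%:R < `|f s|).
  apply/nbhs_CSP; exists (`|f s| - n.+1%:R); first by rewrite subr_gt0.
  move=> f' ff' [] /(_ s) h _; have := ff' s; rewrite ltNge => /negP; apply.
  by apply: le_trans (lerB_dist _ _); rewrite lerD2l lerN2.
move=> h1.
have [[s [s' hs]]|h2] := pselect (exists s s', n.+1%:R * rho s s' `^ alpha < `|f s - f s'|).
  set x := n.+1%:R * _ in hs.
  apply/nbhs_CSP; exists ((`|f s - f s'| - x) / 2); first by rewrite divr_gt0// subr_gt0.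
  move=> f' ff' [] _ /(_ s s') h; rewrite -/x in h.
  have := ff' s; have := ff' s'; move: h.
  have : `|f s - f s'| <= `|f s - f' s| + `|f' s - f' s'| + `|f s' - f' s'|.
    have -> : f s - f s' = (f s - f' s) + (f' s - f' s') - (f s' - f' s') by ring.
    by apply: le_trans (ler_normB _ _) _; rewrite lerD2r ler_normD.
  by lra.
exfalso; apply: nf; split=> [s|s s']; rewrite leNgt; apply/negP => hs.
  by apply: h1; exists s.
by apply: h2; exists s, s'.
Qed.

Definition levels : set (CS S) := \bigcup_n level n.

Lemma measurable_levels : measurable levels.
Proof. by apply: bigcupT_measurable => n; exact: measurable_level. Qed.

(** Partition of C(S) by the value of [hnorm]; the paths that are not Hölder
    continuous form the piece of rank 0. *)
Definition rank (k : nat) : set (CS S) :=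
  if k is n.+1 then level n `\` \bigcup_(m in [set m | (m < n)%N]) level m else ~` levels.

Lemma rank_ex f : exists k, rank k f.
Proof.
have [[n _ ln]|h] := pselect (levels f); last by exists 0%N.
have ex : exists n, `[< level n f >] by exists n; apply/asboolP.
case: (ex_minnP ex) => m /asboolP lm mmin; exists m.+1; split => // -[j /= jm lj].
by have := mmin j (introT (asboolP _) lj); rewrite leqNgt jm.
Qed.

Lemma rank_uniq j k f : rank j f -> rank k f -> j = k.
Proof.
have main i n : (i <= n)%N -> rank i f -> rank n f -> i = n.
  case: i n => [|i] [|n]//=; first by move=> _ h [ln _]; case: h; exists n.
  rewrite ltnS => le [li _] [_ hn]; congr _.+1; apply/eqP; rewrite eqn_leq le/= leqNgt.
  by apply/negP => lt; apply: hn; exists i.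
by case: (leqP j k) => [|/ltnW] le rj rk; [exact: main|exact/esym/main].
Qed.

Lemma measurable_rank k : measurable (rank k).
Proof.
case: k => [|n]; first by apply: measurableC; exact: measurable_levels.
apply: measurableD; first exact: measurable_level.
by apply: bigcup_measurable => m _; exact: measurable_level.
Qed.

Definition hnorm f : R := (projT1 (cid (rank_ex f)))%:R.

Lemma hnormE f : rank (projT1 (cid (rank_ex f))) f.
Proof. exact: projT2 (cid (rank_ex f)). Qed.

Lemma hnorm_ge0 f : 0 <= hnorm f. Proof. by []. Qed.

Lemma measurable_hnorm : measurable_fun setT hnorm.
Proof.
move=> _ A mA; rewrite setTI.
have -> : hnorm @^-1` A = \bigcup_k (if k%:R \in A then rank k else set0).
  apply/seteqP; split => f /=; rewrite /hnorm.
    by move=> Af; exists (projT1 (cid (rank_ex f))) => //; rewrite mem_set//; exact: hnormE.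
  move=> [k _]; case: ifP => // /set_mem kA rk.
  by rewrite -(rank_uniq rk (hnormE f)).
by apply: bigcupT_measurable => k; case: ifP => // _; exact: measurable_rank.
Qed.

Lemma hnorm_levels f : levels f ->
  [/\ 1 <= hnorm f, forall s, `|f s| <= hnorm f & hoelder alpha (hnorm f) f].
Proof.
move=> lf; rewrite /hnorm; move: (hnormE f); case: (projT1 _) => [//|n /= [[h1 h2] _]].
by split => //; rewrite ler1n.
Qed.

Lemma hnorm_le n f : level n f -> hnorm f <= n.+1%:R.
Proof.
move=> ln; rewrite /hnorm ler_nat; move: (hnormE f); case: (projT1 _) => [//|k /= [_ h]].
by rewrite ltnS leqNgt; apply/negP => nk; apply: h; exists n.
Qed.

End hoelder_norm.

Section power_bounds.
Context (R : realType).

Lemma exprD3_le (a b c : R) q : 0 <= a -> 0 <= b -> 0 <= c ->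
  (a + b + c) ^+ q <= 3 ^+ q * (a ^+ q + b ^+ q + c ^+ q).
Proof.
move=> a0 b0 c0; pose m := Num.max a (Num.max b c).
have m0 : 0 <= m by rewrite le_max a0.
have am : a <= m by rewrite le_max lexx.
have bm : b <= m by rewrite !le_max lexx orbT.
have cm : c <= m by rewrite !le_max lexx !orbT.
apply: (@le_trans _ _ ((3 * m) ^+ q)).
  by apply: lerXn2r; rewrite ?nnegrE ?addr_ge0 ?mulr_ge0//; lra.
rewrite exprMn ler_wpM2l ?exprn_ge0//.
have ha : 0 <= a ^+ q by rewrite exprn_ge0.
have hb : 0 <= b ^+ q by rewrite exprn_ge0.
have hc : 0 <= c ^+ q by rewrite exprn_ge0.
by rewrite /m; case: (leP a (Num.max b c)) => _; first case: (leP b c) => _; lra.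
Qed.

(** Both sides carry an additional factor M, so that the case q = 0 causes no
    exception. *)
Lemma expr_sub_le (M x y : R) q : `|x| <= M -> `|y| <= M ->
  M * `|x ^+ q - y ^+ q| <= q%:R * M ^+ q * `|x - y|.
Proof.
move=> xM yM; have M0 : 0 <= M := le_trans (normr_ge0 _) xM.
rewrite subrXX normrM mulrCA [leRHS]mulrC ler_wpM2l//.
case: q => [|q]; first by rewrite big_ord0 normr0 mulr0 mul0r.
rewrite exprS mulrCA ler_wpM2l//.
apply: le_trans (ler_norm_sum _ _ _) _.
apply: (@le_trans _ _ (\sum_(i < q.+1) M ^+ q)); last by rewrite sumr_const card_ord mulr_natl.
apply: ler_sum => i _; rewrite normrM !normrX /=.
have -> : M ^+ q = M ^+ (q - i) * M ^+ i by rewrite -exprD subnK// -ltnS.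
by apply: ler_pM; rewrite ?exprn_ge0//; apply: lerXn2r; rewrite ?nnegrE.
Qed.

End power_bounds.

Section envelope.
Context (R : realType) (D : nat) (S : set 'rV[R]_D).
Hypothesis cS : compact S.
Variables (s0 : S) (alpha : R).
Hypothesis alpha0 : 0 < alpha.
Context d (T : measurableType d) (P : probability T R) (X : {RV P >-> CS S}).
Variable p : nat.
Hypothesis p0 : (0 < p)%N.
Hypothesis Xh : Lp_hoelder P (2 * p) alpha X.
Hypothesis X2p : exists s : S, ('E_P[fun w => (X w s ^+ (2 * p))%R] < +oo)%E.
Local Notation hn := (hnorm alpha).
Local Notation levels := (@levels R D S alpha).

Let mX : measurable_fun setT X := measurable_funP X.

Let L1_finite (f : T -> R) : measurable_fun setT f -> (forall w, 0 <= f w) ->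
  ('E_P[f] < +oo)%E -> L1 P f.
Proof.
move=> mf f0; rewrite unlock => Ef; apply/L1P; split => //.
by rewrite (eq_integral (fun w => (f w)%:E)%E)// => w _; rewrite ger0_norm.
Qed.

Let meval (s : S) : measurable_fun setT (fun w => X w s).
Proof.
by apply: (measurableT_comp (f := fun f : CS S => f s)) => //; exact: measurable_eval.
Qed.

Definition irregular : set T := X @^-1` (~` levels).

Lemma measurable_irregular : measurable irregular.
Proof.
rewrite -[irregular]setTI; apply: mX => //; apply: measurableC; exact: measurable_levels.
Qed.

Let mhX q : measurable_fun setT (fun w => hn (X w) ^+ q).
Proof.
apply: measurable_funX; apply: measurableT_comp => //.
exact: measurable_hnorm.
Qed.

(** Where the Hölder bound with constant L holds, [hnorm] is at most
    |X(s1)| + L (Dl + 1) + 2, where Dl bounds the powers of the distances to s1; each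
    term has a moment of order 2p. *)
Lemma hnorm_moment : P irregular = 0%E /\ L1 P (fun w => hn (X w) ^+ (2 * p)).
Proof.
have [s1 Xs1] := X2p; have [L [L0 Lp [A [mA A0 hA]]]] := Xh.
have [Dl hDl] : exists Dl : R, forall s, `|rho s1 s `^ alpha| <= Dl.
  have [M hM] : exists M : R, forall s, `|rho s1 s| <= M.
    apply: compact_bounded_fun => //; apply/continuous_rhoP => s e e0; exists e => // s'.
    have := rho_triangle s1 s s'; have := rho_triangle s1 s' s; rewrite (rho_sym s' s).
    by rewrite ltr_norml => *; apply/andP; split; lra.
  exists (M `^ alpha) => s; rewrite ger0_norm ?powR_ge0//.
  have sM : rho s1 s <= M by exact: le_trans (ler_norm _) (hM s).
  by apply: ge0_ler_powR => //; rewrite ?nnegrE ?(ltW alpha0) ?rho_ge0 ?(le_trans (rho_ge0 s1 s)).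
have Dl0 : 0 <= Dl by exact: le_trans (normr_ge0 _) (hDl s1).
pose V w := `|X w s1| + L w * (Dl + 1) + 1.
have V0 w : 0 <= V w.
  by rewrite !addr_ge0// mulr_ge0 ?addr_ge0// ltW.
have lev w : ~ A w -> level alpha (Num.truncn (V w)) (X w).
  move=> nA.
  have h s s' : `|X w s - X w s'| <= L w * rho s s' `^ alpha.
    have h1 : forall s s' : S, `|X w s - X w s'| <= L w * euclid (val s - val s') `^ alpha.
      by apply: contrapT => nh; apply: nA; apply: hA.
    apply: le_trans (h1 s s') _; apply: ler_wpM2l; first exact/ltW.
    by apply: ge0_ler_powR; rewrite ?nnegrE ?(ltW alpha0) ?sqrtr_ge0 ?rho_ge0 ?euclid_le_rho.
  have Vt : V w <= (Num.truncn (V w)).+1%:R by rewrite ltW// truncnS_gt.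
  split=> [s|s s'].
    apply: le_trans Vt; have -> : X w s = X w s1 - (X w s1 - X w s) by ring.
    apply: le_trans (ler_normB _ _) _; rewrite /V -addrA lerD2l.
    apply: le_trans (h s1 s) _; rewrite mulrDr -addrA.
    apply: ler_wpDr; first by rewrite mulr1 addr_ge0// ltW.
    by apply: ler_wpM2l; [exact/ltW|exact: le_trans (ler_norm _) (hDl s)].
  apply: le_trans (h s s') _; apply: ler_wpM2r; first exact: powR_ge0.
  apply: le_trans Vt; rewrite /V mulrDr mulr1.
  have := mulr_ge0 (ltW (L0 w)) Dl0; have := normr_ge0 (X w s1).
  by move: (`|_|) (L w * Dl) => x y *; lra.
have irrA : irregular `<=` A.
  by move=> w nl; apply: contrapT => nA; apply: nl; exists (Num.truncn (V w)) => //; exact: lev.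
have mI := measurable_irregular.
split; first by apply: subset_measure0 irrA A0.
have L1X : L1 P (fun w => X w s1 ^+ (2 * p)).
  apply: L1_finite => // [|w]; first exact: measurable_funX.
  by rewrite exprM exprn_ge0// sqr_ge0.
have L1L : L1 P (fun w => L w ^+ (2 * p)).
  apply: L1_finite => // [|w]; last by rewrite exprn_ge0// ltW.
  by apply: measurable_funX; exact: measurable_funP.
pose B w := 3 ^+ (2 * p) * (X w s1 ^+ (2 * p) + (Dl + 2) ^+ (2 * p) * L w ^+ (2 * p) + 2 ^+ (2 * p)).
have B1 : L1 P B.
  by apply: L1Z; apply: L1D; [apply: L1D => //; exact: L1Z|exact: L1_cst].
apply: (L1_le_null mA A0 (mhX _) B1) => w nA.
rewrite ger0_norm ?exprn_ge0 ?hnorm_ge0//.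
have h1 : hn (X w) <= `|X w s1| + (Dl + 2) * L w + 2.
  apply: le_trans (hnorm_le (lev w nA)) _; rewrite -natr1.
  have := truncn_le (V w); rewrite V0 => h; apply: le_trans (lerD h (lexx 1)) _.
  rewrite /V; have := L0 w; move: (`|_|) (L w) => x y y0; lra.
apply: le_trans (_ : (`|X w s1| + (Dl + 2) * L w + 2) ^+ (2 * p) <= _).
  by apply: lerXn2r => //; rewrite nnegrE ?hnorm_ge0// (le_trans _ h1)// hnorm_ge0.
rewrite /B -exprMn.
have -> : X w s1 ^+ (2 * p) = `|X w s1| ^+ (2 * p) by rewrite !exprM real_normK ?num_real.
by apply: exprD3_le => //; rewrite mulr_ge0 ?addr_ge0// ltW.
Qed.

Let reg_null : P irregular = 0%E := hnorm_moment.1.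
Let hn2 : L1 P (fun w => hn (X w) ^+ (2 * p)) := hnorm_moment.2.

Let hn1 : L1 P (fun w => hn (X w) ^+ p).
Proof.
apply: (L1_le (mhX p) (L1D (L1_cst P 1) hn2)) => w.
rewrite mulnC exprM ger0_norm ?exprn_ge0 ?hnorm_ge0//.
move: (_ ^+ p) => x; have := sqr_ge0 (x - 1); have := sqr_ge0 x.
by rewrite sqrrB expr1n mulr1; lra.
Qed.

Definition hmean : R := mean P (fun w => hn (X w) ^+ p).

(** Envelope of the centred powers: the factor p comes from the Lipschitz constant
    of the powers, and [hmean] dominates the moments that are subtracted. *)
Definition bound (f : CS S) : R := p%:R * (hn f ^+ p + hmean).

Lemma hmean_ge0 : 0 <= hmean.
Proof. by apply: mean_ge0 => w; rewrite exprn_ge0// hnorm_ge0. Qed.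

Lemma bound_ge0 f : 0 <= bound f.
Proof. by rewrite mulr_ge0// addr_ge0 ?hmean_ge0// exprn_ge0// hnorm_ge0. Qed.

Lemma measurable_bound : measurable_fun setT bound.
Proof.
apply: measurable_funM => //; apply: measurable_funD => //; apply: measurable_funX.
exact: measurable_hnorm.
Qed.

Lemma L1_bound_sqr : L1 P (fun w => bound (X w) ^+ 2).
Proof.
pose G w := (p%:R ^+ 2 * 2) * (hn (X w) ^+ (2 * p) + hmean ^+ 2).
have G1 : L1 P G by apply: L1Z; apply: L1D => //; exact: L1_cst.
apply: (L1_le _ G1) => [|w].
  by apply: measurable_funX; apply: measurableT_comp => //; exact: measurable_bound.
rewrite ger0_norm ?sqr_ge0// /bound /G exprMn mulnC exprM -mulrA.
apply: ler_wpM2l; first exact: sqr_ge0.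
move: (hn (X w) ^+ p) hmean => a b; have := sqr_ge0 (a - b); rewrite sqrrB sqrrD; lra.
Qed.

Let regular w : ~ irregular w -> levels (X w).
Proof. by move=> h; apply: contrapT. Qed.

Let pow_le f (r : nat) s : (r <= p)%N -> levels f -> `|f s ^+ r| <= hn f ^+ p.
Proof.
move=> rp /hnorm_levels[h1 h2 _]; rewrite normrX.
apply: (@le_trans _ _ (hn f ^+ r)); last exact: ler_weXn2l.
by apply: lerXn2r; rewrite ?nnegrE ?hnorm_ge0.
Qed.

Let pow_hoelder f (r : nat) s s' : (r <= p)%N -> levels f ->
  `|f s ^+ r - f s' ^+ r| <= p%:R * hn f ^+ p * rho s s' `^ alpha.
Proof.
move=> rp /hnorm_levels[h1 h2 h3]; have hpos : 0 < hn f := lt_le_trans ltr01 h1.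
rewrite -(ler_pM2l hpos); apply: le_trans (expr_sub_le r (h2 s) (h2 s')) _.
apply: (@le_trans _ _ (r%:R * hn f ^+ r * (hn f * rho s s' `^ alpha))).
  by apply: ler_wpM2l; [rewrite mulr_ge0// exprn_ge0// hnorm_ge0|exact: h3].
rewrite mulrCA; apply: ler_wpM2l; first exact: hnorm_ge0.
apply: ler_wpM2r; first exact: powR_ge0.
by apply: ler_pM; rewrite ?exprn_ge0 ?hnorm_ge0 ?ler_nat//; exact: ler_weXn2l.
Qed.

Lemma L1_power (r : nat) s : (r <= p)%N -> L1 P (fun w => X w s ^+ r).
Proof.
move=> rp; apply: (L1_le_null measurable_irregular reg_null _ hn1) => [|w /regular Xw].
  exact: measurable_funX.
exact: pow_le.
Qed.

Lemma momentE (r : nat) s : (r <= p)%N -> moment P X r s = mean P (fun w => X w s ^+ r).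
Proof. by move=> rp; rewrite /moment (expectationE (L1_power s rp)). Qed.

Lemma L1_power2 (r r' : nat) s s' : (r <= p)%N -> (r' <= p)%N ->
  L1 P (fun w => X w s ^+ r * X w s' ^+ r').
Proof.
move=> rp rp'; apply: (L1_le_null measurable_irregular reg_null _ hn2) => [|w /regular Xw].
  by apply: measurable_funM; exact: measurable_funX.
by rewrite normrM mul2n -addnn exprD; apply: ler_pM => //; exact: pow_le.
Qed.

Lemma moment_le (r : nat) s : (r <= p)%N -> `|moment P X r s| <= hmean.
Proof.
move=> rp; rewrite momentE//.
apply: (mean_abs_le_null measurable_irregular reg_null (L1_power s rp) hn1) => w /regular Xw.
exact: pow_le.
Qed.

Lemma moment_hoelder (r : nat) : (r <= p)%N -> hoelder alpha (p%:R * hmean) (moment P X r).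
Proof.
move=> rp s s'; rewrite !momentE// -meanB; try exact: L1_power.
rewrite mulrAC -meanZ//.
apply: (mean_abs_le_null measurable_irregular reg_null _ (L1Z _ hn1)) => [|w /regular Xw].
  by apply: L1B; exact: L1_power.
by rewrite mulrAC; exact: pow_hoelder.
Qed.

Lemma bound_centered f (r : nat) s : (r <= p)%N -> levels f ->
  `|f s ^+ r - moment P X r s| <= bound f.
Proof.
move=> rp lf; apply: le_trans (ler_normB _ _) _.
apply: le_trans (lerD (pow_le s rp lf) (moment_le s rp)) _.
rewrite /bound; apply: ler_peMl; last by rewrite ler1n.
by rewrite addr_ge0 ?hmean_ge0// exprn_ge0// hnorm_ge0.
Qed.

Lemma bound_hoelder f (r : nat) : (r <= p)%N -> levels f ->
  hoelder alpha (bound f) (fun s => f s ^+ r - moment P X r s).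
Proof.
move=> rp lf s s'.
have -> : f s ^+ r - moment P X r s - (f s' ^+ r - moment P X r s') =
   (f s ^+ r - f s' ^+ r) - (moment P X r s - moment P X r s') by ring.
apply: le_trans (ler_normB _ _) _; rewrite /bound mulrDr mulrDl; apply: lerD.
  exact: pow_hoelder.
exact: moment_hoelder.
Qed.

End envelope.

(** * The Gaussian limit and the test functions *)

Section gaussian_marginals.
Context (R : realType) (D : nat) (S : set 'rV[R]_D).
Context d (T : measurableType d) (P : probability T R) (Z : {RV P >-> CS S}) (C : S -> S -> R).
Hypothesis ZC : zero_mean_gaussian_with_cov P Z C.

Lemma measurable_marginal s : measurable_fun setT (fun w => Z w s).
Proof.
apply: (measurableT_comp (f := fun f : CS S => f s)); last exact: measurable_funP.
exact: measurable_eval.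
Qed.

Let EZZ s s' : ('E_P[fun w => (Z w s * Z w s')%R])%E = (C s s')%:E.
Proof.
have [_ Z0 ZC2] := ZC; rewrite -ZC2 covariance.unlock !Z0 /=.
by apply: (congr1 (fun F => 'E_P[F])%E); apply/funext => w; rewrite /GRing.mul /= !subr0.
Qed.

Lemma L1_marginal_sqr s : L1 P (fun w => Z w s ^+ 2).
Proof.
apply/L1P; split; first by apply: measurable_funX; exact: measurable_marginal.
rewrite (eq_integral (fun w => (Z w s * Z w s)%:E)%E); last first.
  by move=> w _; rewrite ger0_norm ?sqr_ge0.
by have := EZZ s s; rewrite unlock => ->; rewrite ltry.
Qed.

Lemma L1_marginal_mul s s' : L1 P (fun w => Z w s * Z w s').
Proof.
apply: (L1_le _ (L1D (L1_marginal_sqr s) (L1_marginal_sqr s'))) => [|w].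
  by apply: measurable_funM; exact: measurable_marginal.
rewrite normrM -(real_normK (num_real (Z w s))) -(real_normK (num_real (Z w s'))).
move: `|Z w s| `|Z w s'| => x y.
have := sqr_ge0 (x - y); have := sqr_ge0 x; have := sqr_ge0 y; rewrite sqrrB; lra.
Qed.

Lemma mean_marginal_mul s s' : mean P (fun w => Z w s * Z w s') = C s s'.
Proof. by apply: EFin_inj; rewrite -EZZ expectationE//; exact: L1_marginal_mul. Qed.

Lemma L1_marginal s : L1 P (fun w => Z w s).
Proof. by apply: L1_sqrt; [exact: measurable_marginal|exact: L1_marginal_sqr]. Qed.

Lemma mean_marginal s : mean P (fun w => Z w s) = 0.
Proof.
have [_ Z0 _] := ZC.
by apply: EFin_inj; rewrite -expectationE; [exact: Z0|exact: L1_marginal].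
Qed.

Lemma marginal_char (I : finType) (pt : I -> S) (t : I -> R) th :
  mean P (fun w => cos (\sum_i t i * Z w (pt i) + th)) =
  cos th * expR (- ((\sum_i \sum_j t i * t j * C (pt i) (pt j)) / 2)).
Proof.
pose X w := \sum_i t i * Z w (pt i).
have tL i : L1 P (fun w => t i * Z w (pt i)) by apply: L1Z; exact: L1_marginal.
have X1 : L1 P X by apply: L1_sum.
have XE : X = fun w => \sum_(i < #|I|) t (enum_val i) * Z w (pt (enum_val i)).
  by apply/funext => w; rewrite /X (reindex _ (onW_bij _ (@enum_val_bij I))).
have XX : (fun w => X w ^+ 2) =1 fun w => \sum_i \sum_j t i * t j * (Z w (pt i) * Z w (pt j)).
  move=> w; rewrite expr2 /X big_distrlr /=; apply: eq_bigr => i _; apply: eq_bigr => j _; ring.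
have L2 i j : L1 P (fun w => t i * t j * (Z w (pt i) * Z w (pt j))).
  by apply: L1Z; exact: L1_marginal_mul.
have X2 : L1 P (fun w => X w ^+ 2).
  by apply: (eq_L1 (fsym XX)); apply: L1_sum => i _; apply: L1_sum => j _.
rewrite (@normal_rv_char _ _ _ P X (L1_measurable X1) th) //.
- rewrite (eq_mean P XX) mean_sum; last by move=> i _; apply: L1_sum.
  congr (_ * expR (- (_ / 2))); apply: eq_bigr => i _.
  rewrite mean_sum//; apply: eq_bigr => j _.
  by rewrite meanZ ?mean_marginal_mul//; exact: L1_marginal_mul.
- rewrite XE; have [gp _ _] := ZC; exact: (gp _ (fun i => pt (enum_val i)) (fun i => t (enum_val i))).
- rewrite /X mean_sum//; apply: big1 => i _.
  by rewrite meanZ ?mean_marginal ?mulr0//; exact: L1_marginal.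
Qed.

End gaussian_marginals.

Section lipschitz_tests.
Context (R : realType) (D : nat) (S : set 'rV[R]_D).
Hypothesis cS : compact S.
Variable s0 : S.

Lemma maxnorm_le (u : S -> R) (M : R) : (forall s, `|u s| <= M) -> maxnorm u <= M.
Proof.
move=> uM; apply: ge_sup; first by exists `|u s0|, s0.
by move=> _ [s _ <-].
Qed.

Lemma BL1_dist h (f f' : CS S) (M : R) : BL1 S h -> (forall s, `|f s - f' s| <= M) ->
  `|h f - h f'| <= M.
Proof. by move=> [_ hl] fM; apply: le_trans (hl f f') _; exact: maxnorm_le. Qed.

Lemma BL1_continuous h : BL1 S h -> continuous h.
Proof.
move=> hB f U /nbhs_ballP[e /= e0 eU]; apply/nbhs_CSP; exists (e / 2); first by rewrite divr_gt0.
move=> f' ff'; apply: eU; apply: (@le_lt_trans _ _ (e / 2)); last by lra.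
by apply: (BL1_dist hB) => s; exact/ltW/ff'.
Qed.

Lemma BL1_measurable h : BL1 S h -> measurable_fun setT h.
Proof. by move=> hB; apply: CS_continuous_measurable => //; exact: BL1_continuous. Qed.

Lemma BL1_L1 h d (T : measurableType d) (P : probability T R) (Z : T -> CS S) :
  BL1 S h -> measurable_fun setT Z -> L1 P (fun w => h (Z w)).
Proof.
move=> hB mZ; apply: (@L1_bounded _ _ _ _ _ 1) => [|w]; last exact: hB.1.
by apply: (measurableT_comp (f := h)) => //; exact: BL1_measurable.
Qed.

Lemma continuous_eval (s : S) : continuous (fun f : CS S => f s).
Proof.
move=> f U /nbhs_ballP[e /= e0 eU].
apply/nbhs_CSP; exists e => // f' ff'; apply: eU; exact: ff'.
Qed.

Local Notation "'rep'" := (@rep R D S cS s0 _).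

(** Almost all the mass of the law of Z lies on the paths that are close to their
    interpolation, and this set of paths does not depend on h. *)
Lemma interp_mean d (T : measurableType d) (P : probability T R) (Z : T -> CS S) (e : R) :
  measurable_fun setT Z -> 0 < e -> exists J0, forall J, (J0 <= J)%N -> forall h, BL1 S h ->
    `|mean P (fun w => h (interp s0 (fun c : cells cS J => Z w (rep c)))) -
      mean P (fun w => h (Z w))| <= e.
Proof.
move=> mZ e0; have e20 : 0 < e / 2 by rewrite divr_gt0.
pose gap J (s : S) (f : CS S) : R := f s - interp s0 (fun c : cells cS J => f (rep c)) s.
pose far J : set (CS S) := \bigcup_(s in [set: S]) [set f | e / 2 < `|gap J s f|].
have mfar J : measurable (far J).
  apply: sub_sigma_algebra; apply: bigcup_open => s _.
  rewrite (_ : [set f | _] = (fun f => `|gap J s f|) @^-1` `]e / 2, +oo[%classic); last first.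
    by apply/seteqP; split => f /=; rewrite in_itv/= andbT.
  apply: open_comp (interval_open _ _) => // f _.
  apply: (@continuous_comp _ _ _ (gap J s) (fun x : R => `|x|)); last exact: norm_continuous.
  apply: (@cvgB R R (CS S) (nbhs f) _ (fun f : CS S => f s)); first exact: (@continuous_eval s f).
  apply: (@continuous_sumR R (CS S) _ _ (fun (c : cells cS J) (f : CS S) => f (rep c) * unity s0 c s)) => c.
  by apply: continuous_mulR; [exact: continuous_eval|exact: cst_continuous].
pose m J w : R := 2 * \1_(Z @^-1` far J) w + e / 2.
have mm J : measurable_fun setT (m J).
  apply: measurable_funD => //; apply: measurable_funM => //; apply: measurable_indic.
  by rewrite -[X in measurable X]setTI; exact: mZ.
have mb J w : `|m J w| <= 2 + e / 2.
  rewrite /m indicE; case: (_ \in _); rewrite /= ?mulr1n ?mulr0n ger0_norm; lra.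
have mcv w : m n w @[n --> \oo] --> (e / 2 : R).
  have [J hJ] := interp_cvg cS s0 (Z w) e20.
  apply: cvg_near_cst; exists J => // j /= Jj; rewrite /m indicE memNset ?mulr0 ?add0r// => -[s _ /=].
  by rewrite ltNge hJ.
have [_] := @dominated_mean _ _ _ P m (fun=> e / 2) (fun=> 2 + e / 2) mm (L1_cst P _) mb mcv.
rewrite mean_cst => /cvgrPdist_le/(_ (e / 2) e20)[J0 _ hJ0]; exists J0 => J JJ h hB.
have mI : measurable_fun setT (fun w => interp s0 (fun c : cells cS J => Z w (rep c))).
  apply: CS_measurable => // s; rewrite /interp /mkcts /= /interp_fun.
  apply: measurable_sum => c; apply: measurable_funM => //.
  by apply: (measurableT_comp (f := fun f : CS S => f (rep c))) => //; exact: measurable_eval.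
rewrite -meanB; [|exact: BL1_L1|exact: BL1_L1].
apply: (@le_trans _ _ (mean P (m J))).
  apply: mean_abs_le => [| |w].
  - by apply: L1B; exact: BL1_L1.
  - exact: (@L1_bounded _ _ _ P (m J) (2 + e / 2) (mm J) (mb J)).
  rewrite /m indicE; case: (boolP (w \in _)) => [_|].
    rewrite mulr1; apply: ler_wpDr; first exact: ltW.
    apply: le_trans (ler_normB _ _) _; have [h1 _] := hB.
    by apply: le_trans (lerD (h1 _) (h1 _)) _.
  move=> /negP hn; rewrite mulr0 add0r distrC; apply: (BL1_dist hB) => s.
  rewrite leNgt; apply/negP => hs; apply: hn; rewrite inE; exists s => //.
have := hJ0 J JJ; rewrite /= distrC => /(le_trans (ler_norm _)); lra.
Qed.

End lipschitz_tests.

Section derivative_modulus.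
Context (R : realType) (D : nat) (S : set 'rV[R]_D).
Hypothesis cS : compact S.
Context (K : nat) (f : 'rV[R]_K -> 'rV[R]_K).
Hypothesis cf : continuous f.
Variable mu : 'I_K -> S -> R.
Hypothesis cmu : forall k, continuous (mu k).

Let row_mu s : 'rV[R]_K := \row_k mu k s.

Let near_mu s (e : R) : 0 < e -> \forall s' \near s, forall k, `|mu k s - mu k s'| < e.
Proof.
move=> e0; have nk k : \forall s' \near s, `|mu k s - mu k s'| < e.
  by have := @cmu k s _ (nbhsx_ballx (mu k s) e e0).
exact: (@filter_forall _ _ (fun k s' => `|mu k s - mu k s'| < e) (nbhs s) _ nk).
Qed.

Let nbhs_rowP (y : 'rV[R]_K) (U : set 'rV[R]_K) : nbhs y U ->
  exists2 e : R, 0 < e & forall y' : 'rV[R]_K, (forall k, `|y 0 k - y' 0 k| < e) -> U y'.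
Proof.
move=> /nbhs_ballP[e e0 eU]; exists e => // y' h; apply: eU; split => // i k.
by rewrite ord1; exact: h.
Qed.

(** Only the compact image of mu matters, so that continuity of f gives a modulus
    uniform in s, also for arguments y outside this image. *)
Lemma uniform_modulus (eta : R) : 0 < eta -> exists2 dl : R, 0 < dl &
  forall s (y : 'rV[R]_K), (forall k, `|y 0 k - mu k s| <= dl) ->
    forall k, `|f y 0 k - f (row_mu s) 0 k| <= eta.
Proof.
move=> eta0.
have : \forall dl \near (0 : R)^'+, forall s (y : 'rV[R]_K),
    (forall k, `|y 0 k - mu k s| <= dl) -> forall k, `|f y 0 k - f (row_mu s) 0 k| <= eta.
  apply: compact_near => // s.
  have : nbhs (f (row_mu s)) [set z | forall k, `|z 0 k - f (row_mu s) 0 k| < eta / 2].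
    apply/nbhs_ballP; exists (eta / 2); first by rewrite /= divr_gt0.
    by move=> z [_ hz] k; rewrite distrC; exact: (hz 0 k).
  move=> /cf /nbhs_rowP[e e0 he].
  have : \forall s' \near s, forall k, `|mu k s - mu k s'| < e / 2.
    by apply: near_mu; rewrite divr_gt0.
  move=> /nbhs_rhoP[e1 e10 h1]; exists e1 => //; near=> dl => s' ss' y hy k.
  have dle : dl < e / 2 by near: dl; apply: nbhs_right_lt; rewrite divr_gt0.
  have a1 : `|f y 0 k - f (row_mu s) 0 k| < eta / 2.
    apply: he => l; rewrite mxE -(subrKA (mu l s')); apply: le_lt_trans (ler_normD _ _) _.
    have := h1 s' ss' l; have := hy l; rewrite [in X in _ -> _ -> X](distrC (mu l s') (y 0 l)); lra.
  have a2 : `|f (row_mu s') 0 k - f (row_mu s) 0 k| < eta / 2.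
    by apply: he => l; rewrite !mxE; have := h1 s' ss' l; lra.
  rewrite -(subrKA (f (row_mu s) 0 k)); apply: le_trans (ler_normD _ _) _.
  by rewrite [ `|f (row_mu s) _ _ - _| ]distrC; lra.
move=> [/= r r0 hr]; exists (r / 2); first by rewrite divr_gt0.
by apply: hr; rewrite /=; [rewrite sub0r normrN gtr0_norm; lra|lra].
Unshelve. all: by end_near. Qed.

Lemma continuous_comp_row k : continuous (fun s => f (row_mu s) 0 k).
Proof.
apply/continuous_rhoP => s e e0; have e20 : 0 < e / 2 by rewrite divr_gt0.
have [dl dl0 h] := uniform_modulus e20.
have /nbhs_rhoP := near_mu s dl0.
move=> [e1 e10 h1]; exists e1 => // s' ss'; rewrite distrC.
apply: le_lt_trans (h s (row_mu s') _ k) _; last by lra.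
by move=> l; rewrite mxE distrC; apply/ltW/h1.
Qed.

End derivative_modulus.

(** * The multiplier bootstrap for a fixed sample *)

Section multiplier_bootstrap.
Context (R : realType) (D : nat) (S : set 'rV[R]_D).
Hypothesis cS : compact S.
Variables (s0 : S) (alpha : R).
Hypothesis alpha0 : 0 < alpha.
Context d (T : measurableType d) (P : probability T R).
Context (I : choiceType) (Y : I -> T -> R).
Hypothesis Y1 : forall i, L1 P (Y i).
Hypothesis Y0 : forall i, mean P (Y i) = 0.
Hypothesis Y2 : forall i, L1 P (fun w => Y i w ^+ 2).
Hypothesis Yvar : forall i, mean P (fun w => Y i w ^+ 2) = 1.
Hypothesis indepY : mutually_independent P Y.
Hypothesis Ylind : forall e : R, 0 < e -> exists2 dl0 : R, 0 < dl0 &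
  forall dl : R, 0 < dl <= dl0 -> forall i,
    mean P (fun w => Y i w ^+ 2 * Num.min 1 (dl * `|Y i w|)) <= e.
Context d' (T' : measurableType d') (P' : probability T' R) (Gt : {RV P' >-> CS S}).
Variable C : S -> S -> R.
Hypothesis GtC : zero_mean_gaussian_with_cov P' Gt C.
Context (K : nat) (H : 'rV[R]_K -> R) (HC1 : C1 H) (r : 'I_K -> nat) (mu : 'I_K -> S -> R).
Hypothesis cmu : forall k, continuous (mu k).
Local Notation rep := (@rep R D S cS s0 _).

Definition slope k (s : S) : R := dH H (\row_l mu l s) 0 k.

Definition resid N (x : 'I_N -> CS S) n s : R := \sum_k slope k s * (x n s ^+ r k - mu k s).

(** What the sample must satisfy; J is the level of the net on which the
    covariances are compared. *)
Record typical (J : nat) (dl Q : R) N (x : 'I_N -> CS S) (b : 'I_N -> R) : Prop := Typical {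
  typical_ge0 : forall n, 0 <= b n;
  typical_le : forall n k s, `|x n s ^+ r k - mu k s| <= b n;
  typical_hoelder : forall n k, hoelder alpha (b n) (fun s => x n s ^+ r k - mu k s);
  typical_sqr : N%:R^-1 * \sum_(n < N) b n ^+ 2 <= Q;
  typical_max : forall n, b n <= dl * Num.sqrt N%:R;
  typical_cov : forall c c' : cells cS J,
    `|N%:R^-1 * (\sum_(n < N) resid x n (rep c) * resid x n (rep c')) - C (rep c) (rep c')| <= dl;
  typical_mean : forall k s, `|emp_moment x (r k) s - mu k s| <= dl }.

Let cslope k : continuous (slope k).
Proof. exact: (@continuous_comp_row _ _ _ cS _ _ HC1.2 _ cmu k). Qed.

Lemma slope_bound : exists2 B : R, 0 <= B & forall k s, `|slope k s| <= B.
Proof.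
have /choice[M hM] : forall k, exists M : R, forall s, `|slope k s| <= M.
  by move=> k; exact: compact_bounded_fun.
exists (\sum_k `|M k|) => [|k s]; first exact: sumr_ge0.
apply: le_trans (hM k s) _; apply: le_trans (ler_norm _) _.
by rewrite (bigD1 k)//= lerDl sumr_ge0.
Qed.

Lemma slope_modulus (om : R) : 0 < om -> exists J0, forall J, (J0 <= J)%N ->
  forall k s s', rho s s' < 2 * mesh R J -> `|slope k s - slope k s'| <= om.
Proof.
move=> om0.
have /choice[J hJ] : forall k, exists J0, forall J, (J0 <= J)%N ->
    forall s s', rho s s' < 2 * mesh R J -> `|slope k s - slope k s'| <= om.
  move=> k; have [dl dl0 h] := heine_cantor cS (@cslope k) om0.
  have [J0 hJ0] := mesh_small (divr_gt0 dl0 (ltr0n _ 2)).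
  exists J0 => J JJ s s' ss'; apply/ltW/h; apply: lt_trans ss' _.
  by have := hJ0 J JJ; lra.
exists (\max_k J k)%N => J1 JJ k; apply: hJ; apply: leq_trans JJ; exact: leq_bigmax.
Qed.

Section sample.
Context (N : nat) (x : 'I_N -> CS S) (emb : 'I_N -> I).
Hypothesis N0 : (0 < N)%N.
Local Notation sN := (Num.sqrt N%:R : R).

Let sN0 : 0 < sN. Proof. by rewrite sqrtr_gt0 ltr0n. Qed.

Definition scaled k (n : 'I_N) (s : S) : R := (x n s ^+ r k - mu k s) / sN.

(** The normalised sum of the multipliers: it multiplies the error of the empirical
    moments in the bootstrap process. *)
Definition total w : R := \sum_(n < N) Y (emb n) w * sN^-1.

Lemma bootstrap_decomp w s :
  bootstrap r x HC1 (fun n => Y (emb n) w) s =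
  \sum_k dH H (emp_moments r x s) 0 k *
    (msum Y emb (scaled k) w s - (emp_moment x (r k) s - mu k s) * total w).
Proof.
rewrite -[LHS]/(bootstrap_fun H r x (fun n => Y (emb n) w) s) /bootstrap_fun mulr_sumr.
under [RHS]eq_bigr => k _.
  rewrite /msum /total mulr_sumr -sumrB mulr_sumr; over.
rewrite exchange_big /=; apply: eq_bigr => n _.
rewrite /delta_residual mxE !mulr_sumr; apply: eq_bigr => k _.
by rewrite !mxE /scaled; ring.
Qed.

Lemma L1_total : L1 P total.
Proof.
by apply: L1_sum => n _; apply: eq_L1 (L1Z sN^-1 (Y1 (emb n))) => w; rewrite mulrC.
Qed.

Lemma mean_abs_total : injective emb -> mean P (fun w => `|total w|) <= 1.
Proof.
move=> ie; have [t2 m2] := psum_sqr Y1 Y0 Y2 Yvar indepY ie (fun=> sN^-1) (leqnn N).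
have E w : psum Y emb (fun=> sN^-1) N w = total w by rewrite psum_full.
have {}t2 : L1 P (fun w => total w ^+ 2) by apply: eq_L1 t2 => w; rewrite E.
have {}m2 : mean P (fun w => total w ^+ 2) = 1.
  rewrite -(@eq_mean _ _ _ P _ _ (fun w => congr1 (fun y => y ^+ 2) (E w))) m2.
  rewrite (eq_bigl xpredT) => [|n]; last by rewrite ltn_ord.
  rewrite sumr_const card_ord -[LHS]mulr_natr exprVn sqr_sqrtr ?ler0n// mulVf//.
  by rewrite pnatr_eq0 -lt0n.
by apply: le_trans (mean_abs_le_sqr L1_total t2) _; rewrite m2; lra.
Qed.

Lemma measurable_bootstrap :
  measurable_fun setT (fun w => bootstrap r x HC1 (fun n => Y (emb n) w)).
Proof.
apply: CS_measurable => // s; rewrite (_ : (fun w => _) = fun w => bootstrap_fun H r x (fun n => Y (emb n) w) s)//.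
apply: measurable_funM => //; apply: measurable_sum => n; apply: measurable_funM => //.
exact: L1_measurable.
Qed.

End sample.

(** Three terms of size e/2, e/4 and e/4: the interpolation error of the bootstrap
    process, the central limit theorem on the net, and the interpolation error of the
    Gaussian process. The level J is chosen first, by [chaining] and [interp_mean],
    and dl afterwards, since the threshold of [fd_clt] depends on the net. *)
Theorem bootstrap_close (e Q : R) : 0 < e -> 0 <= Q ->
  exists J : nat, exists2 dl : R, 0 < dl &
    forall N (x : 'I_N -> CS S) (b : 'I_N -> R) (emb : 'I_N -> I),
      (0 < N)%N -> injective emb -> typical J dl Q x b ->
      forall h, BL1 S h ->
        `|mean P (fun w => h (bootstrap r x HC1 (fun n => Y (emb n) w))) -
          mean P' (fun w => h (Gt w))| <= e.
Proof.
move=> e0 Q0.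
have [B B0 hB] := slope_bound.
have [C0 C00 chain] := @chaining _ _ _ cS s0 _ alpha0 _ _ _ _ _ Y1 Y0 Y2 Yvar indepY.
pose A := K%:R * (C0 * (1 + Q)) + 1.
have A0 : 0 < A by rewrite ltr_wpDl// !mulr_ge0// addr_ge0.
pose om := e / 12 / A.
have om0 : 0 < om by rewrite !divr_gt0.
have [J1 hJ1] := slope_modulus om0.
have [J2 hJ2] : exists J2, forall J, (J2 <= J)%N -> B * kappa alpha ^+ J <= om.
  have : B * kappa alpha ^+ j @[j --> \oo] --> (B * 0 : R).
    apply: cvgM; first exact: cvg_cst.
    by apply: cvg_expr; case/andP: (kappa01 alpha0) => k0 k1; rewrite ger0_norm// ltW.
  rewrite mulr0 => /cvgrPdist_le/(_ om om0)[J2 _ hJ2]; exists J2 => J JJ.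
  by have := hJ2 J JJ; rewrite /= sub0r normrN; exact: le_trans (ler_norm _).
have e40 : 0 < e / 4 by rewrite divr_gt0.
have [J3 hJ3] := @interp_mean _ _ _ cS s0 _ _ P' Gt _ (measurable_funP Gt) e40.
pose J := maxn J1 (maxn J2 J3); exists J.
have {}hJ1 := hJ1 J (leq_maxl _ _).
have {}hJ2 : B * kappa alpha ^+ J <= om by apply: hJ2; rewrite !leq_max leqnn orbT.
have {}hJ3 := hJ3 J (leq_trans (leq_maxr _ _) (leq_maxr _ _)).
have [dl1 dl10 clt] := @fd_clt _ _ _ _ _ _ Y1 Y0 Y2 Yvar indepY Ylind _ _ P' (cells cS J)
  (fun c w => Gt w (rep c)) (fun c c' => C (rep c) (rep c'))
  (fun c => L1_marginal_sqr GtC (rep c))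
  (fun c => mean_marginal_mul GtC (rep c) (rep c))
  (fun c => @measurable_marginal _ _ _ _ _ P' Gt (rep c))
  (fun t th => marginal_char GtC (fun c : cells cS J => rep c) t th) _ e40.
pose eta := Num.min 1 om.
have eta0 : 0 < eta by rewrite lt_min ltr01.
have eta1 : eta <= 1 by rewrite ge_min lexx.
have etaom : eta <= om by rewrite ge_min lexx orbT.
have [dl2 dl20 hdl2] := @uniform_modulus _ _ _ cS _ _ HC1.2 _ cmu _ eta0.
pose K1 := K%:R * (B + 1) + 1 : R.
have K10 : 0 < K1 by rewrite ltr_wpDl// mulr_ge0// addr_ge0.
pose dl := Num.min (Num.min dl1 dl2) (Num.min (e / 4 / K1) (dl1 / K1)).
exists dl; first by rewrite !lt_min dl10 dl20 !divr_gt0.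
have dlpos : 0 < dl by rewrite !lt_min dl10 dl20 !divr_gt0.
have dldl1 : dl <= dl1 by rewrite !ge_min lexx.
have dldl2 : dl <= dl2 by rewrite !ge_min lexx orbT.
have dle : K1 * dl <= e / 4 by rewrite mulrC -ler_pdivlMr// !ge_min lexx !orbT.
have dlK : K1 * dl <= dl1 by rewrite mulrC -ler_pdivlMr// !ge_min lexx !orbT.
move=> N x b emb N0 ie [b0 xb xh bQ bmax xcov xmean] h hh.
set sN := Num.sqrt N%:R : R in bmax.
have sN0 : 0 < sN by rewrite sqrtr_gt0 ltr0n.
have sN2 : sN ^- 2 = N%:R^-1 by rewrite sqr_sqrtr ?ler0n.
(* G is the bootstrap process with the true moments in place of the empirical
   ones, and poly its interpolation from the net. *)
pose b' n := b n / sN.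
pose v k n s := scaled x k n s.
pose U k w s := msum Y emb (v k) w s.
pose G w s := \sum_k slope k s * U k w s.
have b'0 n : 0 <= b' n by rewrite divr_ge0// ltW.
have b'Q : \sum_(n < N) b' n ^+ 2 <= Q.
  apply: le_trans bQ; rewrite mulr_sumr; apply: ler_sum => n _.
  by rewrite /b' expr_div_n sN2 mulrC.
have vb k n s : `|v k n s| <= b' n.
  by rewrite /v /scaled -/sN normrM [ `|sN^-1| ]gtr0_norm ?invr_gt0// ler_pM2r ?invr_gt0.
have vh k n : hoelder alpha (b' n) (v k n).
  move=> s s'; rewrite /v /scaled -/sN -mulrBl normrM [ `|sN^-1| ]gtr0_norm ?invr_gt0//.
  by rewrite /b' mulrAC ler_pM2r ?invr_gt0//; exact: xh.
have chn := fun k => chain N emb (v k) b' ie b'0 (vh k) (vb k).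
have /choice[Osc hOsc] : forall k, exists O : T -> R, (L1 P O /\ mean P O <= C0 * kappa alpha ^+ J * (1 + Q)) /\
    forall w s (c : cells cS J), rho s (rep c) < 2 * mesh R J -> `|U k w s - U k w (rep c)| <= O w.
  move=> k; have [ob [h1 h2] h3] := (chn k).1 J; exists ob; split => //; split => //.
  apply: le_trans h2 _; apply: ler_wpM2l; last by rewrite lerD2l.
  by rewrite mulr_ge0// exprn_ge0//; case/andP: (kappa01 alpha0) => /ltW.
have /choice[Sup hSup] : forall k, exists O : T -> R, (L1 P O /\ mean P O <= C0 * (1 + Q)) /\
    forall w s, `|U k w s| <= O w.
  move=> k; have [ob [h1 h2] h3] := (chn k).2; exists ob; split => //; split => //.
  by apply: le_trans h2 _; apply: ler_wpM2l => //; rewrite lerD2l.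
have Sup0 k w : 0 <= Sup k w by exact: le_trans (normr_ge0 _) ((hSup k).2 w s0).
pose W w := total emb w.
pose boot w := bootstrap r x HC1 (fun n => Y (emb n) w).
pose poly w := interp s0 (fun c : cells cS J => G w (rep c)).
have boot_G w s : `|boot w s - G w s| <= \sum_k (eta * Sup k w + (B + 1) * dl * `|W w|).
  rewrite /boot bootstrap_decomp /G -sumrB.
  apply: le_trans (ler_norm_sum _ _ _) _; apply: ler_sum => k _.
  set p := dH H _ 0 k; have pq : `|p - slope k s| <= eta.
    by apply: hdl2 => l; rewrite mxE; exact: le_trans (xmean l s) dldl2.
  have pB : `|p| <= B + 1.
    rewrite -[p](subrK (slope k s)) addrC; apply: le_trans (ler_normD _ _) _.
    by apply: lerD; [exact: hB|exact: le_trans pq eta1].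
  rewrite -/(v k) -/(U k w s) -/(W w).
  have -> : p * (U k w s - (emp_moment x (r k) s - mu k s) * W w) - slope k s * U k w s =
    (p - slope k s) * U k w s - p * (emp_moment x (r k) s - mu k s) * W w by ring.
  apply: le_trans (ler_normB _ _) _; rewrite !normrM; apply: lerD.
    by apply: ler_pM => //; exact: (hSup k).2.
  by apply: ler_wpM2r => //; apply: ler_pM => //; exact: xmean.
(* The increments of slope times U are split between the two factors. *)
have prodB (y z y' z' : R) : y * z - y' * z' = y * (z - z') + (y - y') * z' by ring.
have G_poly w s : `|G w s - poly w s| <= \sum_k (B * Osc k w + om * Sup k w).
  apply: interp_close => c sc; rewrite /G -sumrB.
  apply: le_trans (ler_norm_sum _ _ _) _; apply: ler_sum => k _.
  rewrite prodB.
  apply: le_trans (ler_normD _ _) _; rewrite !normrM; apply: lerD; apply: ler_pM => //.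
  - exact: (hOsc k).2.
  - exact: hJ1.
  - exact: (hSup k).2.
pose M w := \sum_k ((B * Osc k w + (om + eta) * Sup k w) + (B + 1) * dl * `|W w|).
have boot_poly w s : `|boot w s - poly w s| <= M w.
  rewrite -(subrKA (G w s)); apply: le_trans (ler_normD _ _) _.
  apply: le_trans (lerD (boot_G w s) (G_poly w s)) _.
  by rewrite -big_split /=; apply: ler_sum => k _; lra.
have WL : L1 P (fun w => `|W w|) by apply: L1_abs; exact: L1_total.
have WE : mean P (fun w => `|W w|) <= 1 by exact: mean_abs_total.
have SupL k : L1 P (fun w => (om + eta) * Sup k w) by apply: L1Z; exact: (hSup k).1.1.
have OscL k : L1 P (fun w => B * Osc k w) by apply: L1Z; exact: (hOsc k).1.1.
have OSL k : L1 P (fun w => B * Osc k w + (om + eta) * Sup k w) by exact: L1D.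
have WLk : L1 P (fun w => (B + 1) * dl * `|W w|) by exact: L1Z.
have ML : L1 P M by apply: L1_sum => k _; exact: L1D.
have ME : mean P M <= e / 2.
  rewrite /M mean_sum; last by move=> k _; exact: L1D.
  apply: (@le_trans _ _ (\sum_(k < K) (3 * om * (C0 * (1 + Q)) + (B + 1) * dl))).
    apply: ler_sum => k _; rewrite meanD// meanD// !meanZ//; first last.
    - exact: (hOsc k).1.1.
    - exact: (hSup k).1.1.
    have CQ : 0 <= C0 * (1 + Q) by rewrite mulr_ge0// addr_ge0.
    have a1 : B * mean P (Osc k) <= om * (C0 * (1 + Q)).
      apply: le_trans (ler_wpM2l B0 (hOsc k).1.2) _.
      have -> : B * (C0 * kappa alpha ^+ J * (1 + Q)) = B * kappa alpha ^+ J * (C0 * (1 + Q)) by ring.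
      exact: ler_wpM2r.
    have a2 : (om + eta) * mean P (Sup k) <= (om + om) * (C0 * (1 + Q)).
      apply: ler_pM => //.
      - by rewrite addr_ge0// ltW.
      - exact: mean_ge0.
      - by rewrite lerD2l.
      - exact: (hSup k).1.2.
    have a3 : (B + 1) * dl * mean P (fun w => `|W w|) <= (B + 1) * dl.
      by apply: ler_piMr => //; rewrite mulr_ge0 ?addr_ge0// ltW.
    lra.
  rewrite sumr_const card_ord -[leLHS]mulr_natl.
  have b1 : K%:R * (om * (C0 * (1 + Q))) <= e / 12.
    have -> : e / 12 = om * A by rewrite /om divfK// gt_eqF.
    by rewrite [leLHS]mulrCA; apply: ler_wpM2l; [exact: ltW|rewrite /A lerDl].
  have b2 : K%:R * ((B + 1) * dl) <= e / 4.
    by apply: le_trans dle; rewrite mulrA; apply: ler_wpM2r; [exact: ltW|rewrite /K1 lerDl].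
  by lra.
have mboot : measurable_fun setT boot by exact: measurable_bootstrap.
pose a (c : cells cS J) n := resid x n (rep c) / sN.
have GE w c : G w (rep c) = zeta Y emb a w c.
  rewrite /G /zeta; under eq_bigr => k _ do rewrite /U /msum mulr_sumr.
  rewrite exchange_big; apply: eq_bigr => n _; rewrite /a /resid mulr_suml mulr_sumr.
  by apply: eq_bigr => k _; rewrite /v /scaled -/sN; ring.
have polyE w : poly w = interp s0 (zeta Y emb a w).
  by rewrite /poly; congr interp; apply/funext => c; exact: GE.
have mpoly : measurable_fun setT poly.
  apply: CS_measurable => // s; rewrite /poly /interp /mkcts /= /interp_fun.
  apply: measurable_sum => c; apply: measurable_funM => //.
  rewrite (_ : (fun w => _) = fun w => zeta Y emb a w c); last by apply/funext.
  by apply: measurable_sum => n; apply: measurable_funM => //; exact: L1_measurable.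
have hbp : `|mean P (fun w => h (boot w)) - mean P (fun w => h (poly w))| <= e / 2.
  have l1 : L1 P (fun w => h (boot w)) by exact: BL1_L1.
  have l2 : L1 P (fun w => h (poly w)) by exact: BL1_L1.
  rewrite -meanB//; apply: le_trans ME; apply: mean_abs_le => //; first exact: L1B.
  by move=> w; apply: (BL1_dist s0 hh) => s; exact: boot_poly.
have hclt : `|mean P (fun w => h (poly w)) -
    mean P' (fun w => h (interp s0 (fun c : cells cS J => Gt w (rep c))))| <= e / 4.
  rewrite (_ : (fun w => h (poly w)) = fun w => h (interp s0 (zeta Y emb a w))); last first.
    by apply/funext => w; rewrite polyE.
  apply: (clt N emb a ie _ (fun z => h (interp s0 z))) => //.
  - split=> [c n|c c'].
      rewrite /a normrM [ `|sN^-1| ]gtr0_norm ?invr_gt0// ler_pdivrMr//.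
      rewrite /resid; apply: le_trans (ler_norm_sum _ _ _) _.
      apply: (@le_trans _ _ (\sum_(k < K) B * (dl * sN))).
        apply: ler_sum => k _; rewrite normrM; apply: ler_pM => //.
        exact: le_trans (xb n k _) (bmax n).
      rewrite sumr_const card_ord -[leLHS]mulr_natl !mulrA; apply: ler_wpM2r; first exact: ltW.
      apply: le_trans dlK; apply: ler_wpM2r; first exact: ltW.
      by rewrite /K1 mulrDr; have := ler0n R K; lra.
    apply: le_trans dldl1; apply: le_trans (xcov c c').
    rewrite le_eqVlt; apply/orP; left; apply/eqP; congr (`| _ - _ |).
    rewrite mulr_sumr; apply: eq_bigr => n _; rewrite /a -sN2; field.
    by rewrite gt_eqF.
  - by move=> z; exact: hh.1.
  move=> z z'; apply: (BL1_dist s0 hh) => s; exact: interp_lip.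
rewrite -(subrKA (mean P (fun w => h (poly w)))); apply: le_trans (ler_normD _ _) _.
rewrite -(subrKA (mean P' (fun w => h (interp s0 (fun c : cells cS J => Gt w (rep c)))))
  (mean P (fun w => h (poly w)))).
have h3 := hJ3 h hh.
apply: le_trans (lerD hbp (le_trans (ler_normD _ _) (lerD hclt h3))) _; lra.
Qed.

End multiplier_bootstrap.

(** * From bounded Lipschitz to bounded continuous tests *)

Section portmanteau.
Context (R : realType) (D : nat) (S : set 'rV[R]_D).
Hypothesis cS : compact S.
Variable s0 : S.

Definition dist (f f' : CS S) : R := maxnorm (fun s => f s - f' s).

Lemma dist_ge (f f' : CS S) s : `|f s - f' s| <= dist f f'.
Proof.
apply: ub_le_sup; last by exists s.
have [M hM] := compact_bounded_fun cS (@cts_fun _ _ f).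
have [M' hM'] := compact_bounded_fun cS (@cts_fun _ _ f').
exists (M + M') => _ [s' _ <-]; apply: le_trans (ler_normB _ _) _; exact: lerD.
Qed.

Lemma dist_refl f : dist f f = 0.
Proof.
apply/eqP; rewrite eq_le; apply/andP; split.
  by apply: maxnorm_le => // s; rewrite subrr normr0.
by apply: le_trans (dist_ge f f s0); rewrite normr_ge0.
Qed.

Lemma dist_ge0 f f' : 0 <= dist f f'.
Proof. exact: le_trans (normr_ge0 _) (dist_ge f f' s0). Qed.

Lemma dist_triangle f f' f'' : dist f f'' <= dist f f' + dist f' f''.
Proof.
apply: maxnorm_le => // s; rewrite -(subrKA (f' s)); apply: le_trans (ler_normD _ _) _.
by apply: lerD; exact: dist_ge.
Qed.

Lemma dist_sym f f' : dist f f' = dist f' f.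
Proof.
by apply/eqP; rewrite eq_le; apply/andP; split; apply: maxnorm_le => // s; rewrite distrC dist_ge.
Qed.

Section regularization.
Variables (h : CS S -> R) (M : R).
Hypothesis hM : forall f, `|h f| <= M.
Hypothesis ch : continuous h.

(** Lipschitz regularisation from below: it increases to h pointwise by continuity,
    which suffices for dominated convergence. *)
Definition infconv (k : nat) (f : CS S) : R := inf (range (fun f' => h f' + k%:R * dist f f')).

Let lower k f : forall y, range (fun f' => h f' + k%:R * dist f f') y -> - M <= y.
Proof.
move=> _ [f' _ <-]; apply: ler_wpDr; first by rewrite mulr_ge0// dist_ge0.
by have := hM f'; rewrite ler_norml => /andP[].
Qed.

Let infconv_lb k f f' : infconv k f <= h f' + k%:R * dist f f'.
Proof. by apply: ge_inf; [exists (- M); exact: lower|exists f']. Qed.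

Let infconv_glb k f y : (forall f', y <= h f' + k%:R * dist f f') -> y <= infconv k f.
Proof.
by move=> hy; apply: lb_le_inf; [exists (h f + k%:R * dist f f), f|move=> _ [f' _ <-]].
Qed.

Lemma infconv_le k f : infconv k f <= h f.
Proof. by have := infconv_lb k f f; rewrite dist_refl mulr0 addr0. Qed.

Lemma infconv_bounded k f : `|infconv k f| <= M.
Proof.
have := hM f; rewrite !ler_norml => /andP[h1 h2]; apply/andP; split.
  by apply: infconv_glb => f'; apply: lower; exists f'.
exact: le_trans (infconv_le k f) h2.
Qed.

Lemma infconv_lip k f f' : `|infconv k f - infconv k f'| <= k%:R * dist f f'.
Proof.
have main f1 f2 : infconv k f1 - infconv k f2 <= k%:R * dist f1 f2.
  rewrite lerBlDr -lerBlDl; apply: infconv_glb => f3; rewrite lerBlDr.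
  apply: le_trans (infconv_lb k f1 f3) _; rewrite -addrA lerD2l -mulrDr.
  by apply: ler_wpM2l => //; rewrite addrC; exact: dist_triangle.
rewrite ler_norml main andbT lerNl opprB; apply: le_trans (main f' f) _.
by rewrite dist_sym.
Qed.

Lemma infconv_cvg f : infconv k f @[k --> \oo] --> h f.
Proof.
apply/cvgrPdist_le => e e0.
have /nbhs_CSP[dl dl0 hdl] : nbhs f [set f' | `|h f - h f'| < e].
  by have := @ch f _ (nbhsx_ballx (h f) e e0).
near=> k; rewrite ger0_norm ?subr_ge0 ?infconv_le// lerBlDr addrC -lerBlDr.
apply: infconv_glb => f'; have [ff'|ff'] := ltP (dist f f') dl.
  have : `|h f - h f'| < e by apply: hdl => s; exact: le_lt_trans (dist_ge f f' s) ff'.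
  rewrite ltr_norml => /andP[_ h1]; have : 0 <= k%:R * dist f f' by rewrite mulr_ge0// dist_ge0.
  by lra.
have k1 : 2 * M / dl <= k%:R by near: k; exact: nbhs_infty_ger.
have : 2 * M <= k%:R * dist f f'.
  by apply: le_trans (ler_wpM2l (ler0n _ k) ff'); rewrite -ler_pdivrMr.
have := hM f; have := hM f'; rewrite !ler_norml => /andP[a1 a2] /andP[a3 a4]; lra.
Unshelve. all: by end_near. Qed.

Lemma infconv_BL1 k : BL1 S (fun f => infconv k f / (M + k%:R + 1)).
Proof.
have M0 : 0 <= M by exact: le_trans (normr_ge0 _) (hM point).
have p0 : 0 < M + k%:R + 1 by rewrite ltr_wpDl// addr_ge0.
split=> [f|f f'].
  rewrite normrM [ `|_^-1| ]gtr0_norm ?invr_gt0// ler_pdivrMr// mul1r.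
  by apply: le_trans (infconv_bounded k f) _; have := ler0n R k; lra.
rewrite -mulrBl normrM [ `|_^-1| ]gtr0_norm ?invr_gt0// ler_pdivrMr//.
apply: le_trans (infconv_lip k f f') _; rewrite mulrC; apply: ler_wpM2l; first exact: dist_ge0.
by lra.
Qed.

End regularization.

Context d (T : measurableType d) (P : probability T R).
Context d' (T' : measurableType d') (P' : probability T' R).
Variables (Y : nat -> T -> CS S) (Z : T' -> CS S).
Hypothesis mY : forall N, measurable_fun setT (Y N).
Hypothesis mZ : measurable_fun setT Z.
Hypothesis cvgBL1 : forall h, BL1 S h -> forall e : R, 0 < e -> exists N0, forall N, (N0 <= N)%N ->
  `|mean P (fun w => h (Y N w)) - mean P' (fun w => h (Z w))| <= e.

Let L1_test (h : CS S -> R) (M : R) d1 (T1 : measurableType d1) (P1 : probability T1 R) (V : T1 -> CS S) :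
  continuous h -> (forall f, `|h f| <= M) -> measurable_fun setT V -> L1 P1 (fun w => h (V w)).
Proof.
move=> ch hM mV; apply: (@L1_bounded _ _ _ _ _ M) => [|w]; last exact: hM.
by apply: (measurableT_comp (f := h)) => //; exact: CS_continuous_measurable.
Qed.

(** Since [infconv] lies below h and converges to it in mean under the limit law,
    the means of h along the sequence are eventually almost above the limit;
    applied to h and - h this gives the convergence. *)
Let lower_semi (h : CS S -> R) (M e : R) : continuous h -> (forall f, `|h f| <= M) -> 0 < e ->
  exists N0, forall N, (N0 <= N)%N ->
    mean P' (fun w => h (Z w)) - e <= mean P (fun w => h (Y N w)).
Proof.
move=> ch hM e0; have e20 : 0 < e / 2 by rewrite divr_gt0.
have M0 : 0 <= M by exact: le_trans (normr_ge0 _) (hM point).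
pose hk k := infconv h k.
have p0 k : 0 < M + k%:R + 1 by rewrite ltr_wpDl// addr_ge0.
have mk k : measurable_fun setT (hk k).
  have E : hk k = fun f => (M + k%:R + 1) * (hk k f / (M + k%:R + 1)).
    by apply/funext => f; rewrite mulrC divfK// gt_eqF.
  by rewrite E; apply: measurable_funM => //; apply: BL1_measurable => //; exact: infconv_BL1.
have hkb k f : `|hk k f| <= M by exact: infconv_bounded.
have L1hk k d1 (T1 : measurableType d1) (P1 : probability T1 R) (V : T1 -> CS S) :
    measurable_fun setT V -> L1 P1 (fun w => hk k (V w)).
  move=> mV; apply: (@L1_bounded _ _ _ _ _ M) => [|w]; last exact: hkb.
  exact: measurableT_comp.
have [_] := @dominated_mean _ _ _ P' (fun k w => hk k (Z w)) (fun w => h (Z w)) (fun=> M)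
  (fun k => L1_measurable (L1hk k _ _ P' Z mZ)) (L1_cst _ _) (fun k w => hkb k _)
  (fun w => @infconv_cvg h M hM ch (Z w)).
move=> /cvgrPdist_le/(_ (e / 2) e20)[k _ hk'].
have {}hk' := hk' k (leqnn k).
have e3 : 0 < e / 2 / (M + k%:R + 1) by rewrite divr_gt0.
have [N0 hN0] := cvgBL1 (infconv_BL1 hM k) e3; exists N0 => N NN.
have := hN0 N NN.
have E d1 (T1 : measurableType d1) (P1 : probability T1 R) (V : T1 -> CS S) : measurable_fun setT V ->
    mean P1 (fun w => hk k (V w) / (M + k%:R + 1)) = mean P1 (fun w => hk k (V w)) / (M + k%:R + 1).
  move=> mV; rewrite mulrC -meanZ; last exact: L1hk.
  by apply: eq_mean => w; rewrite mulrC.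
rewrite (E _ _ P (Y N))// (E _ _ P' Z)// -mulrBl normrM [ `|_^-1| ]gtr0_norm ?invr_gt0//.
rewrite ler_pM2r ?invr_gt0// => h1.
have h2 : mean P (fun w => hk k (Y N w)) <= mean P (fun w => h (Y N w)).
  by apply: le_mean => [||w]; [exact: L1hk|exact: L1_test hM _|exact: infconv_le].
by move: h1 hk'; rewrite !ler_norml /= => /andP[a1 a2] /andP[a3 a4]; lra.
Qed.

Lemma portmanteau : weak_cvg P P' Y Z.
Proof.
split=> // h ch [M hM].
have hL d1 (T1 : measurableType d1) (P1 : probability T1 R) (V : T1 -> CS S) :
    measurable_fun setT V -> 'E_P1[h \o V]%E = (mean P1 (fun w => h (V w)))%:E.
  by move=> mV; rewrite -expectationE//; exact: L1_test hM mV.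
rewrite hL//; under eq_fun do rewrite hL//.
apply: cvg_EFin; first exact: nearW.
apply/cvgrPdist_le => e e0.
have [N1 hN1] := lower_semi ch hM e0.
have chN : continuous (fun f => - h f) by move=> f; exact: (@cvgN R R (CS S) (nbhs f) _ h (h f) (@ch f)).
have hMN f : `|- h f| <= M by rewrite normrN.
have [N2 hN2] := lower_semi chN hMN e0.
exists (maxn N1 N2) => // N; rewrite /= geq_max => /andP[n1 n2].
have := hN1 N n1; have := hN2 N n2.
rewrite !meanN; [|exact: L1_test hM _|exact: L1_test hM _].
by move=> a1 a2; rewrite ler_norml /=; apply/andP; split; lra.
Qed.

End portmanteau.

(** * Samples are typical with high probability *)

Section vanishing_events.
Context (R : realType) d (T : measurableType d) (P : probability T R).

Definition vanishing (B : nat -> set T) : Prop :=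
  (forall N, measurable (B N)) /\
  forall e : R, 0 < e -> exists N0, forall N, (N0 <= N)%N -> (P (B N) <= e%:E)%E.

Lemma vanishingU B B' : vanishing B -> vanishing B' -> vanishing (fun N => B N `|` B' N).
Proof.
move=> [mB vB] [mB' vB']; split=> [N|e e0]; first exact: measurableU.
have e20 : 0 < e / 2 by rewrite divr_gt0.
have [N1 h1] := vB _ e20; have [N2 h2] := vB' _ e20.
exists (maxn N1 N2) => N; rewrite geq_max => /andP[n1 n2].
apply: le_trans (measureU2 _ _ _) _ => //.
by rewrite (splitr e) EFinD; apply: leeD; [exact: h1|exact: h2].
Qed.

Lemma vanishing_null (B : nat -> set T) :
  (forall N, measurable (B N)) -> (forall N, P (B N) = 0%E) -> vanishing B.
Proof. by move=> mB B0; split=> // e e0; exists 0%N => N _; rewrite B0 lee_fin ltW. Qed.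

Lemma vanishing_fin (I : finType) (B : I -> nat -> set T) : (forall i, vanishing (B i)) ->
  exists2 B', vanishing B' & forall N i, B i N `<=` B' N.
Proof.
move=> vB.
have [B' vB' h] : exists2 B', vanishing B' & forall N i, i \in enum I -> B i N `<=` B' N.
  elim: (enum I) => [|i s [B' vB' h]].
    by exists (fun=> set0) => //; apply: vanishing_null => N; rewrite ?measure0.
  exists (fun N => B i N `|` B' N) => [|N j]; first exact: vanishingU.
  by rewrite inE => /orP[/eqP-> w|js w]; [left|right; exact: (h N j js w)].
by exists B' => // N i; apply: h; rewrite mem_enum.
Qed.

End vanishing_events.

Lemma mulmx_rowE (R : comPzRingType) K (a b : 'rV[R]_K) (M : 'M[R]_K) :
  (a *m M *m b^T) 0 0 = \sum_k \sum_l a 0 k * b 0 l * M k l.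
Proof.
rewrite mxE.
under eq_bigr => l _ do rewrite !mxE mulr_suml.
by rewrite exchange_big; apply: eq_bigr => k _; apply: eq_bigr => l _; rewrite mulrAC.
Qed.

Section typical_samples.
Context (R : realType) (D : nat) (S : set 'rV[R]_D).
Hypothesis cS : compact S.
Variables (s0 : S) (alpha : R).
Hypothesis alpha0 : 0 < alpha.
Context d (T : measurableType d) (P : probability T R) (X : {RV P >-> CS S}).
Variable Xn : nat -> {RV P >-> CS S}.
Hypothesis indepX : mutually_independent P Xn.
Hypothesis lawX : forall n, same_law P P (Xn n) X.
Context (K : nat) (H : 'rV[R]_K -> R) (HC1 : C1 H) (r : 'I_K -> nat) (p : nat).
Hypothesis p0 : (0 < p)%N.
Hypothesis rp : forall k, (r k <= p)%N.
Hypothesis Xh : Lp_hoelder P (2 * p) alpha X.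
Hypothesis X2p : exists s : S, ('E_P[fun w => (X w s ^+ (2 * p))%R] < +oo)%E.
Local Notation rep := (@rep R D S cS s0 _).
Local Notation bnd := (bound alpha X p).

Definition mom (k : 'I_K) (s : S) : R := moment P X (r k) s.

Lemma hoelder_continuous (f : S -> R) (b : R) : 0 <= b -> hoelder alpha b f -> continuous f.
Proof.
move=> b0 fb; apply/continuous_rhoP => s e e0.
have eb : 0 < e / (b + 1) by rewrite divr_gt0// ltr_wpDl.
exists ((e / (b + 1)) `^ alpha^-1); first by rewrite powR_gt0.
move=> s' ss'; apply: le_lt_trans (fb s s') _.
have h : rho s s' `^ alpha < e / (b + 1).
  have -> : e / (b + 1) = ((e / (b + 1)) `^ alpha^-1) `^ alpha.
    by rewrite -powRrM mulVf ?powRr1 ?ltW// lt0r_neq0.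
  by apply: gt0_ltr_powR => //; rewrite nnegrE ?rho_ge0 ?powR_ge0.
apply: le_lt_trans (_ : (b + 1) * rho s s' `^ alpha < e).
  by apply: ler_wpM2r; rewrite ?powR_ge0// lerDl.
by rewrite mulrC -ltr_pdivlMr// ltr_wpDl.
Qed.

Lemma continuous_mom k : continuous (mom k).
Proof.
apply: (@hoelder_continuous _ (p%:R * hmean alpha X p)).
  by rewrite mulr_ge0// hmean_ge0.
exact: moment_hoelder.
Qed.

Definition second_moment : R := mean P (fun w => bnd (X w) ^+ 2) + 1.

Lemma second_moment_ge0 : 0 <= second_moment.
Proof. by rewrite addr_ge0// mean_ge0// => w; exact: sqr_ge0. Qed.

Let law0 n : same_law P P (Xn n) (Xn 0%N).
Proof. by move=> A mA; rewrite lawX// lawX. Qed.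

Lemma lln_vanishing (w : CS S -> R) (e : R) : measurable_fun setT w -> L1 P (w \o X) -> 0 < e ->
  vanishing P (fun N => [set x | e < `|avg Xn w N x - mean P (w \o X)|]).
Proof.
move=> mw w1 e0; have [w10 w2] := same_law_mean (lawX 0) mw w1.
have LA N : L1 P (fun x => `|avg Xn w N x - mean P (w \o X)|).
  by apply: L1_abs; apply: L1B; [exact: L1_avg|exact: L1_cst].
split=> [N|e' e'0]; first by apply: measurable_gt; exact: L1_measurable (LA N).
have [N0 hN0] := lln_mean indepX law0 mw w10 (mulr_gt0 e'0 e0); exists N0 => N NN.
apply: le_trans (markov_mean (LA N) _ e0) _ => //.
by rewrite lee_fin ler_pdivrMr// -w2; exact: hN0.
Qed.

Let meval (s : S) : measurable_fun setT (fun f : CS S => f s).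
Proof. exact: measurable_eval. Qed.

Lemma moment_vanishing k s (e : R) : 0 < e ->
  vanishing P (fun N => [set x | e < `|emp_moment (fun n : 'I_N => Xn n x) (r k) s - mom k s|]).
Proof.
move=> e0; rewrite /mom (momentE cS alpha0 Xh X2p s (rp k)).
apply: (@lln_vanishing (fun f => f s ^+ r k)) => //; first exact: measurable_funX.
exact: (L1_power cS alpha0 Xh X2p s (rp k)).
Qed.

Lemma sqr_vanishing : vanishing P (fun N =>
  [set x | 1 < `|avg Xn (fun f => bnd f ^+ 2) N x - mean P (fun w => bnd (X w) ^+ 2)|]).
Proof.
apply: (@lln_vanishing (fun f => bnd f ^+ 2)) => //.
  by apply: measurable_funX; exact: measurable_bound.
exact: L1_bound_sqr.
Qed.

Lemma max_vanishing (dl : R) : 0 < dl ->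
  vanishing P (fun N => exceed Xn (fun f => bnd f ^+ 2) N (dl * N%:R)).
Proof.
move=> dl0; have mb : measurable_fun setT (fun f : CS S => bnd f ^+ 2).
  by apply: measurable_funX; exact: measurable_bound.
have b1 : L1 P ((fun f => bnd f ^+ 2) \o X) by exact: L1_bound_sqr.
split=> [N|e e0]; first exact: measurable_exceed.
have [b10 _] := same_law_mean (lawX 0) mb b1.
by apply: (max_small law0 mb _ b10 dl0 e0) => f; exact: sqr_ge0.
Qed.

Definition irregular_sample N : set T :=
  \bigcup_(n in [set n | (n < N)%N]) (Xn n @^-1` (~` levels alpha)).

Lemma irregular_vanishing : vanishing P irregular_sample.
Proof.
have ml : measurable (~` @levels R D S alpha) by apply: measurableC; exact: measurable_levels.
have mi n : measurable (Xn n @^-1` (~` levels alpha)).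
  by rewrite -[X in measurable X]setTI; apply: (measurable_funP (Xn n)).
apply: vanishing_null => N; first by apply: bigcup_measurable.
apply/negligibleP; first by apply: bigcup_measurable.
apply: (@negligibleS _ _ _ _ (\bigcup_n (Xn n @^-1` (~` levels alpha)))).
  by apply: bigcup_subset => n.
apply: negligible_bigcup => n; apply/negligibleP; first exact: mi.
by apply: (etrans (lawX n ml)); exact: (hnorm_moment cS alpha0 Xh X2p).1.
Qed.

Let residf (s : S) (f : CS S) : R := \sum_k slope H mom k s * (f s ^+ r k - mom k s).

Let centered k s w : R := X w s ^+ r k - mom k s.

Let L1c k l s s' : L1 P (fun w => centered k s w * centered l s' w) /\
  mean P (fun w => centered k s w * centered l s' w) =
  mean P (fun w => X w s ^+ r k * X w s' ^+ r l) - mom k s * mom l s'.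
Proof.
have Lk k' s1 := L1_power cS alpha0 Xh X2p s1 (rp k').
have Lkl := L1_power2 cS alpha0 Xh X2p s s' (rp k) (rp l).
have E : (fun w => centered k s w * centered l s' w) =1 fun w =>
    X w s ^+ r k * X w s' ^+ r l - mom l s' * X w s ^+ r k -
      mom k s * X w s' ^+ r l + mom k s * mom l s'.
  by move=> w; rewrite /centered; ring.
have L1' := L1Z (mom l s') (Lk k s); have L2' := L1Z (mom k s) (Lk l s').
have L3 := L1B Lkl L1'; have L4 := L1B L3 L2'.
split; first by apply: (eq_L1 (fsym E)); apply: L1D => //; exact: L1_cst.
rewrite (eq_mean P E) meanD//; last exact: L1_cst.
rewrite mean_cst meanB// meanB// !meanZ//.
rewrite -(momentE cS alpha0 Xh X2p s (rp k)) -(momentE cS alpha0 Xh X2p s' (rp l)).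
by rewrite /mom; ring.
Qed.

(** [cov_delta] is the mean of the product of the residuals at s and s', so this is
    the law of large numbers for that product. *)
Lemma cov_vanishing s s' (e : R) : 0 < e ->
  vanishing P (fun N => [set x | e < `|N%:R^-1 *
    (\sum_(n < N) resid H r mom (fun n : 'I_N => Xn n x) n s * resid H r mom (fun n : 'I_N => Xn n x) n s') -
    cov_delta P H X r s s'|]).
Proof.
move=> e0; pose w f := residf s f * residf s' f.
have E : (w \o X) =1 fun x => \sum_k \sum_l slope H mom k s * slope H mom l s' *
    (centered k s x * centered l s' x).
  move=> x; rewrite /w /= /residf big_distrlr /=; apply: eq_bigr => k _; apply: eq_bigr => l _.
  by rewrite /centered; ring.
have LL k l : L1 P (fun x => slope H mom k s * slope H mom l s' * (centered k s x * centered l s' x)).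
  by apply: L1Z; exact: (L1c k l s s').1.
have w1 : L1 P (w \o X).
  by apply: (eq_L1 (fsym E)); apply: L1_sum => k _; apply: L1_sum => l _.
have mw : measurable_fun setT w.
  have mr s1 : measurable_fun setT (residf s1).
    apply: measurable_sum => k; apply: measurable_funM => //; apply: measurable_funB => //.
    exact: measurable_funX.
  exact: measurable_funM.
have -> : cov_delta P H X r s s' = mean P (w \o X).
  rewrite (eq_mean P E) mean_sum; last by move=> k _; apply: L1_sum.
  rewrite /cov_delta mulmx_rowE; apply: eq_bigr => k _; rewrite mean_sum//.
  apply: eq_bigr => l _; rewrite meanZ; last exact: (L1c k l s s').1.
  rewrite (L1c k l s s').2; congr (_ * _); rewrite mxE; congr (_ - _).
  by rewrite expectationE//; exact: (L1_power2 cS alpha0 Xh X2p s s' (rp k) (rp l)).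
exact: lln_vanishing.
Qed.

(** The union of finitely many vanishing events. The moments are compared at the
    points of a fine net only; the Hölder bound, with a constant whose average over
    the sample is bounded, carries this over to all of S. *)
Theorem typical_vanishing (J : nat) (dl : R) : 0 < dl ->
  exists2 B : nat -> set T, vanishing P B & forall N w, (0 < N)%N -> ~ B N w ->
    typical cS s0 alpha (cov_delta P H X r) H r mom J dl second_moment
      (fun n : 'I_N => Xn n w) (fun n : 'I_N => bnd (Xn n w)).
Proof.
move=> dl0; have dl20 : 0 < dl / 2 by rewrite divr_gt0.
have [J' hJ'] : exists J', (1 + second_moment) * mesh R J' `^ alpha <= dl / 2.
  have : (1 + second_moment) * theta alpha ^+ j @[j --> \oo] --> ((1 + second_moment) * 0 : R).
    apply: cvgM; first exact: cvg_cst.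
    by apply: cvg_expr; case/andP: (theta01 alpha0) => t0 t1; rewrite ger0_norm// ltW.
  rewrite mulr0 => /cvgrPdist_le/(_ _ dl20)[J' _ h]; exists J'.
  by have := h J' (leqnn _); rewrite mesh_powR /= sub0r normrN; exact: le_trans (ler_norm _).
have [B1 vB1 hB1] := vanishing_fin (fun cc : cells cS J * cells cS J =>
  cov_vanishing (rep cc.1) (rep cc.2) dl0).
have [B2 vB2 hB2] := vanishing_fin (fun kc : 'I_K * cells cS J' =>
  moment_vanishing kc.1 (rep kc.2) dl20).
have dl2 : 0 < dl ^+ 2 by rewrite exprn_gt0.
have vB := vanishingU (vanishingU irregular_vanishing (vanishingU sqr_vanishing (max_vanishing dl2)))
  (vanishingU vB1 vB2).
eexists; first exact: vB.
move=> N w N0 nB.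
have NR : 0 < N%:R :> R by rewrite ltr0n.
have reg (n : 'I_N) : levels alpha (Xn n w).
  by apply: contrapT => h; apply: nB; left; left; exists n => /=.
have nsqr : N%:R^-1 * (\sum_(n < N) bnd (Xn n w) ^+ 2) <= second_moment.
  have : `|avg Xn (fun f => bnd f ^+ 2) N w - mean P (fun w => bnd (X w) ^+ 2)| <= 1.
    by rewrite leNgt; apply/negP => h; apply: nB; left; right; left.
  by rewrite /second_moment ler_norml /avg => /andP[_]; lra.
have nmax (n : 'I_N) : bnd (Xn n w) ^+ 2 <= dl ^+ 2 * N%:R.
  by apply: (@exceedN _ _ _ _ _ Xn (fun f => bnd f ^+ 2)) => h; apply: nB; left; right; right.
have nmean k (c : cells cS J') : `|emp_moment (fun n : 'I_N => Xn n w) (r k) (rep c) - mom k (rep c)| <= dl / 2.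
  by rewrite leNgt; apply/negP => h; apply: nB; right; right; exact: (hB2 N (k, c)).
split.
- by move=> n; exact: bound_ge0.
- by move=> n k s; apply: bound_centered.
- by move=> n k; apply: bound_hoelder.
- exact: nsqr.
- move=> n; have dN : 0 <= dl * Num.sqrt N%:R by rewrite mulr_ge0 ?sqrtr_ge0// ltW.
  rewrite -(ler_sqr (bound_ge0 _ _ _ _) dN) [leRHS]exprMn sqr_sqrtr ?ler0n//; exact: nmax.
- move=> c c'; rewrite leNgt; apply/negP => h; apply: nB; right; left.
  exact: (hB1 N (c, c')).
move=> k s; pose c := cell cS J' s.
pose v n s := Xn n w s ^+ r k - mom k s.
have E s1 : emp_moment (fun n : 'I_N => Xn n w) (r k) s1 - mom k s1 = N%:R^-1 * \sum_(n < N) v n s1.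
  rewrite /emp_moment /v sumrB sumr_const card_ord mulrBr -[mom k s1 *+ N]mulr_natl mulKf//.
  by rewrite gt_eqF.
rewrite -(subrK (emp_moment (fun n : 'I_N => Xn n w) (r k) (rep c) - mom k (rep c)) (_ - mom k s)).
apply: le_trans (ler_normD _ _) _; rewrite (splitr dl); apply: lerD; last exact: nmean.
rewrite !E -mulrBr -sumrB normrM gtr0_norm ?invr_gt0//.
apply: le_trans hJ'; rewrite ler_pdivrMl//.
apply: le_trans (ler_norm_sum _ _ _) _.
apply: (@le_trans _ _ (\sum_(n < N) (1 + bnd (Xn n w) ^+ 2) * mesh R J' `^ alpha)).
  apply: ler_sum => n _.
  apply: le_trans (bound_hoelder cS alpha0 Xh X2p (rp k) (reg n) s (rep c)) _.
  apply: ler_pM; rewrite ?bound_ge0 ?powR_ge0//.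
    have := sqr_ge0 (bnd (Xn n w) - 1); rewrite sqrrB expr1n mulr1.
    have := sqr_ge0 (bnd (Xn n w)); have := bound_ge0 alpha X p (Xn n w).
    by move: (bnd _) => y; lra.
  by apply: ge0_ler_powR; rewrite ?nnegrE ?rho_ge0 ?(ltW alpha0) ?(ltW (mesh_gt0 _ _)) ?ltW ?rep_close.
rewrite -mulr_suml mulrA; apply: ler_wpM2r; first exact: powR_ge0.
rewrite big_split/= sumr_const card_ord mulrDr mulr1 lerD2l.
by rewrite -ler_pdivrMl.
Qed.

End typical_samples.

(** * The multipliers and the product space *)

Section multipliers.
Context (R : realType) d (T : measurableType d) (P : probability T R).
Context (I : choiceType) (Y : I -> {RV P >-> R}) (i0 : I).
Hypothesis iidY : iid Y.
Hypothesis EY : forall i, 'E_P[Y i]%E = 0%E.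
Hypothesis EY2 : forall i, 'E_P[fun w => (Y i w ^+ 2)%R]%E = 1%E.

Let mY i : measurable_fun setT (Y i) := measurable_funP (Y i).

Lemma multiplier_L1_sqr i : L1 P (fun w => Y i w ^+ 2).
Proof.
apply/L1P; split; first exact: measurable_funX.
rewrite (eq_integral (fun w => (Y i w ^+ 2)%:E)); last first.
  by move=> w _; rewrite ger0_norm ?sqr_ge0.
by have := EY2 i; rewrite unlock => ->; rewrite ltry.
Qed.

Lemma multiplier_var i : mean P (fun w => Y i w ^+ 2) = 1.
Proof. by apply: EFin_inj; rewrite -expectationE; [exact: EY2|exact: multiplier_L1_sqr]. Qed.

Lemma multiplier_L1 i : L1 P (Y i).
Proof. by apply: L1_sqrt => //; exact: multiplier_L1_sqr. Qed.

Lemma multiplier_mean i : mean P (Y i) = 0.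
Proof. by apply: EFin_inj; rewrite -expectationE; [exact: EY|exact: multiplier_L1]. Qed.

(** Dominated convergence for one multiplier; the others have the same law. *)
Lemma multiplier_lindeberg (e : R) : 0 < e -> exists2 dl0 : R, 0 < dl0 &
  forall dl : R, 0 < dl <= dl0 -> forall i,
    mean P (fun w => Y i w ^+ 2 * Num.min 1 (dl * `|Y i w|)) <= e.
Proof.
move=> e0; pose F (dl y : R) : R := y ^+ 2 * Num.min 1 (dl * `|y|).
have mF dl : measurable_fun setT (F dl).
  apply: measurable_funM; first exact: measurable_funX.
  apply: measurable_minr; first exact: measurable_cst.
  by apply: measurable_funM; [exact: measurable_cst|exact: normr_measurable].
have F0 dl y : 0 <= dl -> 0 <= F dl y.
  by move=> h; rewrite mulr_ge0 ?sqr_ge0// le_min ler01/= mulr_ge0.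
have FY dl y : 0 <= dl -> `|F dl y| <= y ^+ 2.
  move=> h; rewrite ger0_norm ?F0// /F; apply: ler_piMr; first exact: sqr_ge0.
  by rewrite ge_min lexx.
have LF dl i : 0 <= dl -> L1 P (F dl \o Y i).
  move=> h; apply: (L1_le _ (multiplier_L1_sqr i)) => [|w]; first exact: measurableT_comp.
  exact: FY.
have n0 n : 0 <= n.+1%:R^-1 :> R by rewrite invr_ge0.
have cv w : F n.+1%:R^-1 (Y i0 w) @[n --> \oo] --> (0 : R).
  apply: (@squeeze_cvgr _ _ _ _ (fun=> 0) (fun n => (Y i0 w ^+ 2 * `|Y i0 w|) * n.+1%:R^-1)).
  - near=> n; rewrite F0//= /F -mulrA; apply: ler_wpM2l; first exact: sqr_ge0.
    by rewrite mulrC ge_min lexx orbT.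
  - exact: cvg_cst.
  - rewrite -[X in _ --> X](mulr0 (Y i0 w ^+ 2 * `|Y i0 w|)).
    apply: cvgM; first exact: cvg_cst.
    exact: cvg_harmonic.
have [_] := @dominated_mean _ _ _ P (fun n w => F n.+1%:R^-1 (Y i0 w)) (fun=> 0)
  (fun w => Y i0 w ^+ 2) (fun n => L1_measurable (LF _ i0 (n0 n))) (multiplier_L1_sqr i0)
  (fun n w => FY _ _ (n0 n)) cv.
rewrite mean_cst => /cvgrPdist_le/(_ e e0)[n _ hn]; exists n.+1%:R^-1; first by rewrite invr_gt0.
move=> dl /andP[dl0 dln] i.
have [_ E] := same_law_mean (iidY.2 i i0) (mF dl) (LF dl i0 (ltW dl0)).
rewrite [leLHS]E.
have := hn n (leqnn n); rewrite /= sub0r normrN; move=> /(le_trans (ler_norm _)).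
apply: le_trans; apply: le_mean => [||w]; [exact: LF (ltW dl0)|exact: LF|].
apply: ler_wpM2l; first exact: sqr_ge0.
rewrite le_min ge_min lexx/= ge_min; apply/orP; right.
by apply: ler_wpM2r.
Unshelve. all: by end_near. Qed.

End multipliers.

Section product_mean.
Context (R : realType) d (T : measurableType d) (P : probability T R).
Context d' (T' : measurableType d') (P' : probability T' R).

Lemma mean_prod (F : T * T' -> R) : L1 (P \x P')%E F ->
  (forall x, L1 P' (fun y => F (x, y))) ->
  L1 P (fun x => mean P' (fun y => F (x, y))) /\
  mean (P \x P')%E F = mean P (fun x => mean P' (fun y => F (x, y))).
Proof.
move=> F1 Fx.
have E : fubini_F P' (EFin \o F) = EFin \o (fun x => mean P' (fun y => F (x, y))).
  by apply/funext => x; rewrite /fubini_F /= -meanE.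
have h1 : L1 P (fun x => mean P' (fun y => F (x, y))).
  by rewrite /L1 -E; exact: integrable_fubini_F F1.
split => //; apply: EFin_inj; rewrite -!meanE//.
rewrite -[LHS](integral12_prod_meas1 F1) E.
by apply: eq_integral.
Qed.

End product_mean.

Section joint_measurability.
Context (R : realType) (D : nat) (S : set 'rV[R]_D).
Hypothesis cS : compact S.
Variable s0 : S.
Context (K : nat) (H : 'rV[R]_K -> R) (HC1 : C1 H) (r : 'I_K -> nat) (N : nat).
Context d (T : measurableType d) (x : 'I_N -> T -> CS S) (a : 'I_N -> T -> R).
Hypothesis mx : forall n, measurable_fun setT (x n).
Hypothesis ma : forall n, measurable_fun setT (a n).

Let fin_dH k : fin_continuous (fun z : 'I_K -> R => dH H (\row_l z l) 0 k).
Proof.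
move=> z e e0; have cH : continuous (fun y => dH H y 0 k).
  move=> y; apply: (@continuous_comp _ _ _ (dH H) (fun M : 'rV[R]_K => M 0 k)).
    exact: HC1.2.
  exact: coord_continuous.
have /nbhs_ballP[dl /= dl0 h] := @cH (\row_l z l) _ (nbhsx_ballx _ e e0).
exists (dl / 2); first by rewrite divr_gt0.
move=> z' zz'; apply/ltW; apply: h; split => // i l; rewrite !mxE.
by apply: le_lt_trans (zz' l) _; lra.
Qed.

(** Joint measurability: at each s the process is a continuous function of finitely
    many measurable variables. *)
Lemma measurable_joint_bootstrap :
  measurable_fun setT (fun w => bootstrap r (fun n => x n w) HC1 (fun n => a n w)).
Proof.
apply: CS_measurable => // s.
rewrite (_ : (fun w => _) = fun w => bootstrap_fun H r (fun n => x n w) (fun n => a n w) s)//.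
have mxs n q : measurable_fun setT (fun w => x n w s ^+ q).
  apply: measurable_funX; apply: (measurableT_comp (f := fun f : CS S => f s)) => //.
  exact: measurable_eval.
have mm q : measurable_fun setT (fun w => emp_moment (fun n => x n w) q s).
  by apply: measurable_funM => //; exact: measurable_sum.
apply: measurable_funM => //; apply: measurable_sum => n; apply: measurable_funM => //.
rewrite (_ : (fun w => _) = fun w => \sum_k
    dH H (\row_l emp_moment (fun n => x n w) (r l) s) 0 k *
    (x n w s ^+ r k - emp_moment (fun n => x n w) (r k) s)); last first.
  apply/funext => w; rewrite /delta_residual mxE; apply: eq_bigr => k _.
  by congr (_ * _); rewrite 2!mxE.
apply: measurable_sum => k; apply: measurable_funM; last exact: measurable_funB.
exact: (measurable_fin_continuous (fin_dH k) (fun l => mm (r l))).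
Qed.

End joint_measurability.

(** * Weak convergence of the multiplier bootstrap *)

Lemma vanishing_cvg (R : realType) d (T : measurableType d) (P : probability T R)
    (B : nat -> set T) : vanishing P B -> P (B N) @[N --> \oo] --> 0%E.
Proof.
move=> [mB vB]; rewrite (_ : (fun N => P (B N)) = EFin \o (fun N => fine (P (B N)))); last first.
  by apply/funext => N /=; rewrite prob_fine.
apply: cvg_EFin; first exact: nearW.
apply/cvgrPdist_le => e e0; have [N0 hN0] := vB e e0; exists N0 => // N /= NN.
rewrite sub0r normrN ger0_norm; last by apply: fine_ge0; exact: measure_ge0.
by rewrite -lee_fin prob_fine//; exact: hN0.
Qed.

Lemma vanishing_outer (R : realType) d (T : measurableType d) (P : probability T R)
    (B A : nat -> set T) : vanishing P B -> (forall N, (0 < N)%N -> A N `<=` B N) ->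
  mu_ext P (A N) @[N --> \oo] --> 0%E.
Proof.
move=> vB AB; apply: (squeeze_cvge (f := fun=> 0%E) (h := fun N => P (B N)) _ (cvg_cst _) (vanishing_cvg vB)).
near=> N; rewrite mu_ext_ge0/=.
have N0 : (0 < N)%N by near: N; exact: nbhs_infty_gt.
apply: le_trans (le_mu_ext P (AB N N0)) _.
by rewrite (measurable_mu_extE _ (vB.1 N)).
Unshelve. all: by end_near. Qed.

Theorem theorem3 (R : realType) (D : nat) (S : set 'rV[R]_D)
    (dO : measure_display) (Omega : measurableType dO) (P : probability Omega R)
    (dg : measure_display) (Omega_g : measurableType dg)
    (Pg : probability Omega_g R)
    (dG : measure_display) (Omega_G : measurableType dG)
    (PG : probability Omega_G R)
    (K : nat) (r : 'I_K.+1 -> nat) (H : 'rV[R]_K.+1 -> R)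
    (X : {RV P >-> CS S}) (Xn : nat -> {RV P >-> CS S})
    (g : forall N : nat, 'I_N -> {RV Pg >-> R})
    (Gt : {RV PG >-> CS S}) (HC1 : C1 H) :
  compact S ->
  iid Xn -> (forall n, same_law P P (Xn n) X) ->
  (1 <= r ord0)%N -> (forall k l : 'I_K.+1, (k < l)%N -> (r k < r l)%N) ->
  (exists2 alpha : R, 0 < alpha <= 1 & Lp_hoelder P (2 * r ord_max) alpha X) ->
  (exists s : S, 'E_P[fun w => (X w s ^+ (2 * r ord_max))%R] < +oo)%E ->
  zero_mean_gaussian_with_cov PG Gt (cov_delta P H X r) ->
  iid (fun i : {N : nat & 'I_N} => g (tag i) (tagged i)) ->
  (forall N (n : 'I_N), 'E_Pg[g N n] = 0)%E ->
  (forall N (n : 'I_N), 'E_Pg[fun w => (g N n w ^+ 2)%R] = 1)%E ->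
  let GN N (wo : Omega) (wg : Omega_g) : CS S :=
    bootstrap r (fun n : 'I_N => Xn n wo) HC1 (fun n : 'I_N => g N n wg) in
  weak_cvg (P \x Pg)%E PG (fun N w => GN N w.1 w.2) Gt /\
  cvg_to0_in_prob P (fun N wo =>
    ereal_sup [set `| 'E_Pg[fun wg => h (GN N wo wg)] - 'E_PG[fun w => h (Gt w)] |
              | h in BL1 S])%E.
Proof.
move=> cS [indepX lawXX] lawX r1 rmono [alpha /andP[alpha0 alpha1] Xh] X2p GtC iidg Eg Eg2 GN.
have [s0 _] := X2p.
have rp k : (r k <= r ord_max)%N.
  have [->//|kmax] := eqVneq k ord_max; apply/ltnW/rmono.
  by rewrite ltn_neqAle kmax/= -ltnS ltn_ord.
have p0 : (0 < r ord_max)%N := leq_trans r1 (rp ord0).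
pose Y (i : {N : nat & 'I_N}) : {RV Pg >-> R} := g (tag i) (tagged i).
pose i0 : {N : nat & 'I_N} := existT _ 1%N ord0.
have EY i : 'E_Pg[Y i]%E = 0%E by exact: Eg.
have EY2 i : 'E_Pg[fun w => (Y i w ^+ 2)%R]%E = 1%E by exact: Eg2.
pose emb N (n : 'I_N) : {N : nat & 'I_N} := existT _ N n.
have emb_inj N : injective (@emb N).
  by move=> n m /eqP; rewrite /emb -[existT _ N m]/(Tagged _ m) eq_Tagged => /eqP.
have mGt : measurable_fun setT Gt by exact: measurable_funP.
(* The bad event is the same for all tests h, hence the supremum in (ii). *)
have close (e : R) : 0 < e -> exists2 B, vanishing P B & forall N w, (0 < N)%N -> ~ B N w ->
    forall h, BL1 S h ->
    `|mean Pg (fun wg => h (GN N w wg)) - mean PG (fun w => h (Gt w))| <= e.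
  move=> e0.
  have [J [dl dl0 hJ]] := bootstrap_close cS s0 alpha0 (multiplier_L1 EY2) (multiplier_mean EY EY2)
    (multiplier_L1_sqr EY2) (multiplier_var EY2) iidg.1 (multiplier_lindeberg i0 iidg EY2) GtC HC1 r
    (continuous_mom cS alpha0 rp Xh X2p) e0 (second_moment_ge0 alpha X (r ord_max)).
  have [B vB hB] := typical_vanishing cS s0 alpha0 indepX lawX H p0 rp Xh X2p J dl0.
  exists B => // N w N0 nB h hh.
  exact: (hJ N _ _ (@emb N) N0 (@emb_inj N) (hB N w N0 nB) h hh).
have mGN N w : measurable_fun setT (fun wg => GN N w wg).
  apply: (@measurable_joint_bootstrap _ _ _ cS s0 _ _ HC1 r N _ _
    (fun n _ => Xn n w) (fun n => g N n)) => // n; exact: measurable_funP.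
have mGN2 N : measurable_fun setT (fun w => GN N w.1 w.2).
  apply: (@measurable_joint_bootstrap _ _ _ cS s0 _ _ HC1 r N _ _
    (fun (n : 'I_N) w => Xn n w.1) (fun n w => g N n w.2)) => n.
    by apply: (measurableT_comp (f := Xn n)); [exact: measurable_funP|exact: measurable_fst].
  by apply: (measurableT_comp (f := g N n)); [exact: measurable_funP|exact: measurable_snd].
split; last first.
  move=> e e0; have [B vB hB] := close e e0.
  apply: (vanishing_outer vB) => N N0 w /= eU; apply: contrapT => nB; move: eU; apply/negP; rewrite -leNgt.
  have dE h : BL1 S h -> (`|'E_Pg[fun wg => h (GN N w wg)] - 'E_PG[fun w => h (Gt w)]| =
      `|mean Pg (fun wg => h (GN N w wg)) - mean PG (fun w => h (Gt w))|%:E)%E.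
    by move=> hh; rewrite !expectationE//; exact: BL1_L1.
  have B0 : BL1 S (cst 0 : CS S -> R).
    split=> [f|f f']; first by rewrite normr0.
    by rewrite subrr normr0; exact: dist_ge0.
  rewrite gee0_abs.
    by apply: ge_ereal_sup => _ [h hh <-]; rewrite dE// lee_fin; exact: hB.
  have : ((0 : R)%:E <= `|mean Pg (fun wg => (cst 0 : CS S -> R) (GN N w wg)) -
      mean PG (fun w => (cst 0 : CS S -> R) (Gt w))|%:E)%E by rewrite lee_fin.
  by move=> /le_trans; apply; rewrite -dE//; apply: ereal_sup_ubound; exists (cst 0).
apply: (portmanteau cS s0) => // h hh e e0.
have e20 : 0 < e / 2 by rewrite divr_gt0.
have e40 : 0 < e / 4 by rewrite divr_gt0.
have [B [mB vB] hB] := close _ e20; have [N0 hN0] := vB _ e40.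
exists N0.+1 => N NN; have {}hN0 := hN0 N (ltnW NN).
have Npos : (0 < N)%N by exact: leq_trans NN.
pose phi w := mean Pg (fun wg => h (GN N w wg)).
pose m := mean PG (fun w => h (Gt w)).
have h1 f : `|h f| <= 1 by exact: hh.1.
have L1h d0 (T0 : measurableType d0) (P0 : probability T0 R) (V : T0 -> CS S) :
    measurable_fun setT V -> L1 P0 (fun w => h (V w)) by exact: BL1_L1.
have [L1phi ->] := @mean_prod _ _ _ P _ _ Pg (fun w => h (GN N w.1 w.2))
  (L1h _ _ _ _ (mGN2 N)) (fun w => L1h _ _ _ _ (mGN N w)).
rewrite -/m -[X in _ - X](mean_cst P m) -meanB//; last exact: L1_cst.
(* Off B N the difference is at most e / 2, and everywhere it is at most 2. *)
pose b w : R := e / 2 + 2 * \1_(B N) w.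
have b1 : L1 P (fun w => 2 * \1_(B N) w) by apply: L1Z; exact: L1_indic.
apply: (@le_trans _ _ (mean P b)).
  apply: mean_abs_le => [||w]; [by apply: L1B => //; exact: L1_cst|by apply: L1D => //; exact: L1_cst|].
  rewrite /b indicE; case: (boolP (w \in B N)) => [_|/negP nB].
    rewrite mulr1; apply: ler_wpDl; first exact: ltW.
    apply: le_trans (ler_normB _ _) _; apply: (@le_trans _ _ (1 + 1)); last by lra.
    apply: lerD; apply: mean_abs_bound => // .
      by apply: L1_measurable; exact: (L1h _ _ Pg _ (mGN N w)).
    by apply: L1_measurable; exact: (L1h _ _ PG _ mGt).
  rewrite mulr0 addr0; apply: hB => //.
  by move=> wB; apply: nB; rewrite inE.
rewrite /b meanD//; last exact: L1_cst.
rewrite mean_cst meanZ; last exact: L1_indic.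
have : fine (P (B N)) <= e / 4 by rewrite -lee_fin prob_fine.
rewrite mean_indic//; lra.
Qed.
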